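(* Let $\Bbbk$ be an algebraically closed field of characteristic $p>2$. Let $\epsilon\in\{1,-1\}$, $q_{12},q_{21},q_{22}\in\Bbbk^\times$ and $a\in\Bbbk$, and let $V$ be the braided vector space with basis $x_1,x_2,x_3$ and braiding $$c(x_i\otimes x_1)=\epsilon x_1\otimes x_i,\quad c(x_i\otimes x_2)=(\epsilon x_2+x_1)\otimes x_i,\quad c(x_i\otimes x_3)=q_{12}x_3\otimes x_i\quad (i=1,2),$$ $$c(x_3\otimes x_1)=q_{21}x_1\otimes x_3,\quad c(x_3\otimes x_2)=q_{21}(x_2+a x_1)\otimes x_3,\quad c(x_3\otimes x_3)=q_{22}x_3\otimes x_3.$$ Suppose that one of the following holds: (1) $\epsilon=1$, $q_{12}q_{21}=1$, $q_{22}=1$, $a\in\mathbb{F}_p^\times$; (2) $\epsilon=1$, $q_{12}q_{21}=1$, $q_{22}=-1$, $a\in\mathbb{F}_p^\times$; (3) $\epsilon=1$, $q_{12}q_{21}=1$, $q_{22}$ is a primitive cube root of unity, and $2a=-1$; (4) $\epsilon=-1$, $q_{12}q_{21}=1$, $q_{22}=1$, $a\in\mathbb{F}_p^\times$; (5) $\epsilon=-1$, $q_{12}q_{21}=1$, $q_{22}=-1$, $a\in\mathbb{F}_p^\times$; (6) $\epsilon=-1$, $q_{12}q_{21}=-1$, $q_{22}=-1$, $a=1$. Then the Nichols algebra $\mathfrak{B}(V)$ is finite-dimensional.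
   Context: $\mathbb{F}_p\subseteq\Bbbk$ is the prime field. For a braided vector space $(V,c)$, the Nichols algebra $\mathfrak{B}(V)$ is $T(V)/\mathcal{J}(V)$, where $\mathcal{J}(V)$ is the largest homogeneous Hopf ideal of the braided Hopf algebra $T(V)$ contained in $\bigoplus_{n\ge2}T^n(V)$. (In case (3), the value of the paper's normalized ''ghost'' is $1$, i.e. $2a\equiv -1 \pmod p$.) *)

(* Defs.v *)
From HB Require Import structures.
From mathcomp Require Import all_boot all_order all_algebra.
Set Implicit Arguments. Unset Strict Implicit. Unset Printing Implicit Defensive.
Import GRing.Theory.
Local Open Scope ring_scope.

Section Tensor.
Variable K : fieldType.

(* words of length n in the letters 0,1,2 (standing for x_1,x_2,x_3) *)
Definition Wd (n : nat) := {ffun 'I_n -> 'I_3}.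
(* T^n(V) = V^{(x) n}, coefficients w.r.t. the word basis *)
Definition Tn (n : nat) := {ffun Wd n -> K^o}.

Definition tbasis n (w : Wd n) : Tn n := [ffun u => (u == w)%:R].

Definition wcat m n (u : Wd m) (v : Wd n) : Wd (m + n) :=
  [ffun t => match split t with inl i => u i | inr j => v j end].

(* multiplication T^m x T^n -> T^(m+n) of the tensor algebra (concatenation);
   this is also the identification T^m (x) T^n = T^(m+n) *)
Definition tmul m n (s : Tn m) (t : Tn n) : Tn (m + n) :=
  \sum_(u : Wd m) \sum_(v : Wd n) ((s u : K) * (t v : K)) *: tbasis (wcat u v).

Definition winit n (w : Wd n.+1) : Wd n := [ffun t => w (widen_ord (leqnSn n) t)].
Definition wlast n (w : Wd n.+1) : 'I_3 := w ord_max.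
Definition wsnoc n (u : Wd n) (l : 'I_3) : Wd n.+1 :=
  [ffun t => if unlift ord_max t is Some t' then u t' else l].

(* x = sum_l (slice x l) (x) x_l ;  extend y l = y (x) x_l *)
Definition slice n (x : Tn n.+1) (l : 'I_3) : Tn n := [ffun u => x (wsnoc u l)].
Definition extend n (y : Tn n) (l : 'I_3) : Tn n.+1 :=
  [ffun w => if wlast w == l then y (winit w) else 0].

Definition wat n (u : Wd n) (k : nat) : 'I_3 :=
  if insub k is Some t then u t else ord0.
Definition wupd2 n (u : Wd n) (k : nat) (l r : 'I_3) : Wd n :=
  [ffun t : 'I_n => if val t == k then l else if val t == k.+1 then r else u t].

Section Braided.
(* braiding on V (x) V:  c(x_i (x) x_j) = sum_k A i j k  x_k (x) x_i *)
Variable A : 'I_3 -> 'I_3 -> 'I_3 -> K.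

(* c acting on the tensor factors k, k+1 (0-based) of T^n *)
Definition simg n (k : nat) (u : Wd n) : Tn n :=
  if (k.+1 < n)%N then
    \sum_(l : 'I_3) A (wat u k) (wat u k.+1) l *: tbasis (wupd2 u k l (wat u k))
  else tbasis u.
Definition bsw n (k : nat) (x : Tn n) : Tn n := \sum_(u : Wd n) (x u : K) *: simg k u.

Fixpoint bseq n (lo cnt : nat) (x : Tn n) : Tn n :=
  match cnt with 0 => x | cnt'.+1 => bsw lo (bseq lo.+1 cnt' x) end.

(* Dcop n i = the (i, n-i) component of the braided coproduct of T(V),
   T^n -> T^i (x) T^(n-i) (= T^n), determined by Delta(v) = v(x)1 + 1(x)v and
   multiplicativity w.r.t. the braided tensor product algebra structure:
   Delta(y v) = Delta(y) (v (x) 1 + 1 (x) v). *)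
Fixpoint Dcop (n : nat) : nat -> Tn n -> Tn n :=
  match n return nat -> Tn n -> Tn n with
  | 0 => fun _ x => x
  | n'.+1 => fun i x =>
      \sum_(l : 'I_3)
        ((if (0 < i)%N then bseq i.-1 (n'.+1 - i) (extend (Dcop i.-1 (slice x l)) l)
          else 0)
         + (if (i < n'.+1)%N then extend (Dcop i (slice x l)) l else 0))
  end.

(* Matsumoto lift of the longest element of S_n:
   W0 (n+1) = c_1 ... c_n (W0 n (x) id) *)
Fixpoint W0 (n : nat) : Tn n -> Tn n :=
  match n return Tn n -> Tn n with
  | 0 => fun x => x
  | n'.+1 => fun x => bseq 0 n' (\sum_(l : 'I_3) extend (W0 (slice x l)) l)
  end.

Definition antipode n (x : Tn n) : Tn n := (-1) ^+ n *: W0 x.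

Definition tsub i j (U : {vspace Tn i}) (V : {vspace Tn j}) : {vspace Tn (i + j)} :=
  <<[seq tmul u v | u <- vbasis U, v <- vbasis V]>>%VS.

(* homogeneous Hopf ideals of T(V) contained in T^{>=2}(V), given by their
   homogeneous components I n *)
Definition hopf_ideal (I : forall n, {vspace Tn n}) : Prop :=
  [/\ I 0%N = 0%VS /\ I 1%N = 0%VS,
      (forall m n (s : Tn m) (x : Tn n), x \in I n -> tmul s x \in I (m + n)%N),
      (forall m n (x : Tn m) (t : Tn n), x \in I m -> tmul x t \in I (m + n)%N),
      (forall i j (x : Tn (i + j)), x \in I (i + j)%N ->
          Dcop i x \in (tsub (I i) fullv + tsub fullv (I j))%VS)
    & (forall n (x : Tn n), x \in I n -> antipode x \in I n)].

(* x lies in J^n(V), the degree n part of the largest such Hopf ideal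
   (the sum of all of them, which is again such a Hopf ideal) *)
Definition in_nichols_ideal n (x : Tn n) : Prop :=
  exists I : forall m, {vspace Tn m}, hopf_ideal I /\ x \in I n.

(* B(V) = T(V)/J(V) is finite-dimensional iff J^n(V) = T^n(V) for n >> 0
   (each T^n(V) being finite-dimensional) *)
Definition nichols_finite_dim : Prop :=
  exists N : nat, forall n : nat, (N <= n)%N -> forall x : Tn n, in_nichols_ideal x.

End Braided.
End Tensor.

(* the braiding of the statement: c(x_i (x) x_j) = (g_i . x_j) (x) x_i,
   letters 0,1,2 = x_1,x_2,x_3 *)
Definition braid_coef (K : fieldType) (eps q12 q21 q22 a : K) (i j k : 'I_3) : K :=
  match val i, val j, val k with
  | (0|1)%N, 0%N, 0%N => eps
  | (0|1)%N, 1%N, 1%N => eps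
  | (0|1)%N, 1%N, 0%N => 1
  | (0|1)%N, 2%N, 2%N => q12
  | 2%N, 0%N, 0%N => q21
  | 2%N, 1%N, 1%N => q21
  | 2%N, 1%N, 0%N => q21 * a
  | 2%N, 2%N, 2%N => q22
  | _, _, _ => 0
  end.

(* a lies in F_p^x (the prime field is the image of nat) *)
Definition Fp_unit (K : fieldType) (a : K) : Prop := (exists k : nat, a = k%:R) /\ a != 0.

(* Main.v *)
(* Dually to T(V), operators act on functions on words in the letters x_1, x_2, x_3: the transposes [eop]
   of the skew derivations (quantum shuffle multiplication by a letter), the deletions [stripl], [stripr]
   of an outer letter and the group-likes [gop].  The annihilator of the span of the functions
   E_(k_1) ... E_(k_n) 1 is a Hopf ideal, so B(V) is finite-dimensional as soon as all long products of
   the E_k vanish.  A relation between the E_k holds when it commutes with all deletions [stripl]; this gives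
   the Jordan or super Jordan relations for x, y, then z_0 = z and z_(n+1) = [x, z_n]_c.
   In the weak cases with q22 = 1, -1 the z_n q-commute, are nilpotent, and vanish for large n because [pz]
   maps z_n to a scalar multiple of a high power of nilpotent elements (for every a).  In case (3) only
   z_0, z_1 survive and form a Cartan type A_2 at a cube root of unity; in case (6) four elements of square
   zero replace the z_n.  Every long word is thus a combination of vanishing ordered monomials. *)
Require Import Defs.
From HB Require Import structures.
From mathcomp Require Import all_boot all_order all_algebra.
From mathcomp Require Import boolp ring zify.
Set Implicit Arguments. Unset Strict Implicit. Unset Printing Implicit Defensive.
Import GRing.Theory.
Local Open Scope ring_scope.

(** * Noncommutative polynomial identities *)

Section NoncommutativeNormalization.
Variables (K : comNzRingType) (R : algType K).

(** The argument consists of upper bounds only: one Hopf ideal that fills all high degrees, and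
    ordered monomials that span. The letters are operators rather than classes in a quotient of T(V)
    because deletion of a left letter satisfies [stripl k * eop l = eop l * stripl k + (k == l)%:R
    *: gop l]: deletions are the skew derivations of the dual algebra. An operator without constant
    term that commutes with all of them vanishes by induction on the length of the word, which turns
    each relation into a finite computation. The characteristic enters through (n)_s = 1 + s + ... +
    s^(n-1): derivations of u^n carry this factor when the derivative of u s-commutes with u, and it
    is zero for s = 1, n = p. This covers y, t and the z_n. The derivative of x (or x^2 in the super
    case) does not s-commute with it, and falling factorials of p take over. Of q12 and q21 only the
    product matters: a diagonal twist of the operators absorbs q21. What remains is eps, q12 q21,
    q22 and the ghost b, equal to -2a for a Jordan block and to a for a super Jordan block. *)

Inductive ncexpr :=
  | NCvar of nat | NCzero | NCone | NCadd of ncexpr & ncexpr | NCopp of ncexpr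
  | NCmul of ncexpr & ncexpr | NCscale of K & ncexpr
  | NCmuln of ncexpr & nat.

Fixpoint nclookup (e : seq R) i {struct e} : R :=
  match e, i with x :: _, 0 => x | _ :: e', i'.+1 => nclookup e' i' | [::], _ => 0 end.

Fixpoint nceval e t : R :=
  match t with
  | NCvar i => nclookup e i | NCzero => 0 | NCone => 1
  | NCadd a b => nceval e a + nceval e b | NCopp a => - nceval e a
  | NCmul a b => nceval e a * nceval e b | NCscale c a => c *: nceval e a
  | NCmuln a n => nceval e a *+ n
  end.

Definition ncpoly := seq (K * seq nat).

(** Private copies of concatenation and word equality let [cbv] unfold the normalizer by an explicit
    delta list while atoms and coefficients stay folded. *)
Fixpoint ncapp (T : Type) (s t : seq T) : seq T :=
  if s is x :: s' then x :: ncapp s' t else t.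
Fixpoint nceqw (s t : seq nat) : bool :=
  match s, t with
  | [::], [::] => true
  | i :: s', j :: t' => if Nat.eqb i j then nceqw s' t' else false
  | _, _ => false
  end.
Fixpoint ncscal (c : K) (w : seq nat) (s : ncpoly) : ncpoly :=
  if s is (d, v) :: s' then (c * d, ncapp w v) :: ncscal c w s' else [::].
Fixpoint ncprod (s t : ncpoly) : ncpoly :=
  if s is (c, w) :: s' then ncapp (ncscal c w t) (ncprod s' t) else [::].
Fixpoint ncnorm t : ncpoly :=
  match t with
  | NCvar i => [:: (1, [:: i])] | NCzero => [::] | NCone => [:: (1, [::])]
  | NCadd a b => ncapp (ncnorm a) (ncnorm b) | NCopp a => ncscal (-1) [::] (ncnorm a)
  | NCmul a b => ncprod (ncnorm a) (ncnorm b) | NCscale c a => ncscal c [::] (ncnorm a)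
  | NCmuln a n => ncscal n%:R [::] (ncnorm a)
  end.
Fixpoint ncins (c : K) w (s : ncpoly) : ncpoly :=
  if s is (d, v) :: s' then if nceqw w v then (c + d, v) :: s' else (d, v) :: ncins c w s'
  else [:: (c, w)].
Fixpoint nccollect (s : ncpoly) : ncpoly :=
  if s is (c, w) :: s' then ncins c w (nccollect s') else [::].
Fixpoint ncnull (s : ncpoly) : Prop :=
  if s is (c, _) :: s' then c = 0 /\ ncnull s' else True.

Definition ncvalue e (s : ncpoly) : R :=
  \sum_(t <- s) t.1 *: \prod_(i <- t.2) nclookup e i.

Lemma ncappE T (s t : seq T) : ncapp s t = s ++ t.
Proof. by elim: s => //= x s ->. Qed.
Lemma ncvalue_cons e c w s :
  ncvalue e ((c, w) :: s) = c *: \prod_(i <- w) nclookup e i + ncvalue e s.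
Proof. by rewrite /ncvalue big_cons. Qed.
Lemma ncvalue_nil e : ncvalue e [::] = 0.
Proof. by rewrite /ncvalue big_nil. Qed.
Lemma ncvalue_app e s t : ncvalue e (ncapp s t) = ncvalue e s + ncvalue e t.
Proof. by rewrite ncappE /ncvalue big_cat. Qed.
Lemma ncvalue_scal e c w s :
  ncvalue e (ncscal c w s) = c *: (\prod_(i <- w) nclookup e i * ncvalue e s).
Proof.
elim: s => [|[d v] s IH] /=; first by rewrite ncvalue_nil mulr0 scaler0.
rewrite !ncvalue_cons IH mulrDr scalerDr ncappE big_cat /=.
by rewrite -scalerAr scalerA.
Qed.
Lemma ncvalue_prod e s t : ncvalue e (ncprod s t) = ncvalue e s * ncvalue e t.
Proof.
elim: s => [|[c w] s IH] /=; first by rewrite ncvalue_nil mul0r.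
by rewrite ncvalue_app ncvalue_scal IH ncvalue_cons mulrDl -scalerAl.
Qed.
Lemma ncvalue_norm e t : ncvalue e (ncnorm t) = nceval e t.
Proof.
elim: t => /= [i|||a IHa b IHb|a IHa|a IHa b IHb|c a IHa|a IHa n].
- by rewrite ncvalue_cons ncvalue_nil addr0 big_seq1 scale1r.
- by rewrite ncvalue_nil.
- by rewrite ncvalue_cons ncvalue_nil addr0 big_nil scale1r.
- by rewrite ncvalue_app IHa IHb.
- by rewrite ncvalue_scal big_nil mul1r scaleN1r IHa.
- by rewrite ncvalue_prod IHa IHb.
- by rewrite ncvalue_scal big_nil mul1r IHa.
- by rewrite ncvalue_scal big_nil mul1r IHa scaler_nat.
Qed.
Lemma nceqwP s t : nceqw s t -> s = t.
Proof.
elim: s t => [|i s IH] [|j t] //=; case: PeanoNat.Nat.eqb_spec => // -> /IH -> //.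
Qed.
Lemma ncvalue_ins e c w s :
  ncvalue e (ncins c w s) = c *: \prod_(i <- w) nclookup e i + ncvalue e s.
Proof.
elim: s => [|[d v] s IH] /=; first by rewrite ncvalue_cons.
case: ifP => [/nceqwP ->|_]; rewrite !ncvalue_cons; first by rewrite scalerDl addrA.
by rewrite IH addrCA.
Qed.
Lemma ncvalue_collect e s : ncvalue e (nccollect s) = ncvalue e s.
Proof.
elim: s => //= -[c w] s IH.
by rewrite ncvalue_ins IH ncvalue_cons.
Qed.
Lemma ncvalue_null e s : ncnull s -> ncvalue e s = 0.
Proof.
elim: s => [|[c w] s IH] /=; first by rewrite ncvalue_nil.
by case=> -> /IH E; rewrite ncvalue_cons scale0r add0r.
Qed.
(** Distinct words are treated as independent, so an identity reduces to one scalar equation per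
    word. *)
Lemma nc_eq e a b :
  ncnull (nccollect (ncnorm (NCadd a (NCopp b)))) -> nceval e a = nceval e b.
Proof.
move=> /(ncvalue_null e); rewrite ncvalue_collect ncvalue_norm /= => /eqP.
by rewrite subr_eq0 => /eqP.
Qed.
End NoncommutativeNormalization.

(** * Reification of identities in an algebra *)

Ltac nc_mem x e :=
  lazymatch e with
  | nil => constr:(false)
  | cons x _ => constr:(true)
  | cons _ ?e' => nc_mem x e'
  end.
Ltac nc_add x e :=
  let b := nc_mem x e in
  lazymatch b with true => e | false => constr:(cons x e) end.
Ltac nc_env t e :=
  lazymatch t with
  | GRing.zero => e
  | GRing.one _ => e
  | GRing.add ?a ?b => let e := nc_env a e in nc_env b e
  | GRing.opp ?a => nc_env a e
  | GRing.mul ?a ?b => let e := nc_env a e in nc_env b e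
  | GRing.scale _ ?a => nc_env a e
  | GRing.natmul ?a _ => nc_env a e
  | _ => nc_add t e
  end.
Ltac nc_index x e :=
  lazymatch e with
  | cons x _ => constr:(O)
  | cons _ ?e' => let i := nc_index x e' in constr:(S i)
  end.
Ltac nc_reify K t e :=
  lazymatch t with
  | GRing.zero => constr:(NCzero K)
  | GRing.one _ => constr:(NCone K)
  | GRing.add ?a ?b =>
    let a := nc_reify K a e in let b := nc_reify K b e in constr:(NCadd a b)
  | GRing.opp ?a => let a := nc_reify K a e in constr:(NCopp a)
  | GRing.mul ?a ?b =>
    let a := nc_reify K a e in let b := nc_reify K b e in constr:(NCmul a b)
  | GRing.scale ?c ?a => let a := nc_reify K a e in constr:(NCscale c a)
  | GRing.natmul ?a ?n => let a := nc_reify K a e in constr:(NCmuln a n)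
  | _ => let i := nc_index t e in constr:(NCvar K i)
  end.
(** Scalar equations that depend on special values of the parameters survive [ring] and are left as
    goals, to be closed by relations such as 1 + q + q^2 = 0. *)
Ltac nc_ring K :=
  lazymatch goal with
  | |- ?a = ?b =>
    let T := type of a in
    let e := nc_env a (@nil T) in
    let e := nc_env b e in
    let a' := nc_reify K a e in
    let b' := nc_reify K b e in
    refine (@nc_eq K _ e a' b' _)
  end;
  cbv beta iota zeta delta [ncnull nccollect ncins ncnorm ncprod ncscal nceqw ncapp Nat.eqb];
  repeat split; try ring.

(** * Operators on functions on words *)

Section Operators.
Variable K : fieldType.

(** Words of all lengths are treated at once, so that the graded types [Tn n] and their casts appear
    only in the pairing. *)
Definition wfun := seq 'I_3 -> K.

Definition wlinear (f : wfun -> wfun) :=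
  forall (c : K) (phi psi : wfun) w,
    f (fun u => c * phi u + psi u) w = c * f phi w + f psi w.

Record oper := Oper { oper_fun :> wfun -> wfun; oper_lin : wlinear oper_fun }.

Lemma operP (f f' : oper) : (forall phi w, f phi w = f' phi w) -> f = f'.
Proof.
case: f => f lf; case: f' => f' lf' /= E.
have {}E : f = f' by apply/funext => phi; apply/funext => w.
by case: _ / E in lf' *; congr Oper; apply: Prop_irrelevance.
Qed.

HB.instance Definition _ := gen_eqMixin oper.
HB.instance Definition _ := gen_choiceMixin oper.

Lemma eq_oper (f : oper) phi psi w : phi =1 psi -> f phi w = f psi w.
Proof. by move=> /funext ->. Qed.

Lemma oper0 (f : oper) w : f (fun _ => 0) w = 0.
Proof.
transitivity (f (fun u => -1 * (fun _ => 0) u + (fun _ => 0) u) w).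
  by apply: eq_oper => u; rewrite mulr0 addr0.
by rewrite oper_lin mulN1r addNr.
Qed.

Lemma operD (f : oper) phi psi w : f (fun u => phi u + psi u) w = f phi w + f psi w.
Proof.
rewrite -[f phi w]mul1r -oper_lin; congr (oper_fun f _ w).
by apply/funext => u; rewrite mul1r.
Qed.

Lemma operZ (f : oper) c phi w : f (fun u => c * phi u) w = c * f phi w.
Proof.
rewrite -[RHS]addr0 -(oper0 f w) -oper_lin; congr (oper_fun f _ w).
by apply/funext => u; rewrite addr0.
Qed.

Lemma wlin0 : wlinear (fun _ _ => 0).
Proof. by move=> *; rewrite mulr0 addr0. Qed.
Lemma wlin_id : wlinear (fun phi => phi).
Proof. by []. Qed.
Lemma wlinD (f g : oper) : wlinear (fun phi w => f phi w + g phi w).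
Proof. by move=> c phi psi w; rewrite !oper_lin mulrDr addrACA. Qed.
Lemma wlinN (f : oper) : wlinear (fun phi w => - f phi w).
Proof. by move=> c phi psi w; rewrite oper_lin opprD mulrN. Qed.
Lemma wlinZ a (f : oper) : wlinear (fun phi w => a * f phi w).
Proof. by move=> c phi psi w; rewrite oper_lin mulrDr !mulrA (mulrC a c). Qed.
Lemma wlinM (f g : oper) : wlinear (fun phi => f (g phi)).
Proof.
move=> c phi psi w; rewrite -oper_lin; apply: eq_oper => u; exact: oper_lin.
Qed.

Definition op0 := Oper wlin0.
Definition op1 := Oper wlin_id.
Definition op_add f g := Oper (wlinD f g).
Definition op_opp f := Oper (wlinN f).
Definition op_scale a f := Oper (wlinZ a f).
Definition op_comp f g := Oper (wlinM f g).

Lemma op_addA : associative op_add.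
Proof. by move=> f g h; apply: operP => phi w /=; rewrite addrA. Qed.
Lemma op_addC : commutative op_add.
Proof. by move=> f g; apply: operP => phi w /=; rewrite addrC. Qed.
Lemma op_add0 : left_id op0 op_add.
Proof. by move=> f; apply: operP => phi w /=; rewrite add0r. Qed.
Lemma op_addN : left_inverse op0 op_opp op_add.
Proof. by move=> f; apply: operP => phi w /=; rewrite addNr. Qed.
HB.instance Definition _ := GRing.isZmodule.Build oper op_addA op_addC op_add0 op_addN.

Lemma op_compA : associative op_comp.
Proof. by move=> f g h; apply: operP. Qed.
Lemma op_comp1l : left_id op1 op_comp.
Proof. by move=> f; apply: operP. Qed.
Lemma op_comp1r : right_id op1 op_comp.
Proof. by move=> f; apply: operP. Qed.
Lemma op_compDl : left_distributive op_comp +%R.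
Proof. by move=> f g h; apply: operP. Qed.
Lemma op_compDr : right_distributive op_comp +%R.
Proof. by move=> f g h; apply: operP => phi w; apply: operD. Qed.
Lemma op1_neq0 : op1 != 0 :> oper.
Proof.
apply/eqP => /(congr1 (fun f : oper => f (fun _ => 1) [::])) /eqP /=.
by rewrite oner_eq0.
Qed.
HB.instance Definition _ := GRing.Zmodule_isNzRing.Build oper
  op_compA op_comp1l op_comp1r op_compDl op_compDr op1_neq0.

Lemma op_scaleA a b f : op_scale a (op_scale b f) = op_scale (a * b) f.
Proof. by apply: operP => phi w /=; rewrite mulrA. Qed.
Lemma op_scale1 : left_id 1 op_scale.
Proof. by move=> f; apply: operP => phi w /=; rewrite mul1r. Qed.
Lemma op_scaleDr : right_distributive op_scale +%R.
Proof. by move=> a f g; apply: operP => phi w /=; rewrite mulrDr. Qed.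
Lemma op_scaleDl f : {morph op_scale^~ f : a b / a + b}.
Proof. by move=> a b; apply: operP => phi w /=; rewrite mulrDl. Qed.
HB.instance Definition _ := GRing.Zmodule_isLmodule.Build K oper
  op_scaleA op_scale1 op_scaleDr op_scaleDl.

Lemma op_scaleAl a (f g : oper) : a *: (f * g) = (a *: f) * g.
Proof. by apply: operP. Qed.
HB.instance Definition _ := GRing.Lmodule_isLalgebra.Build K oper op_scaleAl.

Lemma op_scaleAr a (f g : oper) : a *: (f * g) = f * (a *: g).
Proof. by apply: operP => phi w; exact: esym (operZ f a (g phi) w). Qed.
HB.instance Definition _ := GRing.Lalgebra_isAlgebra.Build K oper op_scaleAr.

Lemma oper_sumE I (r : seq I) (P : pred I) (F : I -> oper) phi w :
  (\sum_(i <- r | P i) F i) phi w = \sum_(i <- r | P i) F i phi w.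
Proof. by elim/big_rec2: _ => // i y1 y2 _ <-. Qed.
Lemma operDE (f g : oper) phi w : (f + g) phi w = f phi w + g phi w.
Proof. by []. Qed.
Lemma operNE (f : oper) phi w : (- f) phi w = - f phi w.
Proof. by []. Qed.
Lemma operZE a (f : oper) phi w : (a *: f) phi w = a * f phi w.
Proof. by []. Qed.
Lemma operME (f g : oper) phi w : (f * g) phi w = f (g phi) w.
Proof. by []. Qed.

End Operators.

(** * Operators of the quantum shuffle algebra and their commutation rules *)

Section BraidedOperators.
Variable K : fieldType.
Implicit Types (phi psi : wfun K) (w : seq 'I_3).
Local Notation op := (oper K).

Lemma wlin_stripl k : @wlinear K (fun phi w => phi (k :: w)).
Proof. by []. Qed.
Definition stripl k := Oper (wlin_stripl k).

Lemma wlin_stripr k : @wlinear K (fun phi w => phi (rcons w k)).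
Proof. by []. Qed.
Definition stripr k := Oper (wlin_stripr k).

Lemma stripl_stripr k l : stripl k * stripr l = stripr l * stripl k.
Proof. exact: operP. Qed.

(** Induction on the word, from its left end. A family is allowed because deleting a letter may turn
    one member into a combination of others. *)
Lemma op_eq0_left (S : Type) (Y : S -> op) :
  (forall s phi, Y s phi [::] = 0) ->
  (forall s k phi w, (forall s' psi, Y s' psi w = 0) -> (stripl k * Y s) phi w = 0) ->
  forall s, Y s = 0.
Proof.
move=> Y0 YS s; apply: operP => phi w.
elim: w s phi => [|k w IH] s phi; [exact: Y0 | exact: (YS s k)].
Qed.

Lemma op_eq0_right (S : Type) (Y : S -> op) :
  (forall s phi, Y s phi [::] = 0) ->
  (forall s k phi w, (forall s' psi, Y s' psi w = 0) -> (stripr k * Y s) phi w = 0) ->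
  forall s, Y s = 0.
Proof.
move=> Y0 YS s; apply: operP => phi w.
elim/last_ind: w s phi => [|w k IH] s phi; [exact: Y0 | exact: (YS s k)].
Qed.

Lemma op_vanish (Y : op) :
  (forall phi, Y phi [::] = 0) -> (forall k, exists Z, stripl k * Y = Y * Z) -> Y = 0.
Proof.
move=> Y0 YS; apply: (@op_eq0_left unit (fun=> Y)) => [_ //|_ k phi w IH|]; last exact: tt.
by have [Z ->] := YS k; exact: (IH tt).
Qed.

Lemma sum_delta (V : lmodType K) l (F : 'I_3 -> V) : \sum_j (j == l)%:R *: F j = F l.
Proof.
rewrite (bigD1 l) //= eqxx scale1r big1 ?addr0 // => j /negPf ->.
by rewrite scale0r.
Qed.

Variable A : 'I_3 -> 'I_3 -> 'I_3 -> K.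

(** For [m = A i] this is phi evaluated at g_i . w, where the group-like g_i acts diagonally on the
    letters of w. *)
Fixpoint gact (m : 'I_3 -> 'I_3 -> K) w phi : K :=
  if w is k :: w' then \sum_j m k j * gact m w' (stripl j phi) else phi [::].

Lemma wlin_gact m : wlinear (fun phi w => gact m w phi).
Proof.
move=> c phi psi w; elim: w phi psi => //= k w IH phi psi.
rewrite mulr_sumr -big_split /=; apply: eq_bigr => j _.
by rewrite -[in RHS]mulrCA -mulrDr -IH.
Qed.
Definition gop i := Oper (wlin_gact (A i)).

(** On k_1 ... k_n this is the sum over all i with k_i = l of phi(k_1 ... k_(i-1) g_l.(k_(i+1) ...
    k_n)): the letter x_l is braided to the right end and removed. It transposes the (n-1,1)
    component of the coproduct. *)
Fixpoint eact l w phi : K :=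
  if w is k :: w' then (k == l)%:R * gop l phi w' + eact l w' (stripl k phi) else 0.

Lemma wlin_eact l : wlinear (fun phi w => eact l w phi).
Proof.
move=> c phi psi w; elim: w phi psi => [|k w IH] phi psi; first by rewrite mulr0 addr0.
by rewrite -[LHS]/(_ + eact l w (fun u => c * stripl k phi u + stripl k psi u)) IH
  oper_lin /= !mulrDr addrACA mulrCA.
Qed.
Definition eop l := Oper (wlin_eact l).

Lemma stripl_gop k i : stripl k * gop i = \sum_j A i k j *: (gop i * stripl j).
Proof. by apply: operP => phi w; rewrite oper_sumE. Qed.

Lemma stripl_eop k l : stripl k * eop l = eop l * stripl k + (k == l)%:R *: gop l.
Proof. by apply: operP => phi w; rewrite addrC. Qed.

(** The coefficient of x_j in g_w . x_l, where g_w is the product of the group-likes of the letters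
    of w. *)
Fixpoint wmat w l j : K :=
  if w is k :: w' then \sum_m A k l m * wmat w' m j else (l == j)%:R.

Lemma wlin_wmat l j : wlinear (fun (phi : wfun K) w => wmat w l j * phi w).
Proof. by move=> c phi psi w; rewrite mulrDr mulrCA. Qed.
Definition xop l j := Oper (wlin_wmat l j).

Lemma stripl_xop k l j : stripl k * xop l j = \sum_m A k l m *: (xop m j * stripl k).
Proof.
apply: operP => phi w; rewrite oper_sumE /= mulr_suml.
by apply: eq_bigr => m _; rewrite mulrA.
Qed.

Lemma wmat_rcons w n l m : wmat (rcons w n) l m = \sum_j wmat w l j * A n j m.
Proof.
elim: w l => [|k w IH] l /=.
  rewrite (bigD1 m) //= eqxx mulr1 big1 => [|j /negPf ->]; last by rewrite mulr0.
  rewrite (bigD1 l) //= eqxx mul1r big1 => // j.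
  by rewrite eq_sym => /negPf ->; rewrite mul0r.
under eq_bigr do rewrite IH mulr_sumr.
rewrite exchange_big /=; apply: eq_bigr => j _.
by rewrite mulr_suml; apply: eq_bigr => i _; rewrite mulrA.
Qed.

Lemma stripr_xop n l m : stripr n * xop l m = \sum_j A n j m *: (xop l j * stripr n).
Proof.
apply: operP => phi w; rewrite oper_sumE /= wmat_rcons mulr_suml.
by apply: eq_bigr => j _; rewrite mulrCA mulrA.
Qed.

(** The word is read backwards because the coproduct rule Delta(y v) = Delta(y)(v (x) 1 + 1 (x) v)
    peels off the last letter; [xop] records the braiding of v past the right tensor factor. *)
Fixpoint shuffle r phi psi : K :=
  if r is l :: r' then
    \sum_j shuffle r' (stripr j phi) (xop l j psi) + shuffle r' phi (stripr l psi)
  else phi [::] * psi [::].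

Lemma wlin_shuffle phi : wlinear (fun psi w => shuffle (rev w) phi psi).
Proof.
move=> c psi psi' w; elim: (rev w) phi psi psi' => [|l r IH] phi psi psi' /=.
  by rewrite mulrDr mulrCA.
rewrite -[X in _ + X]/(shuffle r phi (fun u => c * stripr l psi u + stripr l psi' u)).
rewrite IH mulrDr addrACA; congr (_ + _).
rewrite mulr_sumr -big_split /=; apply: eq_bigr => j _; rewrite -IH.
by congr shuffle; apply/funext => u; rewrite /= mulrDr mulrCA.
Qed.
Definition star phi := Oper (wlin_shuffle phi).

Lemma stripr_star l phi :
  stripr l * star phi = \sum_j star (stripr j phi) * xop l j + star phi * stripr l.
Proof. by apply: operP => psi w; rewrite operDE oper_sumE /= rev_rcons. Qed.

(** Transpose of [W0]: the last letter moves to the front and is acted on by all letters it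
    passes. *)
Fixpoint tact r phi : K :=
  if r is l :: r' then \sum_j wmat (rev r') l j * tact r' (stripl j phi) else phi [::].

Lemma wlin_tact : wlinear (fun phi w => tact (rev w) phi).
Proof.
move=> c phi psi w; elim: (rev w) phi psi => //= k r IH phi psi.
rewrite mulr_sumr -big_split /=; apply: eq_bigr => j _.
by rewrite -[in RHS]mulrCA -mulrDr -IH.
Qed.
Definition top := Oper wlin_tact.

Lemma stripr_top l : stripr l * top = \sum_j xop l j * top * stripl j.
Proof.
apply: operP => phi w; rewrite oper_sumE operME /= rev_rcons /= revK.
by apply: eq_bigr => j _.
Qed.

(** The braiding comes from commuting group-likes g_i, each of which preserves the span of the
    letters with a given group-like: a Yetter-Drinfeld module over an abelian group. *)
Hypothesis A_comm : forall i j l n, \sum_m A i l m * A j m n = \sum_m A j l m * A i m n.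
Hypothesis A_deg : forall i j k, A i j k != 0 -> A j = A k.

Lemma eq_gop i j : A i = A j -> gop i = gop j.
Proof. by rewrite /gop => ->. Qed.

Lemma gop_comm i j : gop i * gop j = gop j * gop i.
Proof.
apply/eqP; rewrite -subr_eq0; apply/eqP; apply: op_vanish => [phi //=|k].
  by rewrite subrr.
exists (\sum_n (\sum_m A i k m * A j m n) *: stripl n).
have E i' j' : stripl k * (gop i' * gop j')
    = gop i' * gop j' * (\sum_n (\sum_m A i' k m * A j' m n) *: stripl n).
  rewrite mulrA stripl_gop mulr_suml mulr_sumr.
  under eq_bigr do rewrite -scalerAl -mulrA stripl_gop mulr_sumr scaler_sumr.
  rewrite exchange_big /=; apply: eq_bigr => n _.
  rewrite -scalerAr scaler_suml; apply: eq_bigr => m _.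
  by rewrite -scalerAr scalerA mulrA.
rewrite mulrBr mulrBl !E; congr (_ - _ * _).
by apply: eq_bigr => n _; rewrite A_comm.
Qed.

Lemma gop_eop i l : gop i * eop l = \sum_m A i m l *: (eop m * gop i).
Proof.
apply/eqP; rewrite -subr_eq0; apply/eqP; apply: op_vanish => [phi|k].
  by rewrite operDE operNE oper_sumE big1 ?subr0 // => m _; rewrite operZE mulr0.
exists (\sum_j A i k j *: stripl j).
rewrite mulrBr mulrBl mulrA stripl_gop mulr_suml.
rewrite -[gop i * eop l * _]/(_) mulr_sumr.
have -> : \sum_j A i k j *: (gop i * stripl j) * eop l =
   gop i * eop l * (\sum_j A i k j *: stripl j) + A i k l *: (gop i * gop l).
  under eq_bigr do rewrite -scalerAl -mulrA stripl_eop mulrDr scalerDr.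
  rewrite big_split /= mulr_sumr; congr (_ + _).
    by apply: eq_bigr => j _; rewrite -scalerAr mulrA.
  rewrite (bigD1 l) //= eqxx scale1r big1 ?addr0 // => j /negPf ->.
  by rewrite scale0r mulr0 scaler0.
have -> : \sum_m stripl k * (A i m l *: (eop m * gop i)) =
   (\sum_m A i m l *: (eop m * gop i)) * (\sum_j A i k j *: stripl j)
     + A i k l *: (gop k * gop i).
  under eq_bigr do rewrite -scalerAr mulrA stripl_eop mulrDl scalerDr.
  rewrite big_split /=; congr (_ + _).
    rewrite mulr_suml; apply: eq_bigr => m _.
    rewrite -mulrA stripl_gop -scalerAl !mulr_sumr; congr (_ *: _).
    by apply: eq_bigr => j _; rewrite -!scalerAr mulrA.
  rewrite (bigD1 k) //= eqxx scale1r big1 ?addr0 // => j /negPf jk.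
  by rewrite eq_sym jk scale0r mul0r scaler0.
rewrite mulr_sumr.
suff -> : A i k l *: (gop i * gop l) = A i k l *: (gop k * gop i).
  by rewrite opprD addrACA subrr addr0.
(* A nonzero [A i k l] means that x_k and x_l carry the same group-like, so the two leftover terms
   agree. *)
have [->|nz] := eqVneq (A i k l) 0; first by rewrite !scale0r.
by rewrite gop_comm (eq_gop (A_deg nz)).
Qed.

Lemma stripr_gop l i : stripr l * gop i = \sum_j A i l j *: (gop i * stripr j).
Proof.
apply/eqP; rewrite -subr_eq0; apply/eqP; apply: op_vanish => [phi|k].
  rewrite operDE operNE oper_sumE; apply/eqP; rewrite subr_eq0; apply/eqP.
  by apply: eq_bigr.
exists (\sum_m A i k m *: stripl m).
rewrite mulrBr mulrBl; congr (_ - _).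
  rewrite mulrA stripl_stripr -mulrA stripl_gop !mulr_sumr.
  by apply: eq_bigr => m _; rewrite -!scalerAr mulrA.
rewrite mulr_sumr mulr_suml; apply: eq_bigr => j _.
rewrite -scalerAl -!scalerAr; congr (_ *: _).
rewrite mulrA stripl_gop mulr_suml mulr_sumr; apply: eq_bigr => m _.
by rewrite -scalerAl -mulrA stripl_stripr -scalerAr mulrA.
Qed.

Lemma stripr_eop l k :
  stripr l * eop k = (l == k)%:R *: 1 + \sum_j A k l j *: (eop k * stripr j).
Proof.
apply/eqP; rewrite -subr_eq0; apply/eqP; apply: op_vanish => [phi|m].
  rewrite !operDE operNE operDE oper_sumE operZE operME.
  rewrite big1 => [|j _]; last by rewrite operZE mulr0.
  by rewrite /= !addr0 subrr.
exists (stripl m).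
have -> : stripl m * (stripr l * eop k - ((l == k)%:R *: 1 + \sum_j A k l j *: (eop k * stripr j))) =
  (stripr l * eop k - ((l == k)%:R *: 1 + \sum_j A k l j *: (eop k * stripr j))) * stripl m +
  (m == k)%:R *: (stripr l * gop k - \sum_j A k l j *: (gop k * stripr j)); last first.
  by rewrite stripr_gop subrr scaler0 addr0.
rewrite mulrBr mulrBl mulrA stripl_stripr -mulrA stripl_eop mulrDr mulrA.
have -> : stripl m * ((l == k)%:R *: 1 + \sum_j A k l j *: (eop k * stripr j)) =
  ((l == k)%:R *: 1 + \sum_j A k l j *: (eop k * stripr j)) * stripl m +
  (m == k)%:R *: \sum_j A k l j *: (gop k * stripr j); last by move: (m == k)%:R (l == k)%:R => c d; nc_ring K.
rewrite mulrDr !mulrDl -scalerAr -scalerAl mulr1 mul1r -addrA; congr (_ + _).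
rewrite mulr_sumr mulr_suml scaler_sumr -big_split /=; apply: eq_bigr => j _.
rewrite -scalerAr mulrA stripl_eop -scalerAl -mulrA -stripl_stripr.
by move: (m == k)%:R => c; nc_ring K.
Qed.

Lemma xop_gop l j k : xop l j * gop k = gop k * xop l j.
Proof.
apply/eqP; rewrite -subr_eq0; apply/eqP.
move: l; apply: op_eq0_left => [l phi|l n phi w IH]; first by rewrite operDE operNE /= subrr.
have -> : stripl n * (xop l j * gop k - gop k * xop l j) =
  \sum_m A n l m *: ((xop m j * gop k - gop k * xop m j) * (\sum_i A k n i *: stripl i)).
  under eq_bigr do rewrite mulrBl scalerBr.
  rewrite big_split /= sumrN mulrBr; congr (_ - _).
    rewrite mulrA stripl_xop mulr_suml; apply: eq_bigr => m _.
    rewrite -scalerAl -!mulrA stripl_gop; congr (_ *: (_ * _)).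
    by rewrite mulr_sumr; apply: eq_bigr => i _; rewrite -scalerAr.
  rewrite mulrA stripl_gop mulr_suml.
  under [LHS]eq_bigr do rewrite -scalerAl -mulrA stripl_xop mulr_sumr scaler_sumr.
  rewrite exchange_big /=; apply: eq_bigr => m _.
  rewrite mulr_sumr scaler_sumr; apply: eq_bigr => i _.
  rewrite -!scalerAr !scalerA mulrA.
  have [->|nz] := eqVneq (A k n i) 0; first by rewrite mul0r mulr0.
  by rewrite (A_deg nz) mulrC.
by rewrite oper_sumE big1 // => m _; rewrite operZE operME IH mulr0.
Qed.

Lemma xop_eop l j k : xop l j * eop k = \sum_m A k l m *: (eop k * xop m j).
Proof.
apply/eqP; rewrite -subr_eq0; apply/eqP.
move: l; apply: op_eq0_left => [l phi|l n phi w IH].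
  rewrite operDE operNE oper_sumE big1 => [|m _]; last by rewrite operZE mulr0.
  by rewrite operME /= mulr0 subrr.
have E1 : stripl n * (xop l j * eop k) =
    \sum_m A n l m *: (xop m j * eop k * stripl n)
      + (n == k)%:R *: \sum_m A n l m *: (xop m j * gop k).
  rewrite mulrA stripl_xop mulr_suml scaler_sumr -big_split /=; apply: eq_bigr => m _.
  by rewrite -scalerAl -(mulrA _ (stripl n)) stripl_eop; move: (n == k)%:R => c; nc_ring K.
have E2 : stripl n * \sum_m A k l m *: (eop k * xop m j) =
    \sum_m A n l m *: ((\sum_i A k m i *: (eop k * xop i j)) * stripl n)
      + (n == k)%:R *: \sum_m A k l m *: (gop k * xop m j).
  rewrite mulr_sumr.
  under [LHS]eq_bigr do rewrite -scalerAr mulrA stripl_eop mulrDl scalerDr.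
  rewrite big_split /=; congr (_ + _); last first.
    rewrite scaler_sumr; apply: eq_bigr => m _; move: (n == k)%:R => c; nc_ring K.
  under [LHS]eq_bigr do rewrite -mulrA stripl_xop mulr_sumr scaler_sumr.
  under [RHS]eq_bigr do rewrite mulr_suml scaler_sumr.
  rewrite exchange_big [RHS]exchange_big /=; apply: eq_bigr => i _.
  under [LHS]eq_bigr do rewrite -scalerAr scalerA mulrA.
  under [RHS]eq_bigr do rewrite -scalerAl scalerA.
  by rewrite -!scaler_suml A_comm.
rewrite mulrBr E1 E2.
have -> : (n == k)%:R *: (\sum_m A n l m *: (xop m j * gop k)) =
    (n == k)%:R *: \sum_m A k l m *: (gop k * xop m j) :> op.
  have [->|_] := eqVneq n k; last by rewrite !scale0r.
  by congr (_ *: _); apply: eq_bigr => m _; rewrite xop_gop.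
rewrite opprD addrACA subrr addr0 -sumrB oper_sumE big1 // => m _.
by rewrite -scalerBr -mulrBl operZE operME IH mulr0.
Qed.

Lemma wmat_deg w l j : wmat w l j != 0 -> A l = A j.
Proof.
elim: w l => [|k w IH] l /=; first by have [->|_] := eqVneq l j; rewrite ?eqxx.
apply: contra_neqP => /= nA; rewrite big1 // => m _.
have [->|/A_deg E] := eqVneq (A k l m) 0; first by rewrite mul0r.
have [->|/IH E'] := eqVneq (wmat w m j) 0; first by rewrite mulr0.
by case: nA; rewrite E.
Qed.

Lemma xop_xop i j k l : xop i j * xop k l = xop k l * xop i j.
Proof. by apply: operP => phi w /=; rewrite mulrCA. Qed.

Lemma xop_deg i j : A i = A j \/ xop i j = 0.
Proof.
have [|E] := pselect (A i = A j); [by left | right].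
apply: operP => phi w /=; have [->|/wmat_deg //] := eqVneq (wmat w i j) 0.
by rewrite mul0r.
Qed.

(** Associativity of the quantum shuffle product: [star phi] multiplies on the left, [eop k] on the
    right. *)
Lemma star_eop phi k : star phi * eop k = eop k * star phi.
Proof.
apply/eqP; rewrite -subr_eq0; apply/eqP.
move: phi; apply: op_eq0_right => [phi psi|phi n psi w IH].
  by rewrite operDE operNE /= mulr0 subrr.
have E1 : stripr n * (star phi * eop k) = (n == k)%:R *: star phi
    + \sum_m A k n m *: (\sum_j star (stripr j phi) * eop k * xop m j
                         + star phi * eop k * stripr m).
  rewrite mulrA stripr_star mulrDl -(mulrA _ (stripr n)) stripr_eop mulrDr mulr_sumr.
  rewrite -scalerAr mulr1 addrCA; congr (_ + _).
  rewrite mulr_suml; under [X in X + _]eq_bigr do rewrite -mulrA xop_eop mulr_sumr.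
  rewrite exchange_big -big_split /=; apply: eq_bigr => m _.
  rewrite scalerDr -scalerAr mulrA scaler_sumr; congr (_ + _).
  by apply: eq_bigr => j _; rewrite -scalerAr mulrA.
have E2 : stripr n * (eop k * star phi) = (n == k)%:R *: star phi
    + \sum_m A k n m *: (\sum_j eop k * star (stripr j phi) * xop m j
                         + eop k * star phi * stripr m).
  rewrite mulrA stripr_eop mulrDl -scalerAl mul1r; congr (_ + _).
  rewrite mulr_suml; apply: eq_bigr => m _; rewrite -scalerAl -(mulrA _ (stripr m)) stripr_star.
  rewrite mulrDr mulr_sumr mulrA; congr (_ *: (_ + _)).
  by apply: eq_bigr => j _; rewrite mulrA.
rewrite mulrBr E1 E2 opprD addrACA subrr add0r -sumrB oper_sumE big1 // => m _.
rewrite -scalerBr opprD addrACA -sumrB -mulrBl operZE operDE oper_sumE.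
rewrite operME IH addr0 big1 ?mulr0 // => j _.
by rewrite -mulrBl operME IH.
Qed.

Definition wvac : wfun K := fun w => (w == [::])%:R.
(** Left multiplication by the k-th letter, the counterpart of [eop k] that the antipode
    requires. *)
Definition lop k := star (eop k wvac).

Lemma stripl_wvac k : stripl k wvac = (fun _ => 0).
Proof. by apply/funext. Qed.

Lemma stripr_wvac k : stripr k wvac = (fun _ => 0).
Proof. by apply/funext => -[]. Qed.

Lemma gop_wvac i : gop i wvac = wvac.
Proof.
apply/funext => -[|k w] //=; rewrite big1 // => j _.
by rewrite -[gact _ _ _]/(gop i (stripl j wvac) w) stripl_wvac oper0 mulr0.
Qed.

Lemma star0 : star (fun _ => 0) = 0.
Proof.
apply: (@op_eq0_right unit (fun=> _)) => [_ psi|_ l psi w IH|]; last exact: tt.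
  by rewrite /= mul0r.
rewrite stripr_star operDE oper_sumE operME (IH tt) addr0 big1 // => j _.
by rewrite operME; exact: (IH tt).
Qed.

Lemma star_wvac : star wvac = 1.
Proof.
apply/eqP; rewrite -subr_eq0; apply/eqP.
apply: (@op_eq0_right unit (fun=> _)) => [_ psi|_ l psi w IH|]; last exact: tt.
  by rewrite operDE operNE /= mul1r subrr.
rewrite mulrBr stripr_star big1 ?add0r => [|j _]; last by rewrite stripr_wvac star0 mul0r.
have -> : star wvac * stripr l - stripr l * 1 = (star wvac - 1) * stripr l.
  by rewrite mulrBl mulr1 mul1r.
by rewrite operME; exact: (IH tt).
Qed.

Lemma stripr_eop_wvac l k : stripr l (eop k wvac) = ((l == k)%:R *: (1 : op)) wvac.
Proof.
apply/funext => w; rewrite -[LHS]/((stripr l * eop k) wvac w) stripr_eop operDE oper_sumE.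
rewrite big1 ?addr0 // => j _.
by rewrite operZE operME stripr_wvac oper0 mulr0.
Qed.

Lemma stripr_lop l k : stripr l * lop k = xop l k + lop k * stripr l.
Proof.
rewrite /lop stripr_star; congr (_ + _).
rewrite (bigD1 k) // big1 => [|j /negPf jk].
  by rewrite stripr_eop_wvac eqxx scale1r star_wvac mul1r; exact: addr0.
suff -> : stripr j (eop k wvac) = (fun _ => 0) by rewrite star0 mul0r.
by rewrite stripr_eop_wvac jk scale0r.
Qed.

Lemma lop_eop k m : lop k * eop m = eop m * lop k.
Proof. exact: star_eop. Qed.

Lemma xop_lop l m k : xop l m * lop k = \sum_j A k j m *: (lop k * xop l j).
Proof.
apply/eqP; rewrite -subr_eq0; apply/eqP.
move: m; apply: op_eq0_right => [m phi|m n phi w IH].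
  rewrite operDE operNE oper_sumE big1 => [|j _]; last by rewrite operZE /= mul0r mulr0.
  by rewrite operME /= mul0r mulr0 subrr.
have E1 : stripr n * (xop l m * lop k) =
    \sum_j A n j m *: (xop l j * lop k * stripr n)
      + \sum_j A n j m *: (xop l j * xop n k).
  rewrite mulrA stripr_xop mulr_suml -big_split /=; apply: eq_bigr => j _.
  by rewrite -scalerAl -(mulrA _ (stripr n)) stripr_lop; nc_ring K.
have E2 : stripr n * \sum_j A k j m *: (lop k * xop l j) =
    \sum_j A n j m *: ((\sum_i A k i j *: (lop k * xop l i)) * stripr n)
      + \sum_j A k j m *: (xop n k * xop l j).
  rewrite mulr_sumr.
  under [LHS]eq_bigr do rewrite -scalerAr mulrA stripr_lop mulrDl scalerDr.
  rewrite big_split /= addrC; congr (_ + _).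
  under [LHS]eq_bigr do rewrite -mulrA stripr_xop mulr_sumr scaler_sumr.
  under [RHS]eq_bigr do rewrite mulr_suml scaler_sumr.
  rewrite exchange_big [RHS]exchange_big /=; apply: eq_bigr => i _.
  under [LHS]eq_bigr do rewrite -scalerAr scalerA mulrA.
  under [RHS]eq_bigr do rewrite -scalerAl scalerA.
  rewrite -!scaler_suml; congr (_ *: _).
  under eq_bigr do rewrite mulrC; rewrite -A_comm.
  by apply: eq_bigr => j _; rewrite mulrC.
rewrite mulrBr E1 E2.
have -> : \sum_j A n j m *: (xop l j * xop n k) =
    \sum_j A k j m *: (xop n k * xop l j) :> op.
  apply: eq_bigr => j _; rewrite xop_xop.
  by case: (xop_deg n k) => [->|->]; rewrite ?mul0r ?scaler0.
rewrite opprD addrACA subrr addr0 -sumrB oper_sumE big1 // => j _.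
by rewrite -scalerBr -mulrBl operZE operME IH mulr0.
Qed.

(** The antipode reverses products up to the braiding, so right multiplication by a letter becomes
    left multiplication. *)
Lemma top_eop k : top * eop k = lop k * top * gop k.
Proof.
apply/eqP; rewrite -subr_eq0; apply/eqP.
apply: (@op_eq0_right unit (fun=> _)) => [_ phi|_ l phi w IH|]; last exact: tt.
  by rewrite operDE operNE /= mul0r subrr.
have E1 : stripr l * (top * eop k) = xop l k * top * gop k
    + \sum_m xop l m * (top * eop k * stripl m).
  rewrite mulrA stripr_top mulr_suml.
  under [LHS]eq_bigr do rewrite -mulrA stripl_eop mulrDr -scalerAr.
  rewrite big_split /= sum_delta addrC; congr (_ + _).
  by apply: eq_bigr => m _; rewrite !mulrA.
have E2 : stripr l * (lop k * top * gop k) = xop l k * top * gop k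
    + \sum_m xop l m * (lop k * top * gop k * stripl m).
  rewrite !mulrA stripr_lop !mulrDl; congr (_ + _).
  rewrite -(mulrA _ (stripr l)) stripr_top mulr_sumr mulr_suml.
  under [LHS]eq_bigr do rewrite -!mulrA stripl_gop !mulr_sumr.
  rewrite exchange_big /=; apply: eq_bigr => m _.
  rewrite !mulrA xop_lop !mulr_suml; apply: eq_bigr => j _.
  by nc_ring K.
rewrite mulrBr E1 E2 opprD addrACA subrr add0r -sumrB oper_sumE big1 // => m _.
by rewrite -mulrBr -mulrBl !operME -[RHS](mulr0 (wmat w l m)) -(IH tt (stripl m phi)).
Qed.

Lemma wmat_comm k w l m : \sum_j A k l j * wmat w j m = \sum_j wmat w l j * A k j m.
Proof.
elim: w l => [|k' w IH] l /=.
  rewrite (bigD1 m) //= eqxx mulr1 big1 => [|j /negPf ->]; last by rewrite mulr0.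
  rewrite (bigD1 l) //= eqxx mul1r big1 => // j.
  by rewrite eq_sym => /negPf ->; rewrite mul0r.
under eq_bigr do rewrite mulr_sumr.
rewrite exchange_big /=.
under eq_bigr do under eq_bigr do rewrite mulrA.
under eq_bigr do rewrite -mulr_suml A_comm mulr_suml.
rewrite exchange_big /=.
under eq_bigr do under eq_bigr do rewrite -mulrA.
under eq_bigr do rewrite -mulr_sumr IH.
under [RHS]eq_bigr do rewrite mulr_suml.
rewrite [RHS]exchange_big /=; apply: eq_bigr => j _; rewrite mulr_sumr.
by apply: eq_bigr => i _; rewrite mulrA.
Qed.

Lemma xop_top l j : xop l j * top = top * xop l j.
Proof.
apply/eqP; rewrite -subr_eq0; apply/eqP.
move: l j; suff H lj : xop lj.1 lj.2 * top - top * xop lj.1 lj.2 = 0.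
  by move=> l j; exact: (H (l, j)).
move: lj; apply: op_eq0_right => [[l j] phi|[l j] n phi w IH].
  by rewrite operDE operNE /= subrr.
rewrite -[_ * _]/(stripr n * (xop l j * top - top * xop l j)).
have E1 : stripr n * (xop l j * top) =
    \sum_i \sum_m A n m j *: (xop n i * (xop l m * top) * stripl i).
  rewrite exchange_big mulrA stripr_xop mulr_suml; apply: eq_bigr => m _.
  rewrite -scalerAl -(mulrA _ (stripr n)) stripr_top mulr_sumr scaler_sumr.
  by apply: eq_bigr => i _; rewrite !mulrA (xop_xop l m).
have E2 : stripr n * (top * xop l j) =
    \sum_i \sum_m A i l m *: (xop n i * (top * xop m j) * stripl i).
  rewrite mulrA stripr_top mulr_suml; apply: eq_bigr => i _.
  rewrite -(mulrA _ (stripl i)) stripl_xop mulr_sumr; apply: eq_bigr => m _.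
  by nc_ring K.
(* A nonzero [xop n i] forces g_n = g_i, and g_i commutes with the group-like of the word, so the
   sum over the second index of [xop] becomes a sum over the first. *)
have E3 i : \sum_m A n m j *: (xop n i * (xop l m * top) * stripl i) =
   \sum_m A i l m *: (xop n i * (xop m j * top) * stripl i).
  case: (xop_deg n i) => [->|->]; last by rewrite !big1 // => m _; rewrite !mul0r scaler0.
  apply: operP => psi u; rewrite !oper_sumE.
  transitivity ((\sum_m wmat u l m * A i m j) * (wmat u n i * top (stripl i psi) u)).
    rewrite mulr_suml; apply: eq_bigr => m _; rewrite operZE !operME /=.
    by ring.
  rewrite -wmat_comm mulr_suml; apply: eq_bigr => m _; rewrite operZE !operME /=.
  by ring.
rewrite mulrBr E1 E2; under eq_bigr do rewrite E3.
rewrite -sumrB oper_sumE big1 // => i _; rewrite -sumrB oper_sumE big1 // => m _.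
rewrite -scalerBr -mulrBl -mulrBr operZE 2!operME -[RHS](mulr0 (A i l m)); congr (_ * _).
rewrite -[RHS](mulr0 (wmat w n i)) -[in RHS](IH (m, j) (stripl i phi)) /=.
by [].
Qed.

Lemma top_wvac : top wvac = wvac.
Proof.
apply/funext => w; elim/last_ind: w => // w l _.
rewrite -[LHS]/((stripr l * top) wvac w) stripr_top oper_sumE big1 => [|j _].
  by case: w.
by rewrite operME stripl_wvac oper0.
Qed.

Lemma lop_wvac k : lop k wvac = eop k wvac.
Proof.
apply/funext => w; elim/last_ind: w => [|w l _] /=; first by rewrite mul0r.
rewrite -[LHS]/((stripr l * lop k) wvac w) -[RHS]/(stripr l (eop k wvac) w).
rewrite stripr_lop stripr_eop_wvac operDE operME stripr_wvac oper0 addr0 operZE /=.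
case: w => //= m w; rewrite /wvac /= !mulr0 //.
Qed.

End BraidedOperators.

(** * Pairing tensors with functions on words *)

Definition wseq n (u : Wd n) : seq 'I_3 := [seq u t | t <- enum 'I_n].

Section Words.
Variable n : nat.

Lemma size_wseq (u : Wd n) : size (wseq u) = n.
Proof. by rewrite size_map size_enum_ord. Qed.

Lemma nth_wseq (u : Wd n) k : nth ord0 (wseq u) k = wat u k.
Proof.
rewrite /wat; case: insubP => [t _ <-|].
  rewrite (nth_map t) ?size_enum_ord ?ltn_ord //.
  have -> // : nth t (enum 'I_n) t = t by apply: val_inj; rewrite /= nth_enum_ord.
by move=> /=; rewrite -leqNgt => le; rewrite nth_default ?size_wseq.
Qed.

Lemma wseq_surj w : size w = n -> exists u : Wd n, wseq u = w.
Proof.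
move=> sw; exists [ffun t : 'I_n => nth ord0 w t].
apply: (@eq_from_nth _ ord0); first by rewrite size_wseq.
move=> k; rewrite size_wseq => kn; rewrite nth_wseq /wat; case: insubP => [t _ <-|].
  by rewrite ffunE.
by rewrite kn.
Qed.

Lemma wat_wsnoc (u : Wd n) l k : (k < n)%N -> wat (wsnoc u l) k = wat u k.
Proof.
move=> kn; rewrite /wat; case: insubP => [t _ tk|]; last by rewrite /= ltnS ltnW.
case: insubP => [s _ sk|]; last by rewrite /= kn.
rewrite ffunE; case: unliftP => [j tj|tm]; last by rewrite -tk tm ltnn in kn.
have -> // : j = s; apply: val_inj; rewrite sk -tk tj /= /bump leqNgt.
by rewrite ltn_ord.
Qed.

Lemma wat_wsnoc_last (u : Wd n) l : wat (wsnoc u l) n = l.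
Proof.
rewrite /wat; case: insubP => [t _ tk|]; last by rewrite /= ltnS leqnn.
have -> : t = ord_max by apply: val_inj.
by rewrite ffunE unlift_none.
Qed.
End Words.

Lemma wseq_wsnoc n (u : Wd n) l : wseq (wsnoc u l) = rcons (wseq u) l.
Proof.
apply: (@eq_from_nth _ ord0) => [|k]; first by rewrite size_rcons !size_wseq.
rewrite size_wseq ltnS leq_eqVlt nth_rcons size_wseq => /predU1P[->|kn].
  by rewrite ltnn eqxx nth_wseq wat_wsnoc_last.
by rewrite kn !nth_wseq wat_wsnoc.
Qed.

Lemma wsnocK n (u : Wd n) l : winit (wsnoc u l) = u.
Proof.
apply/ffunP => t; rewrite !ffunE.
have -> : widen_ord (leqnSn n) t = lift ord_max t by apply: val_inj; exact: esym (lift_max t).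
by rewrite liftK.
Qed.

Lemma wlast_wsnoc n (u : Wd n) l : wlast (wsnoc u l) = l.
Proof. by rewrite /wlast ffunE unlift_none. Qed.

Lemma wsnoc_winit n (u : Wd n.+1) : wsnoc (winit u) (wlast u) = u.
Proof.
apply/ffunP => t; rewrite ffunE; case: unliftP => [j ->|-> //].
rewrite ffunE; have -> // : widen_ord (leqnSn n) j = lift ord_max j.
by apply: val_inj; exact: esym (lift_max j).
Qed.

Lemma wseq_wcat m n (u : Wd m) (v : Wd n) : wseq (wcat u v) = wseq u ++ wseq v.
Proof.
rewrite /wseq.
have -> : enum 'I_(m + n) = [seq lshift n i | i <- enum 'I_m] ++ [seq rshift m i | i <- enum 'I_n].
  apply: (inj_map val_inj); transitivity (iota 0 (m + n)); first exact: val_enum_ord.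
  rewrite map_cat -(map_comp val (lshift n)) -(map_comp val (@rshift m n)).
  rewrite iotaD add0n -[X in _ ++ iota X _]addn0 iotaDl -!val_enum_ord.
  by rewrite -(map_comp (addn m)).
rewrite map_cat -(map_comp _ (lshift n)) -(map_comp _ (@rshift m n)); congr (_ ++ _); apply: eq_map => i /=; rewrite ffunE.
  by rewrite (unsplitK (inl i)).
by rewrite (unsplitK (inr i)).
Qed.

Lemma wseq_wupd2 n (u : Wd n) k l : (k.+1 < n)%N ->
  wseq (wupd2 u k l (wat u k)) = take k (wseq u) ++ l :: wat u k :: drop k.+2 (wseq u).
Proof.
move=> kn; have kn' : (k < n)%N by apply: ltnW.
apply: (@eq_from_nth _ ord0).
  by rewrite size_cat /= size_take size_drop !size_wseq kn'; lia.
move=> i; rewrite size_wseq => ltin; rewrite nth_wseq nth_cat size_take size_wseq kn'.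
rewrite /wat; case: insubP => [t _ ti|]; last by rewrite /= ltin.
rewrite ffunE /= ti; have [lik|leki] := ltnP i k.
  by rewrite nth_take // nth_wseq /wat ltn_eqF // ltn_eqF 1?ltnW // -ti valK.
have [->|nik] := eqVneq i k; first by rewrite subnn.
have [->|nik1] := eqVneq i k.+1; first by rewrite subSnn.
have -> : (i - k = (i - k.+2).+2)%N by lia.
rewrite /= nth_drop nth_wseq.
have -> : (k.+2 + (i - k.+2) = i)%N by lia.
by rewrite /wat -ti valK.
Qed.

Lemma drop2_wseq n (u : Wd n) k : (k.+1 < n)%N ->
  drop k (wseq u) = wat u k :: wat u k.+1 :: drop k.+2 (wseq u).
Proof.
move=> kn; rewrite (@drop_nth _ ord0 k) ?size_wseq 1?ltnW //.
by rewrite (@drop_nth _ ord0 k.+1) ?size_wseq // !nth_wseq.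
Qed.

Section Pairing.
Variable K : fieldType.
Implicit Types (phi psi Phi : wfun K).

Definition pairing n (x : Tn K n) Phi : K := \sum_(u : Wd n) x u * Phi (wseq u).

Lemma eq_pairing n (x : Tn K n) Phi Psi :
  (forall w, size w = n -> Phi w = Psi w) -> pairing x Phi = pairing x Psi.
Proof. by move=> E; apply: eq_bigr => u _; rewrite E ?size_wseq. Qed.

Lemma pairing_linl n c (x y : Tn K n) Phi :
  pairing (c *: x + y) Phi = c * pairing x Phi + pairing y Phi.
Proof.
rewrite mulr_sumr -big_split; apply: eq_bigr => u _.
by rewrite !ffunE mulrDl mulrA.
Qed.

Lemma pairing0l n Phi : pairing (0 : Tn K n) Phi = 0.
Proof. by rewrite /pairing big1 // => u _; rewrite ffunE mul0r. Qed.

Lemma pairingDl n (x y : Tn K n) Phi : pairing (x + y) Phi = pairing x Phi + pairing y Phi.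
Proof. by rewrite -[x]scale1r pairing_linl mul1r scale1r. Qed.

Lemma pairingZl n c (x : Tn K n) Phi : pairing (c *: x) Phi = c * pairing x Phi.
Proof. by rewrite -[c *: x]addr0 pairing_linl pairing0l addr0. Qed.

Lemma pairing_suml n I (r : seq I) (P : pred I) (F : I -> Tn K n) Phi :
  pairing (\sum_(i <- r | P i) F i) Phi = \sum_(i <- r | P i) pairing (F i) Phi.
Proof.
by elim/big_rec2: _ => [|i y z _ <-]; rewrite ?pairing0l ?pairingDl.
Qed.

Lemma pairing_linr n (x : Tn K n) c phi psi :
  pairing x (fun w => c * phi w + psi w) = c * pairing x phi + pairing x psi.
Proof.
rewrite mulr_sumr -big_split; apply: eq_bigr => u _.
by rewrite mulrDr mulrCA.
Qed.

Lemma pairing_sumr n I (r : seq I) (P : pred I) (F : I -> wfun K) (x : Tn K n) :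
  pairing x (fun w => \sum_(i <- r | P i) F i w) = \sum_(i <- r | P i) pairing x (F i).
Proof.
by rewrite exchange_big /=; apply: eq_bigr => u _; rewrite mulr_sumr.
Qed.

Lemma pairing_tbasis n (u : Wd n) Phi : pairing (tbasis K u) Phi = Phi (wseq u).
Proof.
rewrite /pairing (bigD1 u) //= ffunE eqxx mul1r big1 ?addr0 // => v /negPf vu.
by rewrite ffunE vu mul0r.
Qed.

Lemma sum_wsnoc n (F : Wd n.+1 -> K) :
  \sum_w F w = \sum_(l : 'I_3) \sum_(u : Wd n) F (wsnoc u l).
Proof.
rewrite pair_bigA /=.
rewrite (reindex (fun p : 'I_3 * Wd n => wsnoc p.2 p.1)) //=.
exists (fun w => (wlast w, winit w)) => [[l u]|w] _ /=.
  by rewrite wlast_wsnoc wsnocK.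
by rewrite wsnoc_winit.
Qed.

Lemma pairing_slice n (x : Tn K n.+1) Phi :
  pairing x Phi = \sum_l pairing (slice x l) (stripr K l Phi).
Proof.
rewrite /pairing sum_wsnoc; apply: eq_bigr => l _; apply: eq_bigr => u _.
by rewrite ffunE wseq_wsnoc.
Qed.

Lemma pairing_extend n (y : Tn K n) l Phi :
  pairing (extend y l) Phi = pairing y (stripr K l Phi).
Proof.
rewrite pairing_slice (bigD1 l) //= big1 ?addr0 => [|l' nl].
  by congr pairing; apply/ffunP => u; rewrite !ffunE wlast_wsnoc wsnocK eqxx.
rewrite -[RHS](@pairing0l n (stripr K l' Phi)); congr pairing.
by apply/ffunP => u; rewrite !ffunE wlast_wsnoc (negPf nl).
Qed.

Lemma pairing_tmul m n (s : Tn K m) (t : Tn K n) Phi :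
  pairing (tmul s t) Phi = \sum_(u : Wd m) \sum_(v : Wd n)
    s u * t v * Phi (wseq u ++ wseq v).
Proof.
rewrite pairing_suml; apply: eq_bigr => u _.
rewrite pairing_suml; apply: eq_bigr => v _.
by rewrite pairingZl pairing_tbasis wseq_wcat.
Qed.
End Pairing.

(** * Transposes of the coproduct and of the antipode of T(V) *)

Section HopfIdeal.
Variable K : fieldType.
Variable A : 'I_3 -> 'I_3 -> 'I_3 -> K.
Hypothesis A_comm : forall i j l n, \sum_m A i l m * A j m n = \sum_m A j l m * A i m n.
Hypothesis A_deg : forall i j k, A i j k != 0 -> A j = A k.
Implicit Types (phi psi Phi : wfun K).

Definition swap_dual k Phi : wfun K := fun w =>
  if drop k w is i :: j :: r then \sum_l A i j l * Phi (take k w ++ l :: i :: r) else Phi w.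

Lemma pairing_bsw n k (x : Tn K n) Phi :
  pairing (bsw A k x) Phi = pairing x (swap_dual k Phi).
Proof.
rewrite /bsw pairing_suml; apply: eq_bigr => u _; rewrite pairingZl; congr (_ * _).
rewrite /simg /swap_dual; case: ifP => kn.
  rewrite drop2_wseq // pairing_suml; apply: eq_bigr => l _.
  by rewrite pairingZl pairing_tbasis wseq_wupd2.
rewrite pairing_tbasis.
have: (size (drop k (wseq u)) <= 1)%N by rewrite size_drop size_wseq; lia.
by case: (drop _ _) => [|? []].
Qed.

Fixpoint swaps_dual lo cnt Phi : wfun K :=
  if cnt is cnt'.+1 then swaps_dual lo.+1 cnt' (swap_dual lo Phi) else Phi.

Lemma pairing_bseq n lo cnt (x : Tn K n) Phi :
  pairing (Defs.bseq A lo cnt x) Phi = pairing x (swaps_dual lo cnt Phi).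
Proof.
elim: cnt lo Phi => [//|cnt IH] lo Phi /=.
by rewrite pairing_bsw IH.
Qed.

(** Pulling the last letter l leftwards through v leaves v unchanged and applies g_v to x_l. *)
Lemma swaps_dualE s v l Phi :
  swaps_dual (size s) (size v) Phi (s ++ rcons v l)
  = \sum_j wmat A v l j * Phi (s ++ j :: v).
Proof.
elim: v s Phi => [|k v IH] s Phi /=.
  by rewrite (bigD1 l) //= eqxx mul1r big1 ?addr0 // => j /negPf; rewrite eq_sym => ->; rewrite mul0r.
rewrite -cat_rcons -(size_rcons s k) IH.
under [RHS]eq_bigr do rewrite wmat_comm // mulr_suml.
rewrite [RHS]exchange_big /=; apply: eq_bigr => j _.
rewrite cat_rcons /swap_dual drop_size_cat // take_size_cat // mulr_sumr.
by apply: eq_bigr => m _; rewrite mulrA.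
Qed.

Lemma pairing_bseq_extend n lo cnt (y : Tn K n) l Phi : (lo + cnt = n)%N ->
  pairing (Defs.bseq A lo cnt (extend y l)) Phi =
  pairing y (fun w => \sum_j wmat A (drop lo w) l j * Phi (take lo w ++ j :: drop lo w)).
Proof.
move=> E; rewrite pairing_bseq pairing_extend; apply: eq_pairing => w sw /=.
rewrite -swaps_dualE size_drop size_take.
have -> : (if (lo < size w)%N then lo else size w) = lo by case: ifP; lia.
have -> : (size w - lo = cnt)%N by lia.
by rewrite -rcons_cat cat_take_drop.
Qed.

Definition supp_on i phi := forall w, size w != i -> phi w = 0.

Lemma star_supp i phi psi w : supp_on i phi -> (size w < i)%N -> star A phi psi w = 0.
Proof.
elim/last_ind: w i phi psi => [|w l IH] i phi psi sup lt.
  by rewrite /= sup ?mul0r // eq_sym -lt0n.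
rewrite size_rcons in lt.
rewrite -[LHS]/((stripr K l * star A phi) psi w) stripr_star // operDE oper_sumE operME.
rewrite (IH i) ?addr0 //; last exact: ltnW.
rewrite big1 // => j _; rewrite operME (IH i.-1) //; last by case: i lt {sup}.
move=> u nu /=; apply: sup; rewrite size_rcons; apply: contraNneq nu => <-; exact: eqxx.
Qed.

Definition ext_tensor i phi psi : wfun K := fun w => phi (take i w) * psi (drop i w).

(** [star] sums over all splittings of a word; the support condition on [phi] selects the one whose
    left part has length i, which is what [Dcop A i] computes. *)
Lemma pairing_Dcop n i (x : Tn K n) phi psi : (i <= n)%N -> supp_on i phi ->
  pairing (Dcop A i x) (ext_tensor i phi psi) = pairing x (star A phi psi).
Proof.
elim: n i x phi psi => [|n IH] i x phi psi le sup.
  apply: eq_pairing => w /size0nil ->.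
  by rewrite /ext_tensor.
rewrite [RHS]pairing_slice /= pairing_suml; apply: eq_bigr => l _; rewrite pairingDl.
have -> : pairing (slice x l) (stripr K l (star A phi psi)) =
    pairing (slice x l) (fun w => \sum_j star A (stripr K j phi) (xop A l j psi) w)
    + pairing (slice x l) (star A phi (stripr K l psi)).
  rewrite -[X in X + _]mul1r -pairing_linr; apply: eq_pairing => w _.
  rewrite -[LHS]/((stripr K l * star A phi) psi w) stripr_star // operDE oper_sumE.
  by rewrite mul1r.
congr (_ + _).
  case: i le sup => [|i] le sup.
    rewrite pairing0l /pairing big1 // => u _; rewrite big1 ?mulr0 // => j _.
    have -> : stripr K j phi = (fun _ => 0).
      by apply/funext => w; apply: sup; rewrite size_rcons.
    by rewrite star0.
  rewrite subSS /= pairing_bseq_extend ?subnKC // [RHS]pairing_sumr.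
  transitivity (pairing (Dcop A i (slice x l))
    (fun w => \sum_j ext_tensor i (stripr K j phi) (xop A l j psi) w)).
    apply: eq_pairing => w sw; apply: eq_bigr => j _.
    rewrite /ext_tensor -cat_rcons.
    have st : size (rcons (take i w) j) = i.+1.
      by rewrite size_rcons size_take sw; case: ifP; lia.
    rewrite -st take_size_cat // drop_size_cat //=.
    by rewrite mulrCA.
  rewrite pairing_sumr; apply: eq_bigr => j _; apply: IH => // u nu.
  by apply: sup; rewrite size_rcons eqSS.
case: ifP => [lt|nlt].
  rewrite pairing_extend -(IH i) //; apply: eq_pairing => w sw /=.
  rewrite /ext_tensor /= -cats1 take_cat drop_cat sw.
  have [lt'|ge] := ltnP i n; first by rewrite cats1.
  have -> : (i - n = 0)%N by lia.
  by rewrite take0 drop0 take_oversize ?drop_oversize ?cats0 // sw.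
rewrite pairing0l /pairing big1 // => u _.
rewrite (star_supp _ sup) ?mulr0 // size_wseq.
by rewrite ltnNge -ltnS nlt.
Qed.

Lemma pairing_W0 n (x : Tn K n) Phi : pairing (W0 A x) Phi = pairing x (top A Phi).
Proof.
elim: n x Phi => [|n IH] x Phi.
  by apply: eq_pairing => -[].
rewrite /= pairing_bseq pairing_suml [RHS]pairing_slice; apply: eq_bigr => l _.
rewrite -pairing_bseq pairing_bseq_extend ?add0n //.
transitivity (pairing (slice x l) (fun w => \sum_j top A (xop A l j (stripl K j Phi)) w)).
  rewrite !pairing_sumr; apply: eq_bigr => j _; rewrite -IH; apply: eq_pairing => w _ /=.
  by rewrite take0 drop0.
apply: eq_pairing => w _.
rewrite -[RHS]/((stripr K l * top A) Phi w) stripr_top oper_sumE.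
by apply: eq_bigr => j _; rewrite xop_top // -!mulrA.
Qed.
End HopfIdeal.

(** * The Hopf ideal annihilating the dual subalgebra *)

Section DualSubalgebra.
Variable K : fieldType.
Variable A : 'I_3 -> 'I_3 -> 'I_3 -> K.
Hypothesis A_comm : forall i j l n, \sum_m A i l m * A j m n = \sum_m A j l m * A i m n.
Hypothesis A_deg : forall i j k, A i j k != 0 -> A j = A k.
Implicit Types (phi psi Phi : wfun K).

(** The degree n part of the subalgebra generated by the letters in the quantum shuffle algebra, a
    copy of the graded dual of the Nichols algebra. *)
Inductive dual_span : nat -> wfun K -> Prop :=
  | DSvac : dual_span 0 (wvac K)
  | DSzero n : dual_span n (fun _ => 0)
  | DSlin n c phi psi : dual_span n phi -> dual_span n psi ->
      dual_span n (fun w => c * phi w + psi w)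
  | DSeop n k phi : dual_span n phi -> dual_span n.+1 (eop A k phi).

Lemma dual_span_sum n (c : 'I_3 -> K) (F : 'I_3 -> wfun K) :
  (forall j, dual_span n (F j)) -> dual_span n (fun w => \sum_j c j * F j w).
Proof.
move=> H; elim: (index_enum _) => [|j r IH].
  have -> : (fun w => \sum_(j <- [::]) c j * F j w) = (fun _ => 0).
    by apply/funext => w; rewrite big_nil.
  exact: DSzero.
have -> : (fun w => \sum_(i <- j :: r) c i * F i w) =
    (fun w => c j * F j w + \sum_(i <- r) c i * F i w).
  by apply/funext => w; rewrite big_cons.
exact: DSlin.
Qed.

Lemma oper0_fun (f : oper K) : f (fun _ => 0) = (fun _ => 0).
Proof. by apply/funext => w; rewrite oper0. Qed.

Lemma oper_lin_fun (f : oper K) c phi psi :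
  f (fun w => c * phi w + psi w) = (fun w => c * f phi w + f psi w).
Proof. by apply/funext => w; rewrite oper_lin. Qed.

Lemma dual_span_gop n phi i : dual_span n phi -> dual_span n (gop A i phi).
Proof.
elim=> {n phi} [|n|n c phi psi _ IH1 _ IH2|n k phi H IH].
- by rewrite gop_wvac; exact: DSvac.
- by rewrite oper0_fun; exact: DSzero.
- by rewrite oper_lin_fun; exact: DSlin.
have -> : gop A i (eop A k phi) = (fun w => \sum_m A i m k * eop A m (gop A i phi) w).
  apply/funext => w; rewrite -[LHS]/((gop A i * eop A k) phi w) gop_eop //.
  by rewrite oper_sumE.
by apply: dual_span_sum => m; exact: DSeop.
Qed.

(** Degree n - 1 without truncation: a deletion kills degree 0, where [n.-1] would still allow
    constants. *)
Definition dual_span_pred n phi : Prop :=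
  if n is n'.+1 then dual_span n' phi else phi = (fun _ => 0).

Lemma dual_span_predE n k phi : dual_span_pred n phi -> dual_span n (eop A k phi).
Proof.
case: n => [->|n]; last exact: DSeop.
by rewrite oper0_fun; exact: DSzero.
Qed.

Lemma dual_span_pred_lin n c phi psi : dual_span_pred n phi -> dual_span_pred n psi ->
  dual_span_pred n (fun w => c * phi w + psi w).
Proof.
case: n => [-> ->|n]; last exact: DSlin.
by apply/funext => w; rewrite mulr0 addr0.
Qed.

Lemma dual_span_stripl n phi k : dual_span n phi -> dual_span_pred n (stripl K k phi).
Proof.
elim=> {n phi} [|n|n c phi psi _ IH1 _ IH2|n l phi H IH].
- exact: stripl_wvac.
- by case: n => //= n; exact: DSzero.
- by rewrite oper_lin_fun; exact: dual_span_pred_lin.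
have -> : stripl K k (eop A l phi) =
    (fun w => (k == l)%:R * gop A l phi w + eop A l (stripl K k phi) w) by [].
by apply: DSlin; [exact: dual_span_gop | exact: dual_span_predE].
Qed.

Lemma dual_span_stripr n phi k : dual_span n phi -> dual_span_pred n (stripr K k phi).
Proof.
move=> H; elim: H k => {n phi} [|n|n c phi psi _ IH1 _ IH2|n l phi H IH] k.
- exact: stripr_wvac.
- by case: n => //= n; exact: DSzero.
- by rewrite oper_lin_fun; exact: dual_span_pred_lin.
have -> : stripr K k (eop A l phi) = (fun w => (k == l)%:R * phi w +
    (fun w => \sum_j A l k j * eop A l (stripr K j phi) w) w).
  apply/funext => w; rewrite -[LHS]/((stripr K k * eop A l) phi w) stripr_eop //.
  by rewrite operDE oper_sumE.
by apply: DSlin => //; apply: dual_span_sum => j; apply: dual_span_predE.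
Qed.

Lemma dual_span_lop n phi k : dual_span n phi -> dual_span n.+1 (lop A k phi).
Proof.
elim=> {n phi} [|n|n c phi psi _ IH1 _ IH2|n l phi H IH].
- by rewrite lop_wvac //; apply: DSeop; exact: DSvac.
- by rewrite oper0_fun; exact: DSzero.
- by rewrite oper_lin_fun; exact: DSlin.
have -> : lop A k (eop A l phi) = eop A l (lop A k phi).
  by rewrite -[LHS]/((lop A k * eop A l) phi) lop_eop.
exact: DSeop.
Qed.

Lemma dual_span_top n phi : dual_span n phi -> dual_span n (top A phi).
Proof.
(* The outer induction on the degree is needed since the recursive call is made on [gop A k phi],
   which is not a subderivation. *)
elim/ltn_ind: n phi => n IHn phi H; elim: H IHn => {n phi}.
- by rewrite top_wvac => *; exact: DSvac.
- by move=> n _; rewrite oper0_fun; exact: DSzero.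
- by move=> n c phi psi _ IH1 _ IH2 IHn; rewrite oper_lin_fun; apply: DSlin; auto.
move=> n k phi H _ IHn.
have -> : top A (eop A k phi) = lop A k (top A (gop A k phi)).
  by rewrite -[LHS]/((top A * eop A k) phi) top_eop.
by apply: dual_span_lop; apply: IHn => //; exact: dual_span_gop.
Qed.

Definition eword (w : seq 'I_3) : oper K := \prod_(k <- w) eop A k.

Lemma dual_span_eword w : dual_span (size w) (eword w (wvac K)).
Proof.
elim: w => [|k w IH]; first by rewrite /eword big_nil; exact: DSvac.
by rewrite /eword big_cons; exact: DSeop.
Qed.

Lemma dual_span_ind_words n phi (L : wfun K -> K) :
  (forall c phi psi, L (fun w => c * phi w + psi w) = c * L phi + L psi) ->
  (forall w, size w = n -> L (eword w (wvac K)) = 0) -> dual_span n phi -> L phi = 0.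
Proof.
move=> Llin Lw H.
have L0 (L' : wfun K -> K) :
    (forall c phi psi, L' (fun w => c * phi w + psi w) = c * L' phi + L' psi) ->
    L' (fun _ => 0) = 0.
  move=> lin; rewrite -[RHS](addNr (L' (fun _ => 0))) -mulN1r -lin.
  by congr L'; apply/funext => w; rewrite mulr0 addr0.
elim: H L Llin Lw => {n phi} [|n|n c phi psi _ IH1 _ IH2|n k phi H IH] L Llin Lw.
- by have := Lw [::] erefl; rewrite /eword big_nil.
- exact: L0.
- by rewrite Llin IH1 // IH2 // mulr0 addr0.
apply: (IH (fun phi => L (eop A k phi))) => [c phi' psi|w sw].
  by rewrite oper_lin_fun Llin.
by have := Lw (k :: w); rewrite /eword big_cons /= sw => /(_ erefl).
Qed.

(** Pairing with the finitely many words in the E_k detects the whole span and exhibits the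
    annihilator as the kernel of a linear map. *)
Definition word_pairings n (x : Tn K n) : Tn K n :=
  [ffun u => pairing x (eword (wseq u) (wvac K))].

Lemma word_pairings_linear n : linear (@word_pairings n).
Proof. by move=> c x y; apply/ffunP => u; rewrite !ffunE pairing_linl. Qed.
HB.instance Definition _ n :=
  GRing.isLinear.Build K (Tn K n) (Tn K n) *:%R (@word_pairings n) (@word_pairings_linear n).

Definition dual_ann n : {vspace Tn K n} := lker (linfun (@word_pairings n)).

Lemma dual_annP n (x : Tn K n) :
  x \in dual_ann n <-> (forall phi, dual_span n phi -> pairing x phi = 0).
Proof.
rewrite memv_ker lfunE /=; split=> [/eqP E phi|H].
  apply: dual_span_ind_words => [c phi1 phi2|w sw]; first exact: pairing_linr.
  have [u <-] := wseq_surj sw.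
  by have := congr1 (fun f : Tn K n => f u) E; rewrite !ffunE.
apply/eqP/ffunP => u; rewrite !ffunE; apply: H.
by rewrite -[n in dual_span n](size_wseq u); exact: dual_span_eword.
Qed.

Lemma mem_tsub i j (U : {vspace Tn K i}) (V : {vspace Tn K j}) s t :
  s \in U -> t \in V -> tmul s t \in tsub U V.
Proof.
have tl c (s1 s2 : Tn K i) (t1 : Tn K j) :
    tmul (c *: s1 + s2) t1 = c *: tmul s1 t1 + tmul s2 t1.
  rewrite /tmul scaler_sumr -big_split; apply: eq_bigr => u _.
  rewrite /= scaler_sumr -big_split; apply: eq_bigr => v _.
  by rewrite !ffunE mulrDl scalerDl scalerA mulrA.
have tr c (s1 : Tn K i) (t1 t2 : Tn K j) :
    tmul s1 (c *: t1 + t2) = c *: tmul s1 t1 + tmul s1 t2.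
  rewrite /tmul scaler_sumr -big_split; apply: eq_bigr => u _.
  rewrite /= scaler_sumr -big_split; apply: eq_bigr => v _.
  by rewrite !ffunE mulrDr scalerDl scalerA mulrCA.
have t0l (t1 : Tn K j) : tmul (0 : Tn K i) t1 = 0.
  by rewrite /tmul !big1 // => u _; rewrite big1 // => v _; rewrite ffunE mul0r scale0r.
have t0r (s1 : Tn K i) : tmul s1 (0 : Tn K j) = 0.
  by rewrite /tmul !big1 // => u _; rewrite big1 // => v _; rewrite ffunE mulr0 scale0r.
move=> sU tV; rewrite (coord_vbasis sU).
elim/big_rec: _ => [|a y _ IH]; first by rewrite t0l mem0v.
rewrite tl memvD // memvZ // (coord_vbasis tV).
elim/big_rec: _ => [|b z _ IH']; first by rewrite t0r mem0v.
rewrite tr memvD // memvZ // memv_span //.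
by apply/allpairsP; exists ((vbasis U)`_a, (vbasis V)`_b); rewrite !mem_nth ?size_tuple.
Qed.

Definition wleft m n (w : Wd (m + n)) : Wd m := [ffun t => w (lshift n t)].
Definition wright m n (w : Wd (m + n)) : Wd n := [ffun t => w (rshift m t)].

Lemma wleft_wcat m n (u : Wd m) (v : Wd n) : wleft (wcat u v) = u.
Proof. by apply/ffunP => t; rewrite !ffunE (unsplitK (inl t)). Qed.
Lemma wright_wcat m n (u : Wd m) (v : Wd n) : wright (wcat u v) = v.
Proof. by apply/ffunP => t; rewrite !ffunE (unsplitK (inr t)). Qed.
Lemma wcatK m n (w : Wd (m + n)) : wcat (wleft w) (wright w) = w.
Proof.
apply/ffunP => t; rewrite ffunE -[in RHS](splitK t).
by case: (split t) => s; rewrite ffunE.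
Qed.

Lemma tmulE m n (s : Tn K m) (t : Tn K n) w : tmul s t w = s (wleft w) * t (wright w).
Proof.
have E u v : ((s u * t v : K) *: tbasis K (wcat u v)) w =
    (s u * t v) * (w == wcat u v)%:R by rewrite !ffunE.
rewrite /tmul sum_ffunE (bigD1 (wleft w)) //= sum_ffunE (bigD1 (wright w)) //=.
rewrite E wcatK eqxx mulr1 !big1 ?addr0 // => [u nu|v nv].
  rewrite sum_ffunE big1 // => v _; rewrite E.
  case: eqP => [E'|_]; last exact: mulr0.
  by rewrite E' wleft_wcat eqxx in nu.
rewrite E; case: eqP => [E'|_]; last exact: mulr0.
by rewrite E' wright_wcat eqxx in nv.
Qed.

Lemma sum_wcat m n (F : Wd (m + n) -> K) :
  \sum_w F w = \sum_(u : Wd m) \sum_(v : Wd n) F (wcat u v).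
Proof.
rewrite pair_bigA /= (reindex (fun p : Wd m * Wd n => wcat p.1 p.2)) //=.
exists (fun w => (wleft w, wright w)) => [[u v]|w] _ /=; last exact: wcatK.
by rewrite wleft_wcat wright_wcat.
Qed.

(** Linear algebra: the annihilator of a tensor product U (x) W is the sum of ann(U) (x) T and T (x)
    ann(W). *)
Lemma dual_ann_coideal i j (z : Tn K (i + j)) :
  (forall phi psi, dual_span i phi -> dual_span j psi ->
     pairing z (ext_tensor i phi psi) = 0) ->
  z \in (tsub (dual_ann i) fullv + tsub fullv (dual_ann j))%VS.
Proof.
move=> H.
(* Expand [z] along its right factor and project each coefficient onto the left annihilator; [r]
   regroups the complementary parts along the left factor. *)
pose c (v : Wd j) : Tn K i := [ffun u => z (wcat u v)].
pose P := projv (dual_ann i).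
pose r (u : Wd i) : Tn K j := [ffun v => (c v - P (c v)) u].
have -> : z = \sum_v tmul (P (c v)) (tbasis K v) + \sum_u tmul (tbasis K u) (r u).
  apply/ffunP => w; rewrite ffunE !sum_ffunE.
  rewrite (bigD1 (wright w)) //= (bigD1 (wleft w)) //=.
  rewrite !tmulE !ffunE !eqxx mulr1 mul1r !big1 ?addr0 => [|u nu|v nv].
  - by rewrite addrC subrK wcatK.
  - by rewrite tmulE ffunE eq_sym (negPf nu) mul0r.
  - by rewrite tmulE ffunE eq_sym (negPf nv) mulr0.
apply: memv_add; [apply: memv_suml => v _ | apply: memv_suml => u _]; apply: mem_tsub; rewrite ?memvf ?memv_proj //.
apply/dual_annP => psi Hpsi.
(* Contracting [z] with [psi] gives an element of the left annihilator. Hence [d - P d] is zero, and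
   its coordinates are the pairings of the [r u] with [psi]. *)
pose d := \sum_v psi (wseq v) *: c v.
have dI : d \in dual_ann i.
  apply/dual_annP => phi Hphi; rewrite -[RHS](H phi psi) // /d pairing_suml.
  rewrite [RHS]/pairing [RHS]sum_wcat [RHS]exchange_big; apply: eq_bigr => v _.
  rewrite pairingZl [LHS]mulr_sumr; apply: eq_bigr => u' _; rewrite ffunE wseq_wcat.
  rewrite /ext_tensor take_size_cat ?size_wseq // drop_size_cat ?size_wseq //.
  by rewrite mulrCA (mulrC (psi _)).
transitivity ((d - P d) u); last by rewrite projv_id // subrr ffunE.
rewrite /d linear_sum -sumrB sum_ffunE; apply: eq_bigr => v _.
by rewrite linearZ /= -scalerBr !ffunE mulrC.
Qed.

Lemma dual_span_prefix m n u phi : size u = m -> dual_span (m + n) phi ->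
  dual_span n (fun w => phi (u ++ w)).
Proof.
elim: u m phi => [|k u IH] m phi /= <- //.
by move=> /(@dual_span_stripl _ _ k) /(IH _ _ erefl).
Qed.

Lemma dual_span_suffix m n v phi : size v = n -> dual_span (m + n) phi ->
  dual_span m (fun w => phi (w ++ v)).
Proof.
elim/last_ind: v n phi => [|v k IH] n phi /=.
  move=> <-; rewrite addn0 (_ : (fun w => phi (w ++ [::])) = phi) //.
  by apply/funext => w; rewrite cats0.
rewrite size_rcons => <-; rewrite addnS => /(@dual_span_stripr _ _ k) /(IH _ _ erefl).
rewrite (_ : (fun w => phi (w ++ rcons v k)) = (fun w => stripr K k phi (w ++ v))) //.
by apply/funext => w; rewrite /= rcons_cat.
Qed.

Lemma gop_supp i phi w : (forall u, size u = size w -> phi u = 0) -> gop A i phi w = 0.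
Proof.
elim: w phi => [|k w IH] phi H /=; first exact: H.
rewrite big1 // => j _; rewrite -[gact _ _ _]/(gop A i (stripl K j phi) w) IH ?mulr0 //.
by move=> u su /=; apply: H; rewrite /= su.
Qed.

Lemma eop_supp l phi w : (forall u, (size u).+1 = size w -> phi u = 0) -> eop A l phi w = 0.
Proof.
elim: w phi => [//|k w IH] phi H /=.
rewrite -[gact _ _ _]/(gop A l phi w) gop_supp => [|u su]; last by apply: H; rewrite su.
rewrite -[eact _ _ _ _]/(eop A l (stripl K k phi) w) IH ?mulr0 ?addr0 //.
by move=> u su; apply: H => /=; rewrite su.
Qed.

Lemma dual_span_supp n phi : dual_span n phi -> supp_on n phi.
Proof.
elim=> {n phi} [[]|n|n c phi psi _ IH1 _ IH2 w nw|n k phi _ IH w nw] //.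
  by rewrite IH1 // IH2 // mulr0 addr0.
by apply: eop_supp => u su; apply: IH; rewrite -eqSS su.
Qed.

Lemma star_wvac_r phi : star A phi (wvac K) = phi.
Proof.
apply/funext => w; elim/last_ind: w phi => [|w l IH] phi; first by rewrite /= mulr1.
rewrite -[LHS]/((stripr K l * star A phi) (wvac K) w) stripr_star operDE oper_sumE.
rewrite operME stripr_wvac oper0 addr0 -[RHS]/(stripr K l phi w) -IH.
have X j : xop A l j (wvac K) = (fun u => (l == j)%:R * wvac K u + (fun _ => 0) u).
  by apply/funext => -[|k u]; rewrite /= /wvac /= !(mulr0, addr0).
under eq_bigr do rewrite operME X oper_lin oper0 addr0.
rewrite (bigD1 l) // big1 => [|j nj]; last by rewrite eq_sym (negPf nj) mul0r.
by rewrite eqxx mul1r; exact: addr0.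
Qed.

Lemma dual_span_star i j phi psi :
  dual_span i phi -> dual_span j psi -> dual_span (i + j) (star A phi psi).
Proof.
move=> Hphi; elim=> {j psi} [|n|n c psi psi' _ IH1 _ IH2|n k psi H IH].
- by rewrite star_wvac_r addn0.
- by rewrite oper0_fun; exact: DSzero.
- by rewrite oper_lin_fun; exact: DSlin.
rewrite addnS -[star _ _ _]/((star A phi * eop A k) psi) star_eop //.
exact: DSeop.
Qed.

(** Each clause is dual to a closure property of the span: ideals on both sides to deletions of
    outer letters, coideal to [star], antipode to [top]. In degrees 0 and 1 the span separates all
    words. *)
Theorem dual_ann_hopf : hopf_ideal A dual_ann.
Proof.
split.
- split; apply/eqP; rewrite -subv0; apply/subvP => x /dual_annP H; rewrite memv0.
    apply/eqP/ffunP => u; rewrite ffunE.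
    have := H _ DSvac; rewrite /pairing (bigD1 u) //= big1 ?addr0 => [|v nv].
      by rewrite /wvac -size_eq0 size_wseq mulr1.
    by case/eqP: nv; apply/ffunP => -[].
  apply/eqP/ffunP => u; rewrite ffunE.
  have := H _ (DSeop (u ord0) DSvac); rewrite /pairing (bigD1 u) //= big1 ?addr0 => [|v nv].
    have -> : wseq u = [:: u ord0] by rewrite /wseq enum_ordSl enum_ord0.
    by rewrite /= eqxx mul1r addr0 mulr1.
  have -> : wseq v = [:: v ord0] by rewrite /wseq enum_ordSl enum_ord0.
  rewrite /= addr0; case: eqP => [E|_]; last by rewrite mul0r mulr0.
  by case/eqP: nv; apply/ffunP => t; rewrite (ord1 t).
- move=> m n s x /dual_annP H; apply/dual_annP => phi Hphi.
  rewrite pairing_tmul big1 // => u _.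
  transitivity (s u * pairing x (fun w => phi (wseq u ++ w))); last first.
    by rewrite (H _ (dual_span_prefix (size_wseq u) Hphi)) mulr0.
  by rewrite [RHS]mulr_sumr; apply: eq_bigr => v _; rewrite mulrA.
- move=> m n x t /dual_annP H; apply/dual_annP => phi Hphi.
  rewrite pairing_tmul exchange_big big1 // => v _.
  transitivity (t v * pairing x (fun w => phi (w ++ wseq v))); last first.
    by rewrite (H _ (dual_span_suffix (size_wseq v) Hphi)) mulr0.
  by rewrite [RHS]mulr_sumr; apply: eq_bigr => u _; rewrite mulrCA mulrA.
- move=> i j x /dual_annP H; apply: dual_ann_coideal => phi psi Hphi Hpsi.
  rewrite pairing_Dcop ?leq_addr //; last exact: dual_span_supp.
  by apply: H; exact: dual_span_star.
move=> n x /dual_annP H; apply/dual_annP => phi Hphi.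
by rewrite /antipode pairingZl pairing_W0 // H ?mulr0 //; exact: dual_span_top.
Qed.

Theorem nichols_finite_dim_of_nilpotent :
  (exists N, forall w, (N <= size w)%N -> eword w = 0) -> nichols_finite_dim A.
Proof.
move=> [N HN]; exists N => n Nn x; exists dual_ann; split; first exact: dual_ann_hopf.
apply/dual_annP => phi; apply: dual_span_ind_words => [c f g|w sw].
  exact: pairing_linr.
by rewrite HN ?sw // /pairing big1 // => u _; rewrite mulr0.
Qed.
End DualSubalgebra.

(** * Spans of ordered monomials *)

Section Spans.
Variables (K : fieldType) (R : algType K).

(** A predicate instead of a [{vspace _}], since the algebra of operators is
    infinite-dimensional. *)
Inductive lspan (G : R -> Prop) : R -> Prop :=
  | LSpan0 : lspan G 0
  | LSpan_gen u : G u -> lspan G u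
  | LSpan_lin c u v : lspan G u -> lspan G v -> lspan G (c *: u + v).

Lemma lspanD G u v : lspan G u -> lspan G v -> lspan G (u + v).
Proof. by move=> hu hv; rewrite -[u]scale1r; exact: LSpan_lin. Qed.

Lemma lspanZ G c u : lspan G u -> lspan G (c *: u).
Proof. by move=> hu; rewrite -[_ *: _]addr0; apply: LSpan_lin => //; exact: LSpan0. Qed.

Lemma lspanN G u : lspan G u -> lspan G (- u).
Proof. by rewrite -scaleN1r; exact: lspanZ. Qed.

Lemma lspan_mull (G G' : R -> Prop) a u :
  (forall v, G v -> lspan G' (a * v)) -> lspan G u -> lspan G' (a * u).
Proof.
move=> H; elim=> {u} [|u /H//|c u v _ hu _ hv]; first by rewrite mulr0; exact: LSpan0.
by rewrite mulrDr -scalerAr; exact: LSpan_lin.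
Qed.

Lemma lspan_mulr (G G' : R -> Prop) a u :
  (forall v, G v -> lspan G' (v * a)) -> lspan G u -> lspan G' (u * a).
Proof.
move=> H; elim=> {u} [|u /H//|c u v _ hu _ hv]; first by rewrite mul0r; exact: LSpan0.
by rewrite mulrDl -scalerAl; exact: LSpan_lin.
Qed.

Lemma lspan_eq0 (G : R -> Prop) u : (forall v, G v -> v = 0) -> lspan G u -> u = 0.
Proof. by move=> H; elim=> {u} [//|u /H//|c u v _ -> _ ->]; rewrite scaler0 addr0. Qed.

(** [G n] stands for the ordered monomials of degree n: if left multiplication by a letter can be
    straightened in the span, every word is a combination of such monomials. *)
Lemma words_vanish (T : Type) (E : T -> R) (G : nat -> R -> Prop) (N : nat) :
  lspan (G 0%N) 1 -> (forall n k u, G n u -> lspan (G n.+1) (E k * u)) ->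
  (forall n u, (N <= n)%N -> G n u -> u = 0) ->
  forall w, (N <= size w)%N -> \prod_(k <- w) E k = 0.
Proof.
move=> G0 GS GN w Nw; apply: (@lspan_eq0 (G (size w))) => [u|]; first exact: GN.
elim: w {Nw} => [|k w IH]; first by rewrite big_nil.
by rewrite big_cons; apply: lspan_mull IH => v; exact: GS.
Qed.

Lemma expr_eq0_ge (u : R) m n : u ^+ m = 0 -> (m <= n)%N -> u ^+ n = 0.
Proof. by move=> u0 mn; rewrite -(subnK mn) exprD u0 mulr0. Qed.

(* Moving all factors [z i] to the left costs a scalar, so a long word contains a high power of some [z i]. *)
Lemma qcomm_words_vanish (z : nat -> R) (c : nat -> nat -> K) (r M : nat) :
  (forall i j, z i * z j = c i j *: (z j * z i)) ->
  (forall i, z i ^+ M = 0) -> (forall i, (r <= i)%N -> z i = 0) ->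
  forall s, (r * M < size s)%N -> \prod_(i <- s) z i = 0.
Proof.
move=> zC zM zr s lt.
have [/hasP[i si ri]|/hasPn sr] := boolP (has (fun i => r <= i)%N s).
  elim: s si {lt} => //= j s IH; rewrite inE big_cons => /predU1P[<-|/IH ->].
    by rewrite zr // mul0r.
  by rewrite mulr0.
have collect i : exists k, \prod_(j <- s) z j =
    k *: (z i ^+ count_mem i s * \prod_(j <- s | j != i) z j).
  elim: s {lt sr} => [|j s [k IH]]; first by exists 1; rewrite !big_nil expr0 mulr1 scale1r.
  rewrite !big_cons IH /=; have [->|nji] := eqVneq j i.
    by exists k; rewrite add1n exprS -scalerAr mulrA.
  rewrite add0n; move: (count_mem i s) => m.
  have [k' E] : exists k', z j * z i ^+ m = k' *: (z i ^+ m * z j).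
    elim: m => [|m [k' E]]; first by exists 1; rewrite expr0 mulr1 mul1r scale1r.
    exists (c j i * k'); rewrite exprS mulrA zC -scalerAl -(mulrA (z i) (z j)) E -scalerAr scalerA.
    by rewrite mulrA.
  by exists (k * k'); rewrite -scalerAr mulrA E -scalerAl scalerA mulrA.
(* Pigeonhole: more than [r * M] factors have indices below [r]. *)
have [i Mi] : exists i, (M <= count_mem i s)%N.
  apply: contrapT => /forallNP H.
  have : (size s <= r * M)%N.
    have -> : size s = (\sum_(i < r) count_mem (i : nat) s)%N.
      elim: s sr {lt collect H} => [|j s IH] sr; first by rewrite big1.
      rewrite /= big_split /= -IH => [|i si]; last by apply: sr; rewrite inE si orbT.
      have jr : (j < r)%N by rewrite ltnNge sr // mem_head.
      rewrite (bigD1 (Ordinal jr)) //= eqxx big1 ?addn0 // => i nij.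
      by apply/eqP; rewrite eqb0; apply: contraNneq nij => ij; apply/eqP/val_inj.
    rewrite -[r in (_ <= r * _)%N]card_ord -sum_nat_const; apply: leq_sum => i _.
    by have /negP := H i; rewrite -ltnNge => /ltnW.
  by rewrite leqNgt lt.
have [k ->] := collect i.
by rewrite (expr_eq0_ge (zM i) Mi) mul0r scaler0.
Qed.

(** The z_i span a left factor and the block letters a right factor, as in a smash product.
    Straightening preserves the number of letters, with [d i] letters in z_i. A nonzero monomial has
    fewer than N1 factors z_i of degree below D and fewer than N2 block letters. *)
Lemma smash_words_vanish (E : 'I_3 -> R) (x y : R) (z : nat -> R) (d : nat -> nat)
    (D N1 N2 : nat) :
  let e (b : bool) := if b then x else y in
  E ord0 = x -> E 1 = y -> E ord_max = z 0 -> d 0%N = 1%N ->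
  (forall b i, lspan (fun u => (exists j b', d j = d i /\ u = z j * e b') \/
                               (exists j, d j = (d i).+1 /\ u = z j)) (e b * z i)) ->
  (forall i, (D <= d i)%N -> z i = 0) ->
  (forall s, (N1 <= size s)%N -> \prod_(i <- s) z i = 0) ->
  (forall w, (N2 <= size w)%N -> \prod_(b <- w) e b = 0) ->
  forall w, (N1 * D + N2 <= size w)%N -> \prod_(k <- w) E k = 0.
Proof.
move=> e E0 E1 E2 d0 ez zD zN eN.
pose G n u := exists s w, u = \prod_(i <- s) z i * \prod_(b <- w) e b
                       /\ (sumn (map d s) + size w = n)%N.
have Gz i n u : G n u -> G (d i + n)%N (z i * u).
  by case=> s [w [-> <-]]; exists (i :: s), w; rewrite big_cons mulrA addnA.
have Ge n u b : G n u -> lspan (G n.+1) (e b * u).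
  case=> s [w [-> <-]]; rewrite mulrA -addSn.
  have H : lspan (G (sumn (map d s)).+1) (e b * \prod_(i <- s) z i).
    elim: s b => [|i s IH] b /=.
      rewrite big_nil mulr1; apply: LSpan_gen; exists [::], [:: b].
      by rewrite big_nil mul1r big_seq1.
    rewrite big_cons mulrA; apply: lspan_mulr (ez b i) => v [[j [b' [dj ->]]]|[j [dj ->]]].
      rewrite -mulrA -addnS -dj; apply: lspan_mull (IH b') => v' /(Gz j).
      exact: LSpan_gen.
    apply: LSpan_gen; rewrite -addSn -dj; apply: Gz; exists s, [::].
    by rewrite big_nil mulr1 addn0.
  apply: lspan_mulr H => v [s' [w' [-> <-]]]; apply: LSpan_gen; exists s', (w' ++ w).
  by rewrite big_cat mulrA size_cat addnA.
apply: (words_vanish (G := G)).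
- by apply: LSpan_gen; exists [::], [::]; rewrite !big_nil mulr1.
- move=> n k u Gu.
  case: k => [[|[|[|//]]] kP].
  + by rewrite (_ : Ordinal kP = ord0) ?E0; [exact: (Ge n u true) | exact: val_inj].
  + by rewrite (_ : Ordinal kP = 1) ?E1; [exact: (Ge n u false) | exact: val_inj].
  + rewrite (_ : Ordinal kP = ord_max) ?E2; last exact: val_inj.
    by apply: LSpan_gen; rewrite -add1n -d0; exact: Gz.
move=> n u Nn [s [w [-> sn]]].
have [lt|/zN ->] := ltnP (size s) N1; last by rewrite mul0r.
have [lt'|/eN ->] := ltnP (size w) N2; last by rewrite mulr0.
have [/hasP[i si Di]|/hasPn sD] := boolP (has (fun i => D <= d i)%N s).
  have -> : \prod_(i <- s) z i = 0.
    elim: s si {sn lt} => //= j s IH; rewrite inE big_cons => /predU1P[<-|/IH ->].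
      by rewrite zD // mul0r.
    by rewrite mulr0.
  by rewrite mul0r.
have : (sumn (map d s) <= size s * D)%N.
  elim: s sD {sn lt} => //= j s IH sD; rewrite mulSn leq_add ?IH //.
    by apply: ltnW; rewrite ltnNge sD // mem_head.
  by move=> i si; apply: sD; rewrite inE si orbT.
have : (size s * D <= N1 * D)%N by rewrite leq_mul2r ltnW ?orbT.
by lia.
Qed.
End Spans.

(** * Skew derivations *)

Section SkewDerivations.
Variables (K : fieldType) (R : algType K).

Lemma mulA_eq (a b r : R) : a * b = r -> forall w, w * a * b = w * r.
Proof. by move=> <- w; rewrite mulrA. Qed.

(** The Leibniz rule with the s-number (n)_s in place of n. *)
Lemma skew_pow (P D u : R) (s : K) n : P * u = u * P + D -> D * u = s *: (u * D) ->
  P * u ^+ n = u ^+ n * P + (\sum_(i < n) s ^+ i) *: (u ^+ n.-1 * D).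
Proof.
move=> Pu Du; elim: n => [|n IH].
  by rewrite expr0 big_ord0 scale0r addr0 mulr1 mul1r.
rewrite exprSr mulrA IH mulrDl -mulrA Pu mulrDr mulrA -addrA; congr (_ + _).
rewrite -scalerAl -mulrA Du -scalerAr scalerA mulrA.
case: n {IH} => [|n]; first by rewrite !big_ord0 mul0r scale0r addr0 expr0 big_ord_recl
  big_ord0 addr0 expr0 scale1r.
rewrite [n.+1.-1]/= -exprSr -[X in X + _]scale1r -scalerDl; congr (_ *: _).
by rewrite [RHS]big_ord_recl expr0 mulr_suml; congr (_ + _); apply: eq_bigr => i _; rewrite -exprSr.
Qed.

(** The solution of the recursion [jordan_coefS]; every value with n = p contains the factor p. *)
Definition jordan_coef n k : K := (-1) ^+ k * (n ^_ k.+1)%:R.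

Lemma jordan_coefS n k :
  jordan_coef n k.+1 - (k.+2)%:R * jordan_coef n k = jordan_coef n.+1 k.+1.
Proof.
rewrite /jordan_coef; have <- : (n ^_ k.+2 + k.+2 * n ^_ k.+1 = n.+1 ^_ k.+2)%N.
  rewrite ffactSS ffactnSr; have [kn|nk] := leqP k.+1 n; last by rewrite ffact_small // !muln0.
  by rewrite mulnC -mulnDl; congr (_ * _)%N; lia.
rewrite natrD natrM exprS; move: ((-1) ^+ k) => s; ring.
Qed.

(** The commutator with A is a derivation that sends B to B^2, hence B^n to n B^(n+1). *)
Lemma mulX_jordan (A B : R) n : A * B = B * A + B * B -> B ^+ n * A = A * B ^+ n - n%:R *: B ^+ n.+1.
Proof.
move=> AB; elim: n => [|n IH]; first by rewrite expr0 mulr1 mul1r scale0r subr0.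
rewrite exprSr -mulrA (_ : B * A = A * B - B * B); last by rewrite AB addrK.
rewrite mulrBr (mulrA _ A) IH -natr1 !exprSr.
by move: (n%:R : K) (B ^+ n) => s u; nc_ring K.
Qed.

(* Since [A B = B A + B^2], [D] moves past [A] exactly as [B^2] does; the sum is thus formally
   [ad(A)^(p-1)(B^2) B^-2 D] for [n = p] in characteristic [p], and [ad(A)^(p-1)(B^2) = p! B^(p+1)]. *)
Lemma jordan_pow (P A B D : R) n :
  P * A = A * P + D -> A * B = B * A + B * B -> D * A = (A - 2%:R *: B) * D ->
  P * A ^+ n = A ^+ n * P + \sum_(k < n) jordan_coef n k *: (A ^+ (n.-1 - k) * B ^+ k * D).
Proof.
move=> PA AB DA; elim: n => [|n IH]; first by rewrite big_ord0 expr0 mulr1 mul1r addr0.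
rewrite [in LHS]exprSr mulrA IH mulrDl -mulrA PA mulrDr mulrA -exprSr -addrA; congr (_ + _).
rewrite mulr_suml big_ord_recl expr0 mulr1 subn0 /=.
have E (k : 'I_n) : jordan_coef n k *: (A ^+ (n.-1 - k) * B ^+ k * D) * A =
   jordan_coef n k *: (A ^+ (n - k) * B ^+ k * D)
   - (k.+2%:R * jordan_coef n k) *: (A ^+ (n - k.+1) * B ^+ k.+1 * D).
  have -> : (n.-1 - k = n - k.+1)%N by lia.
  have -> : (n - k = (n - k.+1).+1)%N by have := ltn_ord k; lia.
  rewrite -scalerAl -(mulrA _ D) DA (_ : A ^+ (n - k.+1) * B ^+ k * ((A - 2%:R *: B) * D) =
      A ^+ (n - k.+1) * (B ^+ k * A) * D - 2%:R *: (A ^+ (n - k.+1) * (B ^+ k * B) * D)).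
    have -> : k.+2%:R = k%:R + 2%:R :> K by rewrite -natrD addn2.
    rewrite (mulX_jordan k AB) !exprSr.
    by move: (A ^+ _) (B ^+ k) (k%:R : K) (jordan_coef n k) => a b s t; nc_ring K.
  by move: (A ^+ _) (B ^+ k) => a b; nc_ring K.
under eq_bigr do rewrite E.
rewrite sumrB.
have -> : \sum_(k < n) jordan_coef n k *: (A ^+ (n - k) * B ^+ k * D) =
   \sum_(k < n.+1) jordan_coef n k *: (A ^+ (n - k) * B ^+ k * D).
  rewrite big_ord_recr /= (_ : jordan_coef n n = 0) ?scale0r ?addr0 //.
  by rewrite /jordan_coef ffact_small // mulr0.
rewrite big_ord_recl /= subn0 expr0 mulr1 -addrA -sumrB (addrA (A ^+ n * D)).
have -> : A ^+ n * D + jordan_coef n 0 *: (A ^+ n * D) = jordan_coef n.+1 0 *: (A ^+ n * D).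
  rewrite -[X in X + _]scale1r -scalerDl; congr (_ *: _).
  by rewrite /jordan_coef !mul1r !ffactn1 -natr1 addrC.
congr (_ + _); apply: eq_bigr => k _; rewrite /bump /= add1n.
by rewrite -scalerBl jordan_coefS.
Qed.

Lemma jordan_pow_pchar (P A B D : R) p : p \in [pchar K] ->
  P * A = A * P + D -> A * B = B * A + B * B -> D * A = (A - 2%:R *: B) * D ->
  P * A ^+ p = A ^+ p * P.
Proof.
move=> pK PA AB DA; rewrite (jordan_pow p PA AB DA) big1 ?addr0 // => k _.
have := ltn_ord k; case: p pK k => // p pK k _.
by rewrite /jordan_coef ffactSS natrM (pcharf0 pK) mul0r mulr0 scale0r.
Qed.

(* [x], [y], [z] act like the letters of the Nichols algebra (the paper's [x_2], [x_1], [x_3]) and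
   [px], [py], [pz] like the associated skew derivations; the last axiom is the defining property of
   a Nichols algebra, that an element killed by all skew derivations vanishes. *)
Record skew_system (eps sg q b c : K) (x y z px py pz g h : R) (aug : R -> Prop) : Prop := {
  ss_px_x : px * x = x * px + g; ss_px_y : px * y = y * px; ss_px_z : px * z = z * px;
  ss_py_x : py * x = x * py; ss_py_y : py * y = y * py + g; ss_py_z : py * z = z * py;
  ss_pz_x : pz * x = x * pz; ss_pz_y : pz * y = y * pz; ss_pz_z : pz * z = z * pz + h;
  ss_g_x : g * x = (eps *: x + c *: y) * g; ss_g_y : g * y = eps *: (y * g);
  ss_g_z : g * z = sg *: (z * g);
  ss_h_x : h * x = (x + b *: y) * h; ss_h_y : h * y = y * h; ss_h_z : h * z = q *: (z * h);
  ss_aug_x : aug x; ss_aug_y : aug y; ss_aug_z : aug z;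
  ss_augM : forall u v, aug u -> aug (u * v);
  ss_augD : forall u v, aug u -> aug v -> aug (u + v);
  ss_augZ : forall s u, aug u -> aug (s *: u);
  ss_vanish : forall u, aug u -> px * u = u * px -> py * u = u * py -> pz * u = u * pz -> u = 0
}.

Section System.
Variables (eps sg q b c : K) (x y z px py pz g h : R) (aug : R -> Prop).
Hypothesis S : skew_system eps sg q b c x y z px py pz g h aug.

Lemma ss_augN u : aug u -> aug (- u).
Proof. by rewrite -scaleN1r; exact: (ss_augZ S). Qed.

Lemma ss_augX u n : aug u -> (0 < n)%N -> aug (u ^+ n).
Proof. by case: n => // n au _; rewrite exprS; exact: (ss_augM S). Qed.

Lemma ss_nilpotent u n s dx dy dz : aug u -> (0 < n)%N -> \sum_(i < n) s ^+ i = 0 ->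
  px * u = u * px + dx -> dx * u = s *: (u * dx) ->
  py * u = u * py + dy -> dy * u = s *: (u * dy) ->
  pz * u = u * pz + dz -> dz * u = s *: (u * dz) -> u ^+ n = 0.
Proof.
move=> au n0 sn ex cx ey cy ez cz; apply: (ss_vanish S); first exact: ss_augX.
- by rewrite (skew_pow n ex cx) sn scale0r addr0.
- by rewrite (skew_pow n ey cy) sn scale0r addr0.
- by rewrite (skew_pow n ez cz) sn scale0r addr0.
Qed.
End System.
End SkewDerivations.

Ltac ss_aug S :=
  repeat first [exact: (ss_aug_x S) | exact: (ss_aug_y S) | exact: (ss_aug_z S) | assumption
    | apply: (ss_augD S) | apply: (ss_augN S) | apply: (ss_augZ S) | apply: (ss_augM S)].

(** * Jordan and super Jordan planes *)

Ltac nc_expand rules :=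
  rewrite ?(mulrDl, mulrDr, mulrBl, mulrBr, mulNr, mulrN, =^~ scalerAl, =^~ scalerAr, mulrA, rules).

Section Rank2.
Variables (K : fieldType) (R : algType K).
Variables (eps sg q b c : K) (x y z px py pz g h : R) (aug : R -> Prop).
Hypothesis S : skew_system eps sg q b c x y z px py pz g h aug.

Definition ss_relg := ((ss_g_x S, ss_g_y S, ss_g_z S),
  (mulA_eq (ss_g_x S), mulA_eq (ss_g_y S), mulA_eq (ss_g_z S))).
Definition ss_relh := ((ss_h_x S, ss_h_y S, ss_h_z S),
  (mulA_eq (ss_h_x S), mulA_eq (ss_h_y S), mulA_eq (ss_h_z S))).
Definition ss_relx := ((ss_px_x S, ss_px_y S, ss_px_z S),
  (mulA_eq (ss_px_x S), mulA_eq (ss_px_y S), mulA_eq (ss_px_z S)), ss_relg).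
Definition ss_rely := ((ss_py_x S, ss_py_y S, ss_py_z S),
  (mulA_eq (ss_py_x S), mulA_eq (ss_py_y S), mulA_eq (ss_py_z S)), ss_relg).
Definition ss_relz := ((ss_pz_x S, ss_pz_y S, ss_pz_z S),
  (mulA_eq (ss_pz_x S), mulA_eq (ss_pz_y S), mulA_eq (ss_pz_z S)), ss_relh).

Lemma mulX_comm_left (P u : R) n : P * u = u * P -> P * u ^+ n = u ^+ n * P.
Proof. by move=> Pu; apply: commrX. Qed.
End Rank2.

Ltac nc_close K := rewrite ?(mulr0, mul0r, scaler0, addr0, add0r); nc_ring K.

(** * The Jordan plane *)

Section Jordan.
Variables (K : fieldType) (R : algType K).
Variables (sg q b : K) (x y z px py pz g h : R) (aug : R -> Prop).
Hypothesis S : skew_system 1 sg q b (- 2%:R) x y z px py pz g h aug.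
Variable p : nat.
Hypothesis pK : p \in [pchar K].

(** [py] sends xy - yx - y^2 to -(c + 2) y g, which is why the system is normalized to c = -2. *)
Lemma jordan_xy : x * y = y * x + y * y.
Proof.
apply/eqP; rewrite -subr_eq0; apply/eqP; apply: (ss_vanish S); first by ss_aug S.
- by nc_expand (ss_relx S); nc_ring K.
- by nc_expand (ss_rely S); nc_ring K.
- by nc_expand (ss_relz S); nc_ring K.
Qed.

Lemma sum_expr1_pchar : \sum_(i < p) 1 ^+ i = 0 :> K.
Proof. by under eq_bigr do rewrite expr1n; rewrite sumr_const card_ord (pcharf0 pK). Qed.

Lemma jordan_y_nilpotent : y ^+ p = 0.
Proof.
have p0 : (0 < p)%N by apply: prime_gt0; exact: pcharf_prime pK.
apply: (ss_nilpotent S (ss_aug_y S) p0 sum_expr1_pchar (dx := 0) (dy := g) (dz := 0)).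
all: by nc_expand (ss_relx S, ss_rely S, ss_relz S); nc_ring K.
Qed.

Lemma jordan_x_nilpotent : x ^+ p = 0.
Proof.
have p0 : (0 < p)%N by apply: prime_gt0; exact: pcharf_prime pK.
apply: (ss_vanish S); first by apply: (ss_augX S) => //; exact: (ss_aug_x S).
- apply: (jordan_pow_pchar pK (ss_px_x S) jordan_xy).
  by nc_expand (ss_relg S); nc_ring K.
- by apply: mulX_comm_left; exact: (ss_py_x S).
- by apply: mulX_comm_left; exact: (ss_pz_x S).
Qed.

Lemma jordan_x_powy n : x * y ^+ n = y ^+ n * x + n%:R *: y ^+ n.+1.
Proof. by rewrite (mulX_jordan n jordan_xy) subrK. Qed.

Lemma jordan_words_vanish (w : seq bool) : (p + p <= size w)%N ->
  \prod_(b <- w) (if b then x else y) = 0.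
Proof.
pose G n u := exists i j, u = y ^+ i * x ^+ j /\ (i + j = n)%N.
apply: (words_vanish (G := G)) => [|n [] u [i [j [-> <-]]]|n u Nn [i [j [-> E]]]].
- by apply: LSpan_gen; exists 0%N, 0%N; rewrite !expr0 mulr1.
- rewrite mulrA jordan_x_powy mulrDl -scalerAl addrC.
  apply: LSpan_lin; apply: LSpan_gen.
    by exists i.+1, j; rewrite addSn.
  by exists i, j.+1; rewrite -mulrA -exprS addnS.
- by apply: LSpan_gen; exists i.+1, j; rewrite exprS mulrA addSn.
have [ip|/(expr_eq0_ge jordan_y_nilpotent) ->] := ltnP i p; last by rewrite mul0r.
have [jp|/(expr_eq0_ge jordan_x_nilpotent) ->] := ltnP j p; last by rewrite mulr0.
lia.
Qed.
End Jordan.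

(** * The super Jordan plane *)

Section SuperJordan.
Variables (K : fieldType) (R : algType K).
Variables (sg q b : K) (x y z px py pz g h : R) (aug : R -> Prop).
Hypothesis S : skew_system (-1) sg q b 1 x y z px py pz g h aug.
Variable p : nat.
Hypothesis pK : p \in [pchar K].
Variable t : R.
Hypothesis t_def : t = x * y + y * x.

Lemma super_yy : y * y = 0.
Proof.
apply: (ss_vanish S); first by ss_aug S.
- by nc_expand (ss_relx S); nc_ring K.
- by nc_expand (ss_rely S); nc_ring K.
- by nc_expand (ss_relz S); nc_ring K.
Qed.

Lemma super_ty : t * y = y * t.
Proof.
by rewrite t_def mulrDl mulrDr !mulrA -(mulrA x y y) super_yy mulr0 add0r mul0r addr0.
Qed.

Lemma super_xy : x * y = t - y * x.
Proof. by rewrite t_def addrK. Qed.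

Lemma super_px_t : px * t = t * px.
Proof. by rewrite t_def; nc_expand (ss_relx S); nc_ring K. Qed.
Lemma super_py_t : py * t = t * py + y * g.
Proof. by rewrite t_def; nc_expand (ss_rely S); nc_ring K. Qed.
Lemma super_pz_t : pz * t = t * pz.
Proof. by rewrite t_def; nc_expand (ss_relz S); nc_ring K. Qed.
Lemma super_g_t : g * t = t * g.
Proof.
rewrite t_def; nc_expand (ss_relg S); rewrite ?super_yy ?(mulA_eq super_yy).
by nc_close K.
Qed.
Lemma super_h_t : h * t = t * h.
Proof.
rewrite t_def; nc_expand (ss_relh S); rewrite ?super_yy ?(mulA_eq super_yy).
by nc_close K.
Qed.
Lemma super_aug_t : aug t.
Proof. by rewrite t_def; ss_aug S. Qed.

Lemma super_xt : x * t = t * x + y * t.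
Proof.
apply/eqP; rewrite -subr_eq0; apply/eqP; apply: (ss_vanish S).
- by have := super_aug_t => ?; ss_aug S.
- by nc_expand (ss_relx S, super_px_t, mulA_eq super_px_t, super_g_t); nc_ring K.
- nc_expand (ss_rely S, super_py_t, mulA_eq super_py_t, super_g_t).
  rewrite ?(super_yy, mulA_eq super_yy, super_ty, mulA_eq super_ty, super_xy, mulA_eq super_xy).
  by nc_close K.
- nc_expand (ss_relz S, super_pz_t, mulA_eq super_pz_t, super_h_t).
  by nc_close K.
Qed.

Definition super_rules := ((super_yy, super_ty, super_xy, super_xt),
  (mulA_eq super_yy, mulA_eq super_ty, mulA_eq super_xy, mulA_eq super_xt)).

Lemma super_t_nilpotent : t ^+ p = 0.
Proof.
have p0 : (0 < p)%N by apply: prime_gt0; exact: pcharf_prime pK.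
apply: (ss_nilpotent S super_aug_t p0 (sum_expr1_pchar pK) (dx := 0) (dy := y * g) (dz := 0)).
- by rewrite super_px_t addr0.
- by rewrite mul0r mulr0 scaler0.
- exact: super_py_t.
- by rewrite -mulrA super_g_t !mulrA super_ty scale1r.
- by rewrite super_pz_t addr0.
- by rewrite mul0r mulr0 scaler0.
Qed.

(** x^2 and t satisfy the Jordan relation, and the derivative of x^2 under [px] is y g, so the
    Jordan argument applies to x^2. *)
Lemma super_xx_nilpotent : (x * x) ^+ p = 0.
Proof.
have p0 : (0 < p)%N by apply: prime_gt0; exact: pcharf_prime pK.
apply: (ss_vanish S); first by apply: (ss_augX S) => //; ss_aug S.
- apply: (jordan_pow_pchar (B := t) (D := y * g) pK).
  + by nc_expand (ss_relx S); nc_ring K.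
  + by nc_expand super_rules; nc_close K.
  + by nc_expand (super_rules, ss_relg S); nc_close K.
- by apply: mulX_comm_left; nc_expand (ss_rely S).
- by apply: mulX_comm_left; nc_expand (ss_relz S).
Qed.

Lemma super_x_nilpotent : x ^+ (2 * p) = 0.
Proof. by rewrite exprM expr2 super_xx_nilpotent. Qed.

Lemma super_x_powt n : x * t ^+ n = t ^+ n * x + n%:R *: (y * t ^+ n).
Proof.
elim: n => [|n IH]; first by rewrite expr0 scale0r addr0 mulr1 mul1r.
rewrite exprSr mulrA IH mulrDl -!mulrA super_xt -natr1 -scalerAl.
have E : t ^+ n * y = y * t ^+ n by apply/esym/commrX; rewrite /GRing.comm super_ty.
rewrite mulrDr (mulrA _ y) E.
by move: (t ^+ n) (n%:R : K) => u s; nc_ring K.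
Qed.

(** The normal form is y^i t^j x^k with i < 2, j < p, k < 2p. As t consists of two letters, the
    largest degree is 1 + 2(p-1) + (2p-1) = 4p - 2. *)
Lemma super_words_vanish (w : seq bool) : (4 * p <= size w)%N ->
  \prod_(b <- w) (if b then x else y) = 0.
Proof.
pose G n u := exists i j k, u = y ^+ i * t ^+ j * x ^+ k /\ (i + 2 * j + k = n)%N.
have Ggen i j k : lspan (G (i + 2 * j + k)%N) (y ^+ i * t ^+ j * x ^+ k).
  by apply: LSpan_gen; exists i, j, k.
have y2 i : y ^+ i.+2 = 0 by rewrite !exprS mulrA super_yy mul0r.
apply: (words_vanish (G := G)) => [|n [] u [i [j [k [-> <-]]]]|n u Nn [i [j [k [-> E]]]]].
- by have := Ggen 0%N 0%N 0%N; rewrite !expr0 !mulr1.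
- case: i => [|[|i]]; last by rewrite y2 !mul0r mulr0; exact: LSpan0.
    rewrite expr0 mul1r mulrA super_x_powt mulrDl -scalerAl addrC -mulrA -exprS.
    apply: LSpan_lin; first by have := Ggen 1%N j k; rewrite expr1 add1n.
    by have := Ggen 0%N j k.+1; rewrite expr0 mul1r addnS.
  rewrite expr1 !mulrA super_xy mulrBl mulrBl -exprS -!mulrA (mulrA x) super_x_powt.
  have -> : y * ((t ^+ j * x + j%:R *: (y * t ^+ j)) * x ^+ k) = y * t ^+ j * x ^+ k.+1.
    rewrite mulrA mulrDr -scalerAr (mulrA y y) super_yy mul0r scaler0 addr0.
    by rewrite -!mulrA -exprS.
  apply: lspanD.
    by have := Ggen 0%N j.+1 k; rewrite expr0 mul1r; congr (lspan (G _)); lia.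
  apply: lspanN.
  by have := Ggen 1%N j k.+1; rewrite expr1; congr (lspan (G _)); lia.
- have := Ggen i.+1 j k; rewrite exprS !mulrA; by congr (lspan (G _)); lia.
have [ip|ip] := ltnP i 2; last by rewrite -(subnK ip) addn2 y2 !mul0r.
have [jp|/(expr_eq0_ge super_t_nilpotent) ->] := ltnP j p; last by rewrite mulr0 mul0r.
have [kp|/(expr_eq0_ge super_x_nilpotent) ->] := ltnP k (2 * p); last by rewrite mulr0.
lia.
Qed.
End SuperJordan.

(** * One block and one point *)

Section WeakInteraction.
Variables (K : fieldType) (R : algType K).
Variables (eps q b c : K) (x y z px py pz g h : R) (aug : R -> Prop).
Hypothesis S : skew_system eps 1 q b c x y z px py pz g h aug.

(** Iterated braided commutators with x: the scalar is the eigenvalue of g on z_n (see [g_zfam]). *)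
Fixpoint zfam n : R := if n is n'.+1 then x * zfam n' - eps ^+ n' *: (zfam n' * x) else z.

(** The derivative of z_n under [pz] (see [pz_zfam]); x + b y is the conjugate of x by h. *)
Fixpoint ffam n : R :=
  if n is n'.+1 then x * ffam n' - eps ^+ n' *: (ffam n' * (x + b *: y)) else 1.

Hypothesis y_zfam : forall n, y * zfam n = eps ^+ n *: (zfam n * y).

Lemma g_zfam n : g * zfam n = eps ^+ n *: (zfam n * g).
Proof.
elim: n => [|n IH] /=; first by rewrite (ss_g_z S) expr0.
rewrite mulrBr -scalerAr !mulrA IH (ss_g_x S) -scalerAl -!mulrA IH (ss_g_x S) exprS.
have := y_zfam n; move: (zfam n) (eps ^+ n) => u e yu.
have -> : (eps *: x + c *: y) * (e *: (u * g)) = e *: (eps *: (x * u) * g + c *: (y * u) * g).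
  by nc_ring K.
rewrite yu; by nc_ring K.
Qed.

Lemma h_zfam n : h * zfam n = q *: (zfam n * h).
Proof.
elim: n => [|n IH] /=; first exact: (ss_h_z S).
rewrite mulrBr -scalerAr !mulrA IH (ss_h_x S) -scalerAl -!mulrA IH (ss_h_x S).
have := y_zfam n; move: (zfam n) (eps ^+ n) => u e yu.
have -> : (x + b *: y) * (q *: (u * h)) = q *: ((x * u) * h + b *: (y * u) * h).
  by nc_ring K.
rewrite yu; by nc_ring K.
Qed.

(** The two terms of the commutator contribute g z_n and eps^n z_n g, which cancel. The z_n are thus
    constants for the derivations of the block, and [pz] alone decides relations between them. *)
Lemma px_zfam n : px * zfam n = zfam n * px.
Proof.
elim: n => [|n IH] /=; first exact: (ss_px_z S).
rewrite mulrBr mulrBl -scalerAr !mulrA IH (ss_px_x S) -!mulrA (ss_px_x S) mulrDl -!mulrA.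
rewrite IH g_zfam.
by move: (zfam n) (eps ^+ n) => u e; nc_ring K.
Qed.

Lemma py_zfam n : py * zfam n = zfam n * py.
Proof.
elim: n => [|n IH] /=; first exact: (ss_py_z S).
rewrite mulrBr mulrBl -scalerAr !mulrA IH (ss_py_x S) -!mulrA (ss_py_x S) IH.
by move: (zfam n) (eps ^+ n) => u e; nc_ring K.
Qed.

Lemma pz_zfam n : pz * zfam n = zfam n * pz + ffam n * h.
Proof.
elim: n => [|n IH] /=; first by rewrite mul1r (ss_pz_z S).
rewrite mulrBr -scalerAr !mulrA IH (ss_pz_x S) -!mulrA IH.
have -> : (zfam n * pz + ffam n * h) * x = zfam n * (x * pz) + ffam n * ((x + b *: y) * h).
  by rewrite mulrDl -!mulrA (ss_pz_x S) (ss_h_x S).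
by move: (zfam n) (ffam n) (eps ^+ n) => u f e; nc_ring K.
Qed.

Lemma aug_zfam n : aug (zfam n).
Proof.
elim: n => [|n IH] /=; ss_aug S.
Qed.

Variable p : nat.
Hypothesis pK : p \in [pchar K].
Hypotheses (eps2 : eps * eps = 1) (q2 : q * q = 1).
Hypothesis f_zfam : forall m n, ffam m * zfam n = eps ^+ (m * n) *: (zfam n * ffam m).

Lemma exprM_eps2 n : eps ^+ n * eps ^+ n = 1.
Proof. by rewrite -exprMn eps2 expr1n. Qed.

(** Under [pz] the terms with f_m cancel by [f_zfam], those with f_n because eps^(mn) and q both
    square to 1. *)
Lemma zfam_comm m n : zfam m * zfam n = (eps ^+ (m * n) * q) *: (zfam n * zfam m).
Proof.
apply/eqP; rewrite -subr_eq0; apply/eqP; apply: (ss_vanish S).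
- have := (aug_zfam m) => ?; have := (aug_zfam n) => ?; ss_aug S.
- rewrite mulrBr -scalerAr !mulrA !px_zfam -!mulrA !px_zfam.
  by move: (zfam n) (zfam m) (eps ^+ _) => u v e; nc_ring K.
- rewrite mulrBr -scalerAr !mulrA !py_zfam -!mulrA !py_zfam.
  by move: (zfam n) (zfam m) (eps ^+ _) => u v e; nc_ring K.
rewrite mulrBr -scalerAr !mulrA !pz_zfam !mulrDl -!mulrA !pz_zfam !h_zfam.
rewrite -!scalerAr !(mulrA (ffam _)) !f_zfam (mulnC n m).
have := exprM_eps2 (m * n); move: (zfam n) (zfam m) (ffam n) (ffam m) (eps ^+ _) => u v f f' e e2.
nc_ring K.
have -> : 1 * (1 * 1) + -1 * (e * q * (q * (e * (1 * 1) * 1))) = 1 - (e * e) * (q * q) by ring.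
by rewrite e2 q2 mulr1 subrr.
Qed.

(** Pairing consecutive terms gives p (1 + s); the exponent 2p serves s = 1 and s = -1 alike. *)
Lemma sum_expr_sq1 (s : K) : s * s = 1 -> \sum_(i < 2 * p) s ^+ i = 0.
Proof.
move=> s2; suff -> n : \sum_(i < 2 * n) s ^+ i = n%:R * (1 + s).
  by rewrite (pcharf0 pK) mul0r.
elim: n => [|n IH]; first by rewrite muln0 big_ord0 mul0r.
have s2n : s ^+ (2 * n) = 1 by rewrite exprM expr2 s2 expr1n.
by rewrite mulnS !big_ord_recr /= IH exprS s2n mulr1 -natr1 mulrDl mul1r addrA.
Qed.

Lemma zfam_nilpotent n : zfam n ^+ (2 * p) = 0.
Proof.
have p0 : (0 < 2 * p)%N by rewrite muln_gt0 /= prime_gt0 // (pcharf_prime pK).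
have s2 : (q * eps ^+ (n * n)) * (q * eps ^+ (n * n)) = 1.
  by rewrite mulrACA q2 exprM_eps2 mulr1.
apply: (ss_nilpotent S (aug_zfam n) p0 (sum_expr_sq1 s2) (dx := 0) (dy := 0)
  (dz := ffam n * h)).
- by rewrite px_zfam addr0.
- by rewrite mul0r mulr0 scaler0.
- by rewrite py_zfam addr0.
- by rewrite mul0r mulr0 scaler0.
- exact: pz_zfam.
rewrite -mulrA h_zfam -scalerAr (mulrA (ffam n)) f_zfam.
by move: (zfam n) (ffam n) (eps ^+ _) => u f e; nc_ring K.
Qed.

Lemma zfam_eq0 r n : ffam r = 0 -> (r <= n)%N -> zfam n = 0.
Proof.
move=> fr; elim: n => [|n IH].
  rewrite leqn0 => /eqP r0; apply: (ss_vanish S (ss_aug_z S)).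
  - exact: (px_zfam 0).
  - exact: (py_zfam 0).
  by have := pz_zfam 0; rewrite -[in ffam 0]r0 fr mul0r addr0.
rewrite leq_eqVlt => /predU1P[E|]; last first.
  by rewrite ltnS => /IH /= ->; rewrite mulr0 mul0r scaler0 subrr.
apply: (ss_vanish S (aug_zfam n.+1)); rewrite ?px_zfam ?py_zfam //.
by rewrite pz_zfam -E fr mul0r addr0.
Qed.

Lemma weak_smash (E : 'I_3 -> R) (r N1 N2 : nat) :
  E ord0 = x -> E 1 = y -> E ord_max = z ->
  (forall n, (r <= n)%N -> zfam n = 0) ->
  (forall s, (N1 <= size s)%N -> \prod_(i <- s) zfam i = 0) ->
  (forall w : seq bool, (N2 <= size w)%N -> \prod_(b <- w) (if b then x else y) = 0) ->
  exists N, forall w, (N <= size w)%N -> \prod_(k <- w) E k = 0.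
Proof.
(* z_i consists of i + 1 letters, so z_i = 0 for i >= r becomes the degree bound r + 1. *)
move=> E0 E1 E2 zr zN eN; exists (N1 * r.+1 + N2)%N.
apply: (smash_words_vanish (z := zfam) (d := fun i => i.+1) E0 E1 E2) => //.
move=> b' i; case: b'.
  have -> : x * zfam i = eps ^+ i *: (zfam i * x) + zfam i.+1 by rewrite /= addrC subrK.
  apply: LSpan_lin; apply: LSpan_gen; first by left; exists i, true.
  by right; exists i.+1.
rewrite y_zfam; apply/lspanZ/LSpan_gen; left; by exists i, false.
Qed.

Lemma weak_words_vanish (E : 'I_3 -> R) (r N2 : nat) :
  E ord0 = x -> E 1 = y -> E ord_max = z -> ffam r = 0 ->
  (forall w : seq bool, (N2 <= size w)%N -> \prod_(b <- w) (if b then x else y) = 0) ->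
  exists N, forall w, (N <= size w)%N -> \prod_(k <- w) E k = 0.
Proof.
move=> E0 E1 E2 fr eN.
have zr n : (r <= n)%N -> zfam n = 0 by exact: zfam_eq0.
apply: (weak_smash (N1 := (r * (2 * p)).+1) E0 E1 E2 zr) eN.
exact: qcomm_words_vanish zfam_comm zfam_nilpotent zr.
Qed.
End WeakInteraction.

(** * A Jordan block with weak interaction *)

Section WeakJordan.
Variables (K : fieldType) (R : algType K).
Variables (q b : K) (x y z px py pz g h : R) (aug : R -> Prop).
Hypothesis S : skew_system 1 1 q b (- 2%:R) x y z px py pz g h aug.
Variable p : nat.
Hypothesis pK : p \in [pchar K].
Local Notation zf := (zfam 1 x z).
Local Notation ff := (ffam 1 b x y).

Lemma jordan_yz : y * z = z * y.
Proof.
apply/eqP; rewrite -subr_eq0; apply/eqP; apply: (ss_vanish S); first by ss_aug S.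
- by nc_expand (ss_relx S); nc_ring K.
- by nc_expand (ss_rely S); nc_ring K.
- by nc_expand (ss_relz S); nc_ring K.
Qed.

Lemma jordan_y_zfam n : y * zf n = 1 ^+ n *: (zf n * y).
Proof.
rewrite expr1n scale1r; elim: n => [|n IH] /=; first exact: jordan_yz.
have yx : y * x = x * y - y * y by rewrite (jordan_xy S) addrK.
rewrite expr1n scale1r mulrBr !mulrA yx IH mulrBl -!(mulrA _ y (zf n)) IH.
rewrite (mulrA y) IH.
have -> : zf n * y * x = zf n * (x * y - y * y) by rewrite -yx mulrA.
by move: (zf n) => u; nc_ring K.
Qed.

(** The recursion multiplies the coefficient by n - b at each step, so mu is the product of the i -
    b over i < n. *)
Lemma jordan_ffam n : exists mu, ff n = mu *: y ^+ n.
Proof.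
elim: n => [|n [mu E]] /=; first by exists 1; rewrite expr0 scale1r.
exists (mu * (n%:R - b)).
rewrite E expr1n scale1r -scalerAr (jordan_x_powy S) -scalerAl mulrDr -scalerAr -exprSr.
by move: (y ^+ n * x) (y ^+ n.+1) (n%:R : K) => u v s; nc_ring K.
Qed.

Lemma jordan_f_zfam m n : ff m * zf n = 1 ^+ (m * n) *: (zf n * ff m).
Proof.
have [mu ->] := jordan_ffam m.
rewrite expr1n scale1r -scalerAl -scalerAr; congr (_ *: _); apply/esym/commrX.
by rewrite /GRing.comm jordan_y_zfam expr1n scale1r.
Qed.

Lemma weak_jordan_words_vanish (E : 'I_3 -> R) : q * q = 1 ->
  E ord0 = x -> E 1 = y -> E ord_max = z ->
  exists N, forall w, (N <= size w)%N -> \prod_(k <- w) E k = 0.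
Proof.
move=> q2 E0 E1 E2.
have fp : ff p = 0.
  by have [mu ->] := jordan_ffam p; rewrite (jordan_y_nilpotent S pK) scaler0.
exact: (weak_words_vanish S jordan_y_zfam pK (mulr1 1) q2 jordan_f_zfam E0 E1 E2 fp
  (jordan_words_vanish S pK)).
Qed.

(** * The cube root of unity: Cartan type A_2 *)

Section CubeRoot.
Hypotheses (b1 : b = 1) (q3 : 1 + q + q * q = 0).
Variables z1 v : R.
Hypothesis z1_def : z1 = zf 1.
Hypothesis v_def : v = z1 * z - q *: (z * z1).

Lemma cube_ffam1 : ff 1 = - y.
Proof. by rewrite /= b1; nc_ring K. Qed.
(** The coefficient of y^2 is (0 - b)(1 - b), zero at b = 1. *)
Lemma cube_ffam2 : ff 2 = 0.
Proof.
rewrite -[ff 2]/(x * ff 1 - 1 ^+ 1 *: (ff 1 * (x + b *: y))) cube_ffam1 expr1 b1.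
have xy := jordan_xy S; rewrite mulrN xy; nc_ring K.
Qed.
Lemma cube_zfam n : (2 <= n)%N -> zf n = 0.
Proof. by apply: (zfam_eq0 S jordan_y_zfam); exact: cube_ffam2. Qed.

Lemma cube_y_z1 : y * z1 = z1 * y.
Proof. by rewrite z1_def jordan_y_zfam expr1 scale1r. Qed.
Lemma cube_h_z1 : h * z1 = q *: (z1 * h).
Proof. by rewrite z1_def (h_zfam S jordan_y_zfam). Qed.
Lemma cube_px_z1 : px * z1 = z1 * px.
Proof. by rewrite z1_def (px_zfam S jordan_y_zfam). Qed.
Lemma cube_py_z1 : py * z1 = z1 * py.
Proof. by rewrite z1_def (py_zfam S). Qed.
Lemma cube_pz_z1 : pz * z1 = z1 * pz - y * h.
Proof. by rewrite z1_def (pz_zfam S) cube_ffam1 mulNr. Qed.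
Lemma cube_aug_z1 : aug z1.
Proof. by rewrite z1_def; exact: (aug_zfam S 1). Qed.

Definition cube_rules :=
  let E1 := jordan_yz in let E2 := cube_y_z1 in
  let E3 := cube_h_z1 in let E4 := ss_h_z S in
  let E5 := cube_px_z1 in let E6 := ss_px_z S in
  let E7 := cube_py_z1 in let E8 := ss_py_z S in
  let E9 := cube_pz_z1 in let E10 := ss_pz_z S in
  ((E1, E2, E3, E4, E5, E6, E7, E8, E9, E10),
   (mulA_eq E1, mulA_eq E2, mulA_eq E3, mulA_eq E4, mulA_eq E5, mulA_eq E6, mulA_eq E7,
    mulA_eq E8, mulA_eq E9, mulA_eq E10)).

(** z and z1 are the simple root vectors of A_2, and v is the root vector of their sum. *)
Lemma cube_z1_z : z1 * z = v + q *: (z * z1).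
Proof. by rewrite v_def subrK. Qed.

Lemma cube_y_v : y * v = v * y.
Proof. by rewrite v_def; move: cube_rules => rls; nc_expand rls; nc_ring K. Qed.
Lemma cube_h_v : h * v = (q * q) *: (v * h).
Proof. by rewrite v_def; move: cube_rules => rls; nc_expand rls; nc_ring K. Qed.
Lemma cube_px_v : px * v = v * px.
Proof. by rewrite v_def; move: cube_rules => rls; nc_expand rls; nc_ring K. Qed.
Lemma cube_py_v : py * v = v * py.
Proof. by rewrite v_def; move: cube_rules => rls; nc_expand rls; nc_ring K. Qed.
Lemma cube_pz_v : pz * v = v * pz + (1 - q * q) *: (z1 * h).
Proof. by rewrite v_def; move: cube_rules => rls; nc_expand rls; nc_ring K. Qed.

Lemma cube_aug_v : aug v.
Proof. by rewrite v_def; have := cube_aug_z1 => ?; ss_aug S. Qed.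

Definition cube_rules2 :=
  let E1 := cube_y_v in let E2 := cube_h_v in let E3 := cube_px_v in
  let E4 := cube_py_v in let E5 := cube_pz_v in let E6 := cube_z1_z in
  (cube_rules, (E1, E2, E3, E4, E5, E6),
   (mulA_eq E1, mulA_eq E2, mulA_eq E3, mulA_eq E4, mulA_eq E5, mulA_eq E6)).

Lemma cube_eq0 (r c : K) : r = c * (1 + q + q * q) -> r = 0.
Proof. by rewrite q3 mulr0. Qed.

Lemma cube_z1_v : z1 * v = (q * q) *: (v * z1).
Proof.
apply/eqP; rewrite -subr_eq0; apply/eqP; apply: (ss_vanish S).
- by have := cube_aug_z1 => ?; have := cube_aug_v => ?; ss_aug S.
- by move: cube_rules2 => rls; nc_expand rls; nc_ring K.
- by move: cube_rules2 => rls; nc_expand rls; nc_ring K.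
- move: cube_rules2 => rls; nc_expand rls; nc_ring K.
  (* The only surviving coefficient is (1 - q^2)(1 - q^3), that of z1^2 h. *)
  by apply: (cube_eq0 (c := (1 - q * q) * (1 - q))); ring.
Qed.

Lemma cube_z_v : z * v = q *: (v * z).
Proof.
apply/eqP; rewrite -subr_eq0; apply/eqP; apply: (ss_vanish S).
- by have := cube_aug_z1 => ?; have := cube_aug_v => ?; ss_aug S.
- by move: cube_rules2 => rls; nc_expand rls; nc_ring K.
- by move: cube_rules2 => rls; nc_expand rls; nc_ring K.
- move: cube_rules2 => rls; nc_expand rls; nc_ring K.
    by apply: (cube_eq0 (c := ((1 - q * q) * (1 - q)))); ring.
  by apply: (cube_eq0 (c := (q * (q - 1)))); ring.
Qed.

Lemma cube_sum : \sum_(i < 3) q ^+ i = 0.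
Proof. by rewrite !big_ord_recr big_ord0 /= expr0 expr1 add0r -q3. Qed.

Lemma cube_z_nilpotent : z ^+ 3 = 0.
Proof.
apply: (ss_nilpotent S (ss_aug_z S) (isT : (0 < 3)%N) cube_sum (dx := 0) (dy := 0) (dz := h)).
all: by move: cube_rules => rls; nc_expand rls; nc_ring K.
Qed.

Lemma cube_z1_nilpotent : z1 ^+ 3 = 0.
Proof.
apply: (ss_nilpotent S cube_aug_z1 (isT : (0 < 3)%N) cube_sum (dx := 0) (dy := 0)
  (dz := - (y * h))).
all: by move: cube_rules => rls; nc_expand rls; nc_ring K.
Qed.

Lemma cube_v_nilpotent : v ^+ 3 = 0.
Proof.
have E := cube_z1_v; have E' := mulA_eq cube_z1_v.
apply: (ss_nilpotent S cube_aug_v (isT : (0 < 3)%N) cube_sum (dx := 0) (dy := 0)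
  (dz := (1 - q * q) *: (z1 * h))).
all: move: cube_rules2 => rls; nc_expand (rls, E, E'); nc_ring K.
by apply: (cube_eq0 (c := ((1 - q * q) * q * (q - 1)))); ring.
Qed.

Lemma cube_pow_v (u : R) r n : u * v = r *: (v * u) -> u * v ^+ n = r ^+ n *: (v ^+ n * u).
Proof.
move=> uv; elim: n => [|n IH]; first by rewrite !expr0 mul1r mulr1 scale1r.
by rewrite exprSr mulrA IH -scalerAl -(mulrA _ u) uv -scalerAr scalerA mulrA -!exprSr.
Qed.

Lemma cube_z1_zpow i : exists s s' : K,
  z1 * z ^+ i.+1 = s *: (z ^+ i.+1 * z1) + s' *: (v * z ^+ i).
Proof.
elim: i => [|i [s [s' IH]]].
  by exists q, 1; rewrite expr1 expr0 mulr1 scale1r cube_z1_z addrC.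
exists (q * s), (s * q ^+ i.+1 + s').
have zv n : z ^+ n * v = q ^+ n *: (v * z ^+ n).
  elim: n => [|n IHn]; first by rewrite !expr0 mul1r mulr1 scale1r.
  rewrite exprS -mulrA IHn -scalerAr (mulrA z v) cube_z_v -scalerAl scalerA.
  by rewrite -[q ^+ n * q]exprSr mulrA.
rewrite [z ^+ i.+2 in LHS]exprSr mulrA IH mulrDl -!scalerAl -(mulrA _ z1) cube_z1_z.
rewrite mulrDr zv -scalerAr mulrA -[z ^+ i.+1 * z]exprSr -(mulrA v) -exprSr.
by move: (z ^+ _) (z ^+ _) (q ^+ _) => u u' r; nc_ring K.
Qed.

(** v replaces the two letters z1, z and counts twice. Exponents are at most 2, so nonzero ordered
    monomials have degree at most 8, well below 12. *)
Lemma cube_words_vanish (s : seq nat) : (12 <= size s)%N -> \prod_(i <- s) zf i = 0.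
Proof.
pose G n u := exists i j k, u = v ^+ i * z ^+ j * z1 ^+ k /\ (2 * i + j + k = n)%N.
have Ggen i j k : lspan (G (2 * i + j + k)%N) (v ^+ i * z ^+ j * z1 ^+ k).
  by apply: LSpan_gen; exists i, j, k.
apply: (words_vanish (G := G)) => [|n l u [i [j [k [-> <-]]]]|n u Nn [i [j [k [-> E]]]]].
- by have := Ggen 0%N 0%N 0%N; rewrite !expr0 !mulr1.
- case: l => [|[|l]]; last by rewrite cube_zfam // mul0r; exact: LSpan0.
    rewrite !mulrA [zf 0]/= (cube_pow_v i cube_z_v) -!scalerAl; apply: lspanZ.
    by have := Ggen i j.+1 k; rewrite exprS addnS addSn !mulrA.
  rewrite -z1_def !mulrA (cube_pow_v i cube_z1_v) -!scalerAl; apply: lspanZ.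
  case: j => [|j].
    by rewrite expr0 mulr1; have := Ggen i 0%N k.+1; rewrite expr0 mulr1 exprS addnS !mulrA.
  rewrite -(mulrA _ z1); have [s1 [s2 ->]] := cube_z1_zpow j.
  rewrite mulrDr mulrDl -!scalerAr -!scalerAl !mulrA.
  apply: LSpan_lin.
    by have := Ggen i j.+1 k.+1; rewrite [z1 ^+ k.+1]exprS addnS !mulrA.
  apply: lspanZ; rewrite -exprSr; have := Ggen i.+1 j k; congr (lspan (G _)); lia.
have [iv|/(expr_eq0_ge cube_v_nilpotent) ->] := ltnP i 3; last by rewrite !mul0r.
have [jv|/(expr_eq0_ge cube_z_nilpotent) ->] := ltnP j 3; last by rewrite mulr0 mul0r.
have [kv|/(expr_eq0_ge cube_z1_nilpotent) ->] := ltnP k 3; last by rewrite mulr0.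
lia.
Qed.
End CubeRoot.

Lemma cube_jordan_words_vanish (E : 'I_3 -> R) : b = 1 -> 1 + q + q * q = 0 ->
  E ord0 = x -> E 1 = y -> E ord_max = z ->
  exists N, forall w, (N <= size w)%N -> \prod_(k <- w) E k = 0.
Proof.
move=> b1 q3 E0 E1 E2.
exact: (weak_smash jordan_y_zfam E0 E1 E2 (cube_zfam b1)
  (cube_words_vanish b1 q3 erefl erefl) (jordan_words_vanish S pK)).
Qed.
End WeakJordan.

(** * A super Jordan block with weak interaction *)

Section WeakSuperJordan.
Variables (K : fieldType) (R : algType K).
Variables (q b : K) (x y z px py pz g h : R) (aug : R -> Prop).
Hypothesis S : skew_system (-1) 1 q b 1 x y z px py pz g h aug.
Variable p : nat.
Hypothesis pK : p \in [pchar K].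
Local Notation zf := (zfam (-1) x z).
Local Notation ff := (ffam (-1) b x y).
Variable t : R.
Hypothesis t_def : t = x * y + y * x.

Lemma super_yz : y * z = z * y.
Proof.
apply/eqP; rewrite -subr_eq0; apply/eqP; apply: (ss_vanish S); first by ss_aug S.
- by nc_expand (ss_relx S); nc_ring K.
- by nc_expand (ss_rely S); nc_ring K.
- by nc_expand (ss_relz S); nc_ring K.
Qed.

Lemma super_tz : t * z = z * t.
Proof.
apply/eqP; rewrite -subr_eq0; apply/eqP; apply: (ss_vanish S).
- by have := super_aug_t S t_def => ?; ss_aug S.
- by nc_expand (ss_relx S, super_px_t S t_def, mulA_eq (super_px_t S t_def)); nc_ring K.
- by nc_expand (ss_rely S, super_py_t S t_def, mulA_eq (super_py_t S t_def),
    super_yz, mulA_eq super_yz); nc_ring K.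
- by nc_expand (ss_relz S, super_pz_t S t_def, mulA_eq (super_pz_t S t_def), super_h_t S t_def);
    nc_ring K.
Qed.

(** The two claims need each other: y passes x at the cost of t, and t passes x at the cost of y
    t. *)
Lemma super_yt_zfam n : y * zf n = (-1) ^+ n *: (zf n * y) /\ t * zf n = zf n * t.
Proof.
elim: n => [|n [IHy IHt]] /=; first by rewrite expr0 scale1r super_tz super_yz.
have e2 : (-1) ^+ n * (-1) ^+ n = 1 :> K by rewrite -exprMn mulrNN mulr1 expr1n.
have tx : t * x = x * t - y * t by rewrite (super_xt S t_def) addrK.
have yx : y * x = t - x * y by rewrite t_def addrAC subrr add0r.
rewrite exprS; move: (zf n) ((-1) ^+ n) e2 IHy IHt => u e e2 IHy IHt; split.
  rewrite mulrBr -scalerAr !mulrA yx mulrBl -(mulrA x y) IHy IHt.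
  have -> : e *: ((e *: (u * y)) * x) = u * (t - x * y).
    by rewrite -scalerAl scalerA e2 scale1r -mulrA yx.
  have -> : u * (t - x * y) = u * t - (e * e) *: (u * x * y).
    by rewrite e2 scale1r mulrBr mulrA.
  by nc_ring K.
rewrite mulrBr -scalerAr !mulrA tx mulrBl -!(mulrA _ t u) IHt -(mulrA u t) tx (mulrA y) IHy.
by nc_ring K.
Qed.

Lemma super_powt_y n : t ^+ n * y = y * t ^+ n.
Proof. by apply/esym/commrX; rewrite /GRing.comm (super_ty S t_def). Qed.

(** The step to an odd index multiplies the coefficient by k - b. In the step to an even index all
    terms with y^2 drop out and x y + y x = t raises the power of t. *)
Lemma super_ffam k : (exists nu, ff (2 * k) = nu *: t ^+ k) /\
  (exists nu, ff (2 * k).+1 = nu *: (y * t ^+ k)).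
Proof.
have e2 n : (-1) ^+ (2 * n) = 1 :> K by rewrite exprM expr2 mulrNN mulr1 expr1n.
have odd_step n nu : ff (2 * n) = nu *: t ^+ n -> exists nu', ff (2 * n).+1 = nu' *: (y * t ^+ n).
  move=> E; exists (nu * (n%:R - b)).
  rewrite /= E e2 scale1r -scalerAr (super_x_powt S t_def) -scalerAl mulrDr -scalerAr super_powt_y.
  by move: (t ^+ n) (n%:R : K) => u s; nc_ring K.
elim: k => [|k [_ [nu E]]].
  have E : ff (2 * 0) = 1 *: t ^+ 0 by rewrite expr0 scale1r.
  by split; [exists 1 | exact: odd_step E].
have E' : ff (2 * k.+1) = nu *: t ^+ k.+1.
  rewrite mulnS -[ff _]/(x * ff (2 * k).+1 - (-1) ^+ (2 * k).+1 *: (ff (2 * k).+1 * (x + b *: y))).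
  rewrite E exprS e2 mulr1 scaleN1r opprK -scalerAr mulrA (super_xy t_def) mulrBl -mulrA.
  rewrite (super_x_powt S t_def) mulrDr -scalerAr (mulrA y y) (super_yy S) mul0r scaler0 addr0.
  rewrite -scalerAl mulrDr -scalerAr -(mulrA y _ y) super_powt_y (mulrA y y) (super_yy S).
  rewrite mul0r scaler0 addr0 exprS.
  by move: (t ^+ k) => u; nc_ring K.
by split; [exists nu | exact: odd_step E'].
Qed.

Lemma super_f_zfam m n : ff m * zf n = (-1) ^+ (m * n) *: (zf n * ff m).
Proof.
have [yz tz] := super_yt_zfam n.
have tkz k : t ^+ k * zf n = zf n * t ^+ k by apply/esym/commrX; rewrite /GRing.comm tz.
have [[nu E] [nu' E']] := super_ffam m./2.
rewrite -(odd_double_half m) -mul2n; case: (odd m); last first.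
  rewrite add0n E -mulnA exprM expr2 mulrNN mulr1 expr1n scale1r.
  by rewrite -scalerAl tkz scalerAr.
rewrite add1n E' mulSn exprD -mulnA (exprM _ 2) expr2 mulrNN mulr1 expr1n mulr1.
rewrite -scalerAl -mulrA tkz mulrA yz -scalerAl -scalerAr scalerA mulrC -scalerA mulrA.
by rewrite scalerA mulrC -scalerA.
Qed.

Lemma weak_super_words_vanish (E : 'I_3 -> R) : q * q = 1 ->
  E ord0 = x -> E 1 = y -> E ord_max = z ->
  exists N, forall w, (N <= size w)%N -> \prod_(k <- w) E k = 0.
Proof.
move=> q2 E0 E1 E2.
have fp : ff (2 * p) = 0.
  by have [[mu ->] _] := super_ffam p; rewrite (super_t_nilpotent S pK t_def) scaler0.
have e2 : -1 * -1 = 1 :> K by rewrite mulrNN mulr1.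
exact: (weak_words_vanish S (fun n => (super_yt_zfam n).1) pK e2 q2 super_f_zfam E0 E1 E2 fp
  (super_words_vanish S pK t_def)).
Qed.
End WeakSuperJordan.

(** * The Cyclops algebra *)

Lemma nc_rule (R : pzRingType) (a b r : R) : a * b = r ->
  (a * b = r) * (forall w, w * a * b = w * r).
Proof. by move=> <-; split=> // w; rewrite mulrA. Qed.

Section Cyclops.
Variables (K : fieldType) (R : algType K).
Variables (x y z px py pz g h : R) (aug : R -> Prop).
Hypothesis S : skew_system (-1) (-1) (-1) 1 1 x y z px py pz g h aug.
Variable p : nat.
Hypothesis pK : p \in [pchar K].

(** Here q12 q21 = -1 and the braided commutator w0 of y and z survives. z1 is that of x and z;
    since g z1 = (z1 - w0) g, v is minus that of x and z1. *)
Variables w0 z1 v : R.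
Hypotheses (w0_def : w0 = y * z + z * y) (z1_def : z1 = x * z + z * x)
  (v_def : v = (z1 - w0) * x - x * z1).

Definition cyc_rh := (nc_rule (ss_h_x S), nc_rule (ss_h_y S), nc_rule (ss_h_z S)).
Definition cyc_rg := (nc_rule (ss_g_x S), nc_rule (ss_g_y S), nc_rule (ss_g_z S)).
Definition cyc_rx := (nc_rule (ss_px_x S), nc_rule (ss_px_y S), nc_rule (ss_px_z S)).
Definition cyc_ry := (nc_rule (ss_py_x S), nc_rule (ss_py_y S), nc_rule (ss_py_z S)).
Definition cyc_rz := (nc_rule (ss_pz_x S), nc_rule (ss_pz_y S), nc_rule (ss_pz_z S)).

Lemma cyc_yy : y * y = 0.
Proof. exact: super_yy S. Qed.

Lemma cyc_xxy : x * x * y = y * x * x + y * x * y.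
Proof.
have xt := super_xt S erefl.
have -> : x * x * y = x * (x * y + y * x) - x * y * x by nc_ring K.
have -> : y * x * x + y * x * y
    = (x * y + y * x) * x + y * (x * y + y * x) - x * y * x - y * y * x by nc_ring K.
by rewrite xt cyc_yy mul0r subr0.
Qed.

Lemma cyc_yz : y * z = w0 - z * y.
Proof. by rewrite w0_def addrK. Qed.
Lemma cyc_xz : x * z = z1 - z * x.
Proof. by rewrite z1_def addrK. Qed.
Lemma cyc_xz1 : x * z1 = (z1 - w0) * x - v.
Proof. by rewrite v_def opprB addrC subrK. Qed.
Lemma cyc_yw0 : y * w0 = w0 * y.
Proof. by rewrite w0_def; nc_expand (nc_rule cyc_yy); nc_close K. Qed.

Lemma cyc_px_w0 : px * w0 = w0 * px.
Proof. by rewrite w0_def; nc_expand (cyc_rx, cyc_rg); nc_ring K. Qed.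
Lemma cyc_py_w0 : py * w0 = w0 * py.
Proof. by rewrite w0_def; nc_expand (cyc_ry, cyc_rg); nc_ring K. Qed.
Lemma cyc_pz_w0 : pz * w0 = w0 * pz + 2%:R *: (y * h).
Proof. by rewrite w0_def; nc_expand (cyc_rz, cyc_rh); nc_ring K. Qed.
Lemma cyc_g_w0 : g * w0 = w0 * g.
Proof. by rewrite w0_def; nc_expand cyc_rg; nc_ring K. Qed.
Lemma cyc_h_w0 : h * w0 = - (w0 * h).
Proof. by rewrite w0_def; nc_expand cyc_rh; nc_ring K. Qed.
Lemma cyc_px_z1 : px * z1 = z1 * px.
Proof. by rewrite z1_def; nc_expand (cyc_rx, cyc_rg); nc_ring K. Qed.
Lemma cyc_py_z1 : py * z1 = z1 * py.
Proof. by rewrite z1_def; nc_expand (cyc_ry, cyc_rg); nc_ring K. Qed.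
Lemma cyc_pz_z1 : pz * z1 = z1 * pz + (2%:R *: x + y) * h.
Proof. by rewrite z1_def; nc_expand (cyc_rz, cyc_rh); nc_ring K. Qed.
Lemma cyc_g_z1 : g * z1 = (z1 - w0) * g.
Proof. by rewrite z1_def w0_def; nc_expand cyc_rg; nc_ring K. Qed.
Lemma cyc_h_z1 : h * z1 = - ((z1 + w0) * h).
Proof. by rewrite z1_def w0_def; nc_expand cyc_rh; nc_ring K. Qed.

Lemma cyc_aug_w0 : aug w0.
Proof. by rewrite w0_def; ss_aug S. Qed.
Lemma cyc_aug_z1 : aug z1.
Proof. by rewrite z1_def; ss_aug S. Qed.
Lemma cyc_aug_v : aug v.
Proof. by rewrite v_def; have := cyc_aug_w0 => ?; have := cyc_aug_z1 => ?; ss_aug S. Qed.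

Definition cyc_rx1 := (cyc_rx, nc_rule cyc_px_w0, nc_rule cyc_px_z1, nc_rule cyc_g_z1, nc_rule cyc_g_w0, cyc_rg).
Definition cyc_ry1 := (cyc_ry, nc_rule cyc_py_w0, nc_rule cyc_py_z1, nc_rule cyc_g_z1, nc_rule cyc_g_w0, cyc_rg).
Definition cyc_rh1 := (nc_rule cyc_h_w0, nc_rule cyc_h_z1, cyc_rh).
Definition cyc_rz1 := (cyc_rz, nc_rule cyc_pz_w0, nc_rule cyc_pz_z1, cyc_rh1).

Lemma cyc_px_v : px * v = v * px.
Proof. by rewrite v_def; nc_expand cyc_rx1; nc_ring K. Qed.
Lemma cyc_py_v : py * v = v * py.
Proof. by rewrite v_def; nc_expand cyc_ry1; nc_ring K. Qed.
Lemma cyc_pz_v : pz * v = v * pz + (x * y - y * x) * h.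
Proof. by rewrite v_def; nc_expand (cyc_rz1, nc_rule cyc_yy); nc_close K. Qed.

Ltac cyc_vanish :=
  apply/eqP; rewrite -subr_eq0 ?subr0; apply/eqP; apply: (ss_vanish S);
  [have := cyc_aug_w0 => ?; have := cyc_aug_z1 => ?; have := cyc_aug_v => ?; ss_aug S | ..].

Lemma cyc_xw0 : x * w0 = w0 * x + 2%:R *: v.
Proof.
cyc_vanish.
- by nc_expand (cyc_rx1, nc_rule cyc_px_v); nc_ring K.
- by nc_expand (cyc_ry1, nc_rule cyc_py_v); nc_ring K.
- by nc_expand (cyc_rz1, nc_rule cyc_pz_v, nc_rule cyc_yy); nc_close K.
Qed.

Lemma cyc_yz1 : y * z1 = (z1 - w0) * y - 2%:R *: v.
Proof.
cyc_vanish.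
- by nc_expand (cyc_rx1, nc_rule cyc_px_v); nc_ring K.
- by nc_expand (cyc_ry1, nc_rule cyc_py_v); nc_ring K.
- by nc_expand (cyc_rz1, nc_rule cyc_pz_v, nc_rule cyc_yy); nc_close K.
Qed.

Definition cyc_re1 := (nc_rule cyc_yz, nc_rule cyc_xz, nc_rule cyc_yw0, nc_rule cyc_xw0,
  nc_rule cyc_yz1, nc_rule cyc_xz1, nc_rule cyc_yy).

Lemma cyc_g_v : g * v = - (v * g).
Proof.
rewrite {1}v_def; nc_expand (cyc_rg, nc_rule cyc_g_w0, nc_rule cyc_g_z1).
by nc_expand cyc_re1; nc_ring K.
Qed.
Lemma cyc_h_v : h * v = - (v * h).
Proof. by rewrite {1}v_def; nc_expand cyc_rh1; nc_expand cyc_re1; nc_ring K. Qed.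

Lemma cyc_yv : y * v = - (v * y).
Proof.
cyc_vanish.
- by nc_expand (cyc_rx1, nc_rule cyc_px_v); nc_ring K.
- by nc_expand (cyc_ry1, nc_rule cyc_py_v, nc_rule cyc_g_v); nc_ring K.
- by nc_expand (cyc_rz1, nc_rule cyc_pz_v, nc_rule cyc_yy); nc_close K.
Qed.

Lemma cyc_xv : x * v = - (v * x).
Proof.
cyc_vanish.
- by nc_expand (cyc_rx1, nc_rule cyc_px_v, nc_rule cyc_g_v); nc_ring K.
- by nc_expand (cyc_ry1, nc_rule cyc_py_v); nc_ring K.
- by nc_expand (cyc_rz1, nc_rule cyc_pz_v, nc_rule cyc_yy, cyc_xxy); nc_close K.
Qed.

Definition cyc_rxx := (nc_rule cyc_px_v, nc_rule cyc_px_w0, nc_rule cyc_px_z1, nc_rule (ss_px_z S)).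
Definition cyc_ryy := (nc_rule cyc_py_v, nc_rule cyc_py_w0, nc_rule cyc_py_z1, nc_rule (ss_py_z S)).

(** Both block derivations commute with z, w0, z1 and v, so the content of each relation is its [pz]
    part, for which [rules] is supplied. *)
Ltac cyc_relation rules :=
  cyc_vanish; [by nc_expand cyc_rxx; nc_ring K | by nc_expand cyc_ryy; nc_ring K
              | by nc_expand rules; nc_close K].

Lemma cyc_zz : z * z = 0.
Proof. cyc_relation (nc_rule (ss_pz_z S), nc_rule (ss_h_z S)). Qed.
Lemma cyc_w0w0 : w0 * w0 = 0.
Proof. cyc_relation (nc_rule cyc_pz_w0, nc_rule cyc_h_w0, nc_rule cyc_yw0). Qed.
Lemma cyc_z1z1 : z1 * z1 = 0.
Proof. cyc_relation (nc_rule cyc_pz_z1, nc_rule cyc_h_z1, nc_rule cyc_h_w0, nc_rule cyc_xz1, nc_rule cyc_xw0, nc_rule cyc_yz1, nc_rule cyc_yw0). Qed.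
Lemma cyc_w0z : w0 * z = z * w0.
Proof. cyc_relation (nc_rule cyc_pz_w0, nc_rule (ss_pz_z S), nc_rule cyc_h_w0, nc_rule (ss_h_z S), nc_rule cyc_yz). Qed.
Lemma cyc_z1z : z1 * z = z * z1.
Proof. cyc_relation (nc_rule cyc_pz_z1, nc_rule (ss_pz_z S), nc_rule cyc_h_z1, nc_rule (ss_h_z S), nc_rule cyc_xz, nc_rule cyc_yz). Qed.
Lemma cyc_z1w0 : z1 * w0 = - (w0 * z1).
Proof. cyc_relation (nc_rule cyc_pz_z1, nc_rule cyc_pz_w0, nc_rule cyc_h_z1, nc_rule cyc_h_w0, nc_rule cyc_xw0, nc_rule cyc_yw0, nc_rule cyc_yz1). Qed.
Lemma cyc_vz : v * z = - (z * v) - w0 * z1.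
Proof. cyc_relation (nc_rule cyc_pz_v, nc_rule cyc_pz_z1, nc_rule cyc_pz_w0, nc_rule (ss_pz_z S), nc_rule cyc_h_v, nc_rule cyc_h_z1, nc_rule cyc_h_w0, nc_rule (ss_h_z S), nc_rule cyc_xz1, nc_rule cyc_xw0, nc_rule cyc_xz, nc_rule cyc_yz1, nc_rule cyc_yw0, nc_rule cyc_yz). Qed.
Lemma cyc_vw0 : v * w0 = - (w0 * v).
Proof. cyc_relation (nc_rule cyc_pz_v, nc_rule cyc_pz_w0, nc_rule cyc_h_v, nc_rule cyc_h_w0, nc_rule cyc_xv, nc_rule cyc_xw0, nc_rule cyc_yv, nc_rule cyc_yw0). Qed.
Lemma cyc_vz1 : v * z1 = - (z1 * v) + w0 * v.
Proof. cyc_relation (nc_rule cyc_pz_v, nc_rule cyc_pz_z1, nc_rule cyc_pz_w0, nc_rule cyc_h_v, nc_rule cyc_h_z1, nc_rule cyc_h_w0, nc_rule cyc_xv, nc_rule cyc_xz1, nc_rule cyc_xw0, nc_rule cyc_yv, nc_rule cyc_yz1, nc_rule cyc_yw0). Qed.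
Lemma cyc_vv : v * v = 0.
Proof. cyc_relation (nc_rule cyc_pz_v, nc_rule cyc_h_v, nc_rule cyc_xv, nc_rule cyc_yv). Qed.

Definition cyc_fam i : R := nth 0 [:: z; w0; z1; v] i.
(** The numbers of letters in z, w0, z1, v. The default 4 lets a degree bound D = 4 single out the
    indices where [cyc_fam] is zero. *)
Definition cyc_deg i : nat := nth 4 [:: 1; 2; 2; 3]%N i.

Lemma anticomm_pow (a u : R) n : a * u = - (u * a) -> a * u ^+ n = (-1) ^+ n *: (u ^+ n * a).
Proof.
move=> au; elim: n => [|n IH]; first by rewrite !expr0 mul1r mulr1 scale1r.
rewrite exprSr mulrA IH -scalerAl -(mulrA _ a) au mulrN mulrA -scaleN1r scalerA.
by rewrite -[(-1) ^+ n * -1]exprSr.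
Qed.

Lemma sq0_pow (u : R) n : u * u = 0 -> u ^+ n.+2 = 0.
Proof. by move=> uu; rewrite !exprS mulrA uu mul0r. Qed.

(** All four squares vanish, so the largest monomial z w0 z1 v has weight 1 + 2 + 2 + 3 = 8. [G n]
    only bounds the weight below by n, as each new factor adds at least 1 to it. *)
Lemma cyc_words_vanish (s : seq nat) : (9 <= size s)%N -> \prod_(i <- s) cyc_fam i = 0.
Proof.
pose G n u := exists i j k l, u = z ^+ i * w0 ^+ j * z1 ^+ k * v ^+ l /\
  (n <= i + 2 * j + 2 * k + 3 * l)%N.
have Ggen n i j k l : (n <= i + 2 * j + 2 * k + 3 * l)%N ->
    lspan (G n) (z ^+ i * w0 ^+ j * z1 ^+ k * v ^+ l).
  by move=> le; apply: LSpan_gen; exists i, j, k, l.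
have w0z i : w0 * z ^+ i = z ^+ i * w0 by apply: commrX; exact: cyc_w0z.
have z1z i : z1 * z ^+ i = z ^+ i * z1 by apply: commrX; exact: cyc_z1z.
have z1w0 := fun j => anticomm_pow j cyc_z1w0.
have vw0 := fun j => anticomm_pow j cyc_vw0.
have Gw n i j k l : (n < i + 2 * j + 2 * k + 3 * l + 2)%N ->
    lspan (G n) (w0 * (z ^+ i * w0 ^+ j * z1 ^+ k * v ^+ l)).
  move=> le; rewrite !mulrA w0z -!(mulrA (z ^+ i)) -exprS !mulrA.
  by apply: Ggen; lia.
have Gz1 n i j k l : (n < i + 2 * j + 2 * k + 3 * l + 2)%N ->
    lspan (G n) (z1 * (z ^+ i * w0 ^+ j * z1 ^+ k * v ^+ l)).
  move=> le; rewrite !mulrA z1z -(mulrA (z ^+ i)) z1w0 -scalerAr -!scalerAl mulrA.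
  apply: lspanZ; rewrite -(mulrA _ z1) -exprS; apply: Ggen; lia.
have Gv0 n j k l : (n < 2 * j + 2 * k + 3 * l + 3)%N ->
    lspan (G n) (v * (w0 ^+ j * z1 ^+ k * v ^+ l)).
  move=> le; rewrite !mulrA vw0 -!scalerAl; apply: lspanZ.
  case: k le => [|[|k]] le; last by rewrite (sq0_pow k cyc_z1z1) mulr0 mul0r; exact: LSpan0.
    rewrite expr0 mulr1 -mulrA -exprS.
    by have := @Ggen n 0%N j 0%N l.+1; rewrite !expr0 mul1r mulr1; apply; lia.
  rewrite expr1 -(mulrA _ v) cyc_vz1 mulrDr mulrDl mulrN mulNr !mulrA.
  apply: lspanD.
    apply: lspanN; rewrite -!(mulrA _ v) -exprS.
    by have := @Ggen n 0%N j 1%N l.+1; rewrite !expr0 mul1r expr1; apply; lia.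
  rewrite -exprSr -!(mulrA _ v) -exprS.
  by have := @Ggen n 0%N j.+1 0%N l.+1; rewrite !expr0 mul1r mulr1; apply; lia.
have cz n u : G n u -> lspan (G n.+1) (z * u).
  case=> i [j [k [l [-> le]]]]; have := @Ggen n.+1 i.+1 j k l.
  by rewrite exprS !mulrA; apply; lia.
have cw n u : G n u -> lspan (G n.+1) (w0 * u).
  by case=> i [j [k [l [-> le]]]]; apply: Gw; lia.
have cz1 n u : G n u -> lspan (G n.+1) (z1 * u).
  by case=> i [j [k [l [-> le]]]]; apply: Gz1; lia.
have cv n u : G n u -> lspan (G n.+1) (v * u).
  case=> i [j [k [l [-> le]]]].
  case: i le => [|[|i]] le; last by rewrite (sq0_pow i cyc_zz) !mul0r mulr0; exact: LSpan0.
    by rewrite expr0 mul1r; apply: Gv0; lia.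
  rewrite expr1; set X := w0 ^+ j * z1 ^+ k * v ^+ l.
  have -> : v * (z * w0 ^+ j * z1 ^+ k * v ^+ l) = - (z * (v * X)) - w0 * (z1 * X).
    rewrite -!(mulrA z) -/X mulrA cyc_vz; nc_ring K.
  apply: lspanD; apply: lspanN; [apply: (lspan_mull (cz n)) | apply: (lspan_mull (cw n))].
    by apply: Gv0; lia.
  by have := @Gz1 n 0%N j k l; rewrite expr0 mul1r; apply; lia.
apply: (words_vanish (G := G)) => [|n m u Gu|n u Nn [i [j [k [l [-> le]]]]]].
- by have := @Ggen 0%N 0%N 0%N 0%N 0%N; rewrite !expr0 !mulr1; apply.
- case: m => [|[|[|[|m]]]] /=; [exact: cz Gu | exact: cw Gu | exact: cz1 Gu | exact: cv Gu |].
  by rewrite /cyc_fam nth_default // mul0r; exact: LSpan0.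
have [i2|i2] := ltnP i 2; last by rewrite -(subnK i2) addn2 (sq0_pow _ cyc_zz) !mul0r.
have [j2|j2] := ltnP j 2; last by rewrite -(subnK j2) addn2 (sq0_pow _ cyc_w0w0) mulr0 !mul0r.
have [k2|k2] := ltnP k 2; last by rewrite -(subnK k2) addn2 (sq0_pow _ cyc_z1z1) mulr0 mul0r.
have [l2|l2] := ltnP l 2; last by rewrite -(subnK l2) addn2 (sq0_pow _ cyc_vv) mulr0.
lia.
Qed.

Lemma cyclops_words_vanish (E : 'I_3 -> R) : E ord0 = x -> E 1 = y -> E ord_max = z ->
  exists N, forall w, (N <= size w)%N -> \prod_(k <- w) E k = 0.
Proof.
move=> E0 E1 E2; exists (9 * 4 + 4 * p)%N.
apply: (smash_words_vanish (z := cyc_fam) (d := cyc_deg) E0 E1 E2) => //.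
- pose G i := fun u => (exists j b', cyc_deg j = cyc_deg i /\ u = cyc_fam j * (if b' : bool then x else y)) \/
                               (exists j, cyc_deg j = (cyc_deg i).+1 /\ u = cyc_fam j).
  have Gx i j : cyc_deg j = cyc_deg i -> lspan (G i) (cyc_fam j * x).
    by move=> e; apply: LSpan_gen; left; exists j, true.
  have Gy i j : cyc_deg j = cyc_deg i -> lspan (G i) (cyc_fam j * y).
    by move=> e; apply: LSpan_gen; left; exists j, false.
  have Gs i j : cyc_deg j = (cyc_deg i).+1 -> lspan (G i) (cyc_fam j).
    by move=> e; apply: LSpan_gen; right; exists j.
  move=> b [|[|[|[|i]]]]; rewrite -/(G _).
  + rewrite /cyc_fam /=; case: b.
      rewrite cyc_xz; apply: lspanD; first exact: (Gs _ 2).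
      by apply: lspanN; exact: (Gx _ 0).
    rewrite cyc_yz; apply: lspanD; first exact: (Gs _ 1).
    by apply: lspanN; exact: (Gy _ 0).
  + rewrite /cyc_fam /=; case: b.
      rewrite cyc_xw0; apply: lspanD; first exact: (Gx _ 1).
      by apply: lspanZ; exact: (Gs _ 3).
    by rewrite cyc_yw0; exact: (Gy _ 1).
  + rewrite /cyc_fam /=; case: b.
      rewrite cyc_xz1 mulrBl; apply: lspanD; last by apply: lspanN; exact: (Gs _ 3).
      apply: lspanD; first exact: (Gx _ 2).
      by apply: lspanN; exact: (Gx _ 1).
    rewrite cyc_yz1 mulrBl; apply: lspanD; last first.
      by apply/lspanN/lspanZ; exact: (Gs _ 3).
    apply: lspanD; first exact: (Gy _ 2).
    by apply: lspanN; exact: (Gy _ 1).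
  + rewrite /cyc_fam /=; case: b; rewrite ?cyc_xv ?cyc_yv; apply: lspanN; first exact: (Gx _ 3).
    exact: (Gy _ 3).
  by rewrite /cyc_fam nth_default // mulr0; exact: LSpan0.
- by move=> [|[|[|[|i]]]] //= _; rewrite /cyc_fam nth_default.
- exact: cyc_words_vanish.
exact: (super_words_vanish S pK (erefl (x * y + y * x))).
Qed.
End Cyclops.

(** * Twisting away [q21] *)

Section Twist.
Variable K : fieldType.
Variable A : 'I_3 -> 'I_3 -> 'I_3 -> K.
Hypothesis A_block : forall i k j, A i k j != 0 -> (k == ord_max) = (j == ord_max).
Implicit Types (al be : K).

(** The braiding preserves the bidegree that counts block letters and letters x_3, so rescaling by
    bidegree commutes with the group-likes. *)
Definition scale_of al be (k : 'I_3) := if k == ord_max then be else al.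

Lemma wlin_diag al be :
  @wlinear K (fun phi w => (\prod_(k <- w) scale_of al be k) * phi w).
Proof. by move=> c phi psi w; rewrite mulrDr mulrCA. Qed.
Definition diag_op al be := Oper (wlin_diag al be).

Lemma diag_op_M al be al' be' :
  diag_op al be * diag_op al' be' = diag_op (al * al') (be * be').
Proof.
apply: operP => phi w; rewrite operME /= mulrA -big_split /=; congr (_ * _).
by apply: eq_bigr => k _; rewrite /scale_of; case: ifP.
Qed.

Lemma diag_op_comm al be al' be' :
  diag_op al be * diag_op al' be' = diag_op al' be' * diag_op al be.
Proof. by rewrite !diag_op_M (mulrC al) (mulrC be). Qed.

Lemma diag_op1 : diag_op 1 1 = 1.
Proof.
apply: operP => phi w /=; rewrite big1 ?mul1r // => k _.
by rewrite /scale_of; case: ifP.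
Qed.

Lemma stripl_diag k al be :
  stripl K k * diag_op al be = scale_of al be k *: (diag_op al be * stripl K k).
Proof. by apply: operP => phi w; rewrite /= big_cons mulrA. Qed.

Lemma diag_gop al be i : diag_op al be * gop A i = gop A i * diag_op al be.
Proof.
apply/eqP; rewrite -subr_eq0; apply/eqP; apply: op_vanish => [phi|k].
  by rewrite operDE operNE /= big_nil !mul1r subrr.
exists (scale_of al be k *: \sum_j A i k j *: stripl K j).
rewrite mulrBr mulrBl !mulrA stripl_diag stripl_gop -scalerAl -mulrA stripl_gop; congr (_ - _).
  rewrite -scalerAr !mulr_sumr; congr (_ *: _); apply: eq_bigr => j _.
  by rewrite -!scalerAr mulrA.
rewrite mulr_suml -scalerAr mulr_sumr scaler_sumr; apply: eq_bigr => j _.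
rewrite -scalerAl -(mulrA _ (stripl K j)) stripl_diag.
have [->|/A_block E] := eqVneq (A i k j) 0; first by nc_ring K.
by rewrite /scale_of E; nc_ring K.
Qed.

Lemma diag_eop al be l :
  diag_op al be * eop A l = scale_of al be l *: (eop A l * diag_op al be).
Proof.
apply/eqP; rewrite -subr_eq0; apply/eqP; apply: op_vanish => [phi|k].
  by rewrite operDE operNE operZE !operME /= !mulr0 subrr.
exists (scale_of al be k *: stripl K k).
have E1 : stripl K k * (diag_op al be * eop A l) = scale_of al be k *:
    (diag_op al be * eop A l * stripl K k + (k == l)%:R *: (gop A l * diag_op al be)).
  rewrite mulrA stripl_diag -scalerAl -(mulrA _ (stripl K k)) stripl_eop -diag_gop.
  by move: (k == l)%:R => r; nc_ring K.
have E2 : stripl K k * (eop A l * diag_op al be) = scale_of al be k *: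
    (eop A l * diag_op al be * stripl K k) + (k == l)%:R *: (gop A l * diag_op al be).
  rewrite mulrA stripl_eop mulrDl -(mulrA _ (stripl K k)) stripl_diag.
  by move: (k == l)%:R => r; nc_ring K.
rewrite mulrBr -scalerAr E1 E2; have [->|_] := eqVneq k l.
  by rewrite !scale1r; nc_ring K.
by rewrite !scale0r; nc_ring K.
Qed.

(** The diagonal operators move to the right at the cost of nonzero scalars and collect into one
    invertible diagonal operator, which can be cancelled. *)
Lemma twist_words (E' : 'I_3 -> oper K) (s al be : 'I_3 -> K) w :
  (forall k, [/\ s k != 0, al k != 0 & be k != 0]) ->
  (forall k, E' k = s k *: (eop A k * diag_op (al k) (be k))) ->
  \prod_(k <- w) E' k = 0 -> eword A w = 0.
Proof.
move=> nz EE.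
have [r [a' [b' [[r0 a0 b0] ->]]]] : exists r a' b', [/\ r != 0, a' != 0 & b' != 0] /\
    \prod_(k <- w) E' k = r *: (eword A w * diag_op a' b').
  elim: w => [|k w [r [a' [b' [[r0 a0 b0] IH]]]]].
    exists 1, 1, 1; rewrite oner_neq0; split=> //.
    by rewrite /eword !big_nil diag_op1 mulr1 scale1r.
  have [r' [r'0 E]] : exists r', r' != 0 /\
      diag_op (al k) (be k) * eword A w = r' *: (eword A w * diag_op (al k) (be k)).
    elim: w {IH} => [|l w [r' [r'0 IH]]].
      by exists 1; rewrite oner_neq0 /eword big_nil mul1r mulr1 scale1r.
    exists (scale_of (al k) (be k) l * r'); split.
      by rewrite mulf_neq0 // /scale_of; case: ifP; case: (nz k).
    rewrite /eword big_cons -/(eword A w) mulrA diag_eop -scalerAl.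
    by rewrite -(mulrA (eop A l) (diag_op _ _)) IH -scalerAr scalerA mulrA.
  exists (s k * r * r'), (al k * a'), (be k * b').
  have [s0 al0 be0] := nz k; split; first by rewrite !mulf_neq0.
  have -> : \prod_(l <- k :: w) E' l = (s k * r) *:
      (eop A k * (diag_op (al k) (be k) * eword A w) * diag_op a' b').
    by rewrite big_cons IH EE; nc_ring K.
  by rewrite E -diag_op_M /eword big_cons -/(eword A w); nc_ring K.
move=> /eqP; rewrite scaler_eq0 (negPf r0) /= => /eqP /(congr1 (fun u => u * diag_op a'^-1 b'^-1)).
by rewrite mul0r -mulrA diag_op_M !divff // diag_op1 mulr1.
Qed.
End Twist.

(** * The braiding of the statement as a skew system *)

Section Concrete.
Variables (K : fieldType) (eps q12 q21 q22 a : K).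
Hypothesis q21_neq0 : q21 != 0.
Let A := braid_coef eps q12 q21 q22 a.

Lemma ord3_cases (P : 'I_3 -> Prop) : P ord0 -> P 1 -> P ord_max -> forall i, P i.
Proof.
move=> P0 P1 P2 [[|[|[|//]]] lt].
- by rewrite (_ : Ordinal lt = ord0) //; exact: val_inj.
- by rewrite (_ : Ordinal lt = 1) //; exact: val_inj.
- by rewrite (_ : Ordinal lt = ord_max) //; exact: val_inj.
Qed.

Lemma sum_ord3 (V : zmodType) (F : 'I_3 -> V) : \sum_i F i = F ord0 + F 1 + F ord_max.
Proof.
rewrite !big_ord_recr big_ord0 /= add0r.
by congr (F _ + F _ + F _); exact: val_inj.
Qed.

Lemma braid_comm i j l n : \sum_m A i l m * A j m n = \sum_m A j l m * A i m n.
Proof.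
rewrite !sum_ord3 /A.
move: i j l n; do 4 elim/ord3_cases; rewrite /braid_coef /=; ring.
Qed.

Lemma braid_deg i j k : A i j k != 0 -> A j = A k.
Proof.
by rewrite /A; move: i j k; do 3 elim/ord3_cases; rewrite /braid_coef /= ?eqxx.
Qed.

Lemma braid_block i k j : A i k j != 0 -> (k == ord_max) = (j == ord_max).
Proof.
by rewrite /A; move: i j k; do 3 elim/ord3_cases; rewrite /braid_coef /= ?eqxx.
Qed.

Variable u : K.
Hypothesis u0 : u != 0.

Local Notation E0 := (eop A ord0).
Local Notation E1 := (eop A 1).
Local Notation E2 := (eop A ord_max).
Local Notation G := (gop A ord0).
Local Notation H := (gop A ord_max).
Local Notation P k := (stripl K k).
Local Notation T := (diag_op q21^-1 1).
Local Notation t := (diag_op 1 q21).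

(** Transposition reverses the block, so the dual of x_1 plays x and that of x_2, rescaled by u,
    plays y. [T] cancels the scalar q21 of [H] on the block; [t] makes [oppx] and [oppy] commute
    with [opz] in return and gives [opg] the eigenvalue q12 q21 on [opz]. *)
Definition opx : oper K := E0.
Definition opy : oper K := u *: E1.
Definition opz : oper K := E2 * T.
Definition oppx : oper K := t * P ord0.
Definition oppy : oper K := u^-1 *: (t * P 1).
Definition oppz : oper K := P ord_max.
Definition opg : oper K := G * t.
Definition oph : oper K := H * T.

Lemma gop1 : gop A 1 = G. Proof. by []. Qed.

Lemma braid_skew_system :
  skew_system eps (q12 * q21) q22 (a * u^-1) u^-1 opx opy opz oppx oppy oppz opg oph
    (fun Y : oper K => forall phi, Y phi [::] = 0).
Proof.
have pe k l : k != l -> P k * eop A l = eop A l * P k.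
  by move=> /negPf kl; rewrite stripl_eop kl scale0r addr0.
have pe' k : P k * eop A k = eop A k * P k + gop A k.
  by rewrite stripl_eop eqxx scale1r.
have p01 := nc_rule (@pe ord0 1 isT); have p02 := nc_rule (@pe ord0 ord_max isT).
have p10 := nc_rule (@pe 1 ord0 isT); have p12 := nc_rule (@pe 1 ord_max isT).
have p20 := nc_rule (@pe ord_max ord0 isT); have p21 := nc_rule (@pe ord_max 1 isT).
have p00 := nc_rule (pe' ord0); have p11 := nc_rule (pe' 1); have p22 := nc_rule (pe' ord_max).
have pp := (p00, p01, p02, (p10, p11, p12), (p20, p21, p22)).
rewrite gop1 in p11 pp.
have dE al be l : diag_op al be * eop A l = scale_of al be l *: (eop A l * diag_op al be).
  exact: (diag_eop braid_block al be l).
have dG al be i : diag_op al be * gop A i = gop A i * diag_op al be.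
  exact: (diag_gop braid_block al be i).
have te := (nc_rule (dE 1 q21 ord0), nc_rule (dE 1 q21 1), nc_rule (dE 1 q21 ord_max)).
have Te := (nc_rule (dE q21^-1 1 ord0), nc_rule (dE q21^-1 1 1), nc_rule (dE q21^-1 1 ord_max)).
have dg := (nc_rule (dG 1 q21 ord0), nc_rule (dG q21^-1 1 ord0), nc_rule (dG 1 q21 ord_max),
  nc_rule (dG q21^-1 1 ord_max)).
have pT := (nc_rule (stripl_diag ord0 q21^-1 1), nc_rule (stripl_diag 1 q21^-1 1),
  nc_rule (stripl_diag ord_max q21^-1 1)).
have Tt := nc_rule (diag_op_comm q21^-1 1 1 q21).
have Ge := gop_eop braid_comm braid_deg.
have g0 : G * E0 = (eps *: E0 + E1) * G.
  by rewrite Ge sum_ord3 /A /braid_coef /= scale0r addr0 scale1r mulrDl -scalerAl.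
have g1 : G * E1 = eps *: (E1 * G).
  by rewrite Ge sum_ord3 /A /braid_coef /= !scale0r addr0 add0r.
have g2 : G * E2 = q12 *: (E2 * G).
  by rewrite Ge sum_ord3 /A /braid_coef /= !scale0r !add0r.
have h0 : H * E0 = q21 *: ((E0 + a *: E1) * H).
  by rewrite Ge sum_ord3 /A /braid_coef /= scale0r addr0; nc_ring K.
have h1 : H * E1 = q21 *: (E1 * H).
  by rewrite Ge sum_ord3 /A /braid_coef /= !scale0r addr0 add0r.
have h2 : H * E2 = q22 *: (E2 * H).
  by rewrite Ge sum_ord3 /A /braid_coef /= !scale0r !add0r.
have gh := ((nc_rule g0, nc_rule g1, nc_rule g2), (nc_rule h0, nc_rule h1, nc_rule h2)).
have aug_nil (Y : oper K) l phi : (eop A l * Y) phi [::] = 0 by [].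
rewrite /opx /opy /opz /oppx /oppy /oppz /opg /oph.
split.
all: try by nc_expand (pp, te, Te, dg, pT, gh, Tt); rewrite /scale_of /=; nc_ring K; field;
  rewrite ?u0 ?q21_neq0.
- by [].
- by move=> phi; rewrite operZE /= mulr0.
- by [].
- by move=> Y Z H0 phi; rewrite operME H0.
- by move=> Y Z H1 H2 phi; rewrite operDE H1 H2 addr0.
- by move=> s Y H0 phi; rewrite operZE H0 mulr0.
move=> Y Y0 Y1 Y2 Y3; apply: (@op_eq0_left K unit (fun=> Y)) => [_|_ k phi w IH|]; [exact: Y0 | | exact: tt].
(* [oppx] and [oppy] are deletions composed with the invertible [t]; cancelling it brings back the
   deletions that the induction on words requires. *)
have tK : diag_op 1 q21^-1 * t = 1 by rewrite diag_op_M mulr1 mulVf // diag_op1.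
have H k' : t * P k' * Y = Y * (t * P k') -> (P k' * Y) phi w = 0.
  move=> E; have -> : P k' * Y = diag_op 1 q21^-1 * (Y * (t * P k')).
    by rewrite -E -!mulrA mulrA tK mul1r.
  have Z : (Y * (t * P k')) phi w = 0 by rewrite operME (IH tt).
  by rewrite operME -[LHS]/(_ * (Y * (t * P k')) phi w) Z mulr0.
move: k; apply: ord3_cases; [exact: H | apply: H | by rewrite Y3 operME (IH tt)].
by move: Y2; rewrite -scalerAl -scalerAr => /(scalerI (invr_neq0 u0)).
Qed.

Lemma braid_words_vanish :
  (exists N, forall w : seq 'I_3, (N <= size w)%N ->
    \prod_(k <- w) (if k == ord0 then opx else if k == 1 then opy else opz) = 0) ->
  nichols_finite_dim A.
Proof.
move=> [N HN]; apply: (nichols_finite_dim_of_nilpotent braid_comm braid_deg); exists N => w Nw.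
apply: (@twist_words K A braid_block _ (fun k : 'I_3 => if k == 1 then u else 1)
  (fun k : 'I_3 => if k == ord_max then q21^-1 else 1) (fun=> 1) w _ _ (HN w Nw)).
  by apply: ord3_cases => /=; rewrite ?invr_eq0 ?u0 ?oner_neq0 ?invr_neq0.
by apply: ord3_cases; rewrite /= ?diag_op1 ?mulr1 ?scale1r.
Qed.
End Concrete.

Theorem theorem4p1 (K : closedFieldType) (p : nat) (eps q12 q21 q22 a : K) :
  p \in [pchar K] -> (2 < p)%N ->
  (eps = 1 \/ eps = -1) ->
  q12 != 0 -> q21 != 0 -> q22 != 0 ->
  ([/\ eps = 1, q12 * q21 = 1, q22 = 1 & Fp_unit a]
   \/ [/\ eps = 1, q12 * q21 = 1, q22 = -1 & Fp_unit a]
   \/ [/\ eps = 1, q12 * q21 = 1, 3.-primitive_root q22 & 2%:R * a = -1]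
   \/ [/\ eps = -1, q12 * q21 = 1, q22 = 1 & Fp_unit a]
   \/ [/\ eps = -1, q12 * q21 = 1, q22 = -1 & Fp_unit a]
   \/ [/\ eps = -1, q12 * q21 = -1, q22 = -1 & a = 1]) ->
  nichols_finite_dim (braid_coef eps q12 q21 q22 a).
Proof.
move=> pK p2 _ _ q210 _ cases.
have two0 : 2%:R != 0 :> K.
  rewrite -(dvdn_pcharf pK); apply: contraL p2 => /(dvdn_leq (isT : (0 < 2)%N)).
  by rewrite -leqNgt.
(* u = -1/2 gives c = -2 and b = -2a in the Jordan cases; u = 1 gives c = 1 and b = a in the super
   cases. *)
have u0 : (- 2%:R)^-1 != 0 :> K by rewrite invr_eq0 oppr_eq0.
have Sjordan := braid_skew_system 1 q12 q22 a q210 u0.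
have Ssuper := braid_skew_system (-1) q12 q22 a q210 (oner_neq0 K).
rewrite invr1 mulr1 in Ssuper; rewrite invrK in Sjordan.
have sq1 : 1 * 1 = 1 :> K by rewrite mulr1.
have sqN1 : -1 * -1 = 1 :> K by rewrite mulrNN mulr1.
case: cases => [[-> e q _]|[[-> e q _]|[[-> e q ha]|[[-> e q _]|[[-> e q _]|[-> e q ha]]]]]].
- apply: (braid_words_vanish q210 u0); rewrite e q in Sjordan *.
  exact: (weak_jordan_words_vanish Sjordan pK).
- apply: (braid_words_vanish q210 u0); rewrite e q in Sjordan *.
  exact: (weak_jordan_words_vanish Sjordan pK).
- apply: (braid_words_vanish q210 u0); rewrite e in Sjordan.
  apply: (cube_jordan_words_vanish Sjordan pK) => //.
    by rewrite mulrN mulrC ha opprK.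
  have q3 : (q22 - 1) * (1 + q22 + q22 * q22) = 0.
    have -> : (q22 - 1) * (1 + q22 + q22 * q22) = q22 ^+ 3 - 1 by ring.
    by rewrite (prim_expr_order q) subrr.
  have q1 : q22 - 1 != 0.
    by rewrite subr_eq0; have := prim_order_dvd q 1; rewrite expr1 => <-.
  by move/eqP: q3; rewrite mulf_eq0 (negPf q1) => /eqP.
- apply: (braid_words_vanish q210 (oner_neq0 K)); rewrite e q in Ssuper *.
  exact: (weak_super_words_vanish Ssuper pK erefl).
- apply: (braid_words_vanish q210 (oner_neq0 K)); rewrite e q in Ssuper *.
  exact: (weak_super_words_vanish Ssuper pK erefl).
apply: (braid_words_vanish q210 (oner_neq0 K)); rewrite e q ha in Ssuper *.
exact: (cyclops_words_vanish Ssuper pK erefl erefl erefl).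
Qed.
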